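(* Let $X$ be a compact $2$-dimensional complex manifold with a holomorphic foliation $\mathcal{F}$ of complex dimension $1$ all of whose leaves are parabolic. If the bundle $E=\Lambda^{(0,1)}T^*\mathcal{N}\otimes\Lambda^{(1,0)}T^*\mathcal{F}$ over $(X,\mathcal{F})$ has a strictly negative curvature along the leaves, then the invariant $\Gamma$ vanishes identically and there exist holomorphic cylinders along the foliation.
   Context: Setting. $J$ is the complex structure of $X$. A leaf is parabolic if its universal covering is biholomorphic to $\mathbb{C}$. $L_p$ is the leaf through $p$; $T\mathcal{F}$ is the tangent bundle of the foliation; $T\mathcal{N}=TX/T\mathcal{F}$. $\mathbb{D}$ is the unit disk of $\mathbb{C}$; points of $\mathbb{D}\times\mathbb{C}$ are written $(x,y)$. A holomorphic cylinder along the foliation is an immersed holomorphic map $F:\mathbb{D}\times\mathbb{C}\to X$ such that for every $x\in\mathbb{D}$, $\{x\}\times\mathbb{C}$ is sent onto a leaf. The bundle $E$. Its fiber at a point is the space of maps $T\mathcal{N}\times T\mathcal{F}\to\mathbb{C}$ that are $\mathbb{C}$-antilinear in the first and $\mathbb{C}$-linear in the second variable. In a holomorphic foliated chart $(x,y)$ (leaves being locally $x=\mathrm{const}$), sections are $g(x,y)\,d\bar{x}\otimes dy$, and a section is holomorphic along the leaves if $g$ is holomorphic in $y$; this makes $E$ a leaf-wise holomorphic line bundle. Strictly negative curvature along the leaves means that $E$ has a smooth Hermitian metric whose restriction to each leaf has everywhere strictly negative Chern curvature. The class $\mathcal{C}$. Let $D\subset X$ be a holomorphic disk transverse to $\mathcal{F}$,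 holomorphically parametrized by $\mathbb{D}$, $x\mapsto p(x)$, and let $t:x\mapsto t_x\in T_{p(x)}\mathcal{F}$ be a holomorphic trivialization of $T\mathcal{F}$ along $D$. For each $x$ let $F_x:\mathbb{C}\to L_{p(x)}$ be the unique holomorphic universal covering map with $F_x(0)=p(x)$ and $dF_x(0)(1)=t_x$. Put $F(x,y)=F_x(y)$. $\mathcal{C}$ is the set of all such maps $F:\mathbb{D}\times\mathbb{C}\to X$. Standing assumption: every $F\in\mathcal C$ is a smooth immersion (onto the union of the leaves meeting $D$). The invariant $\Gamma$. For $F\in\mathcal{C}$, let $V_F$ be an open neighborhood of $F(0,0)$ on which $F$ has a local inverse $F^{-1}=((F^{-1})_1,(F^{-1})_2):V_F\to U_0$, $U_0$ a neighborhood of $(0,0)$. Define the $\mathbb{C}$-valued $1$-form $\lambda_F(Z)=d(F^{-1})_2(JZ)-i\,d(F^{-1})_2(Z)$ on $V_F$, and the $\mathbb{C}$-valued $1$-form $A_F$ on $V_F$ by $A_F(Z)\,d(F^{-1})_2(Y)=d\lambda_F(Z,Y)$ for $Z\in TX$, $Y\in T\mathcal{F}$. Then $\Gamma_F=(dA_F)_{|TX\times T\mathcal{F}}$ does not depend on $F$ on overlaps of the sets $V_F$, and $\Gamma$ is the tensor on $X$ equal to $\Gamma_F$ on each $V_F$. *)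

(* Defs.v *)
From HB Require Import structures.
From mathcomp Require Import all_boot all_order all_algebra complex.
From mathcomp Require Import all_classical all_reals all_analysis.

Set Implicit Arguments.
Unset Strict Implicit.
Unset Printing Implicit Defensive.

Import Order.TTheory GRing.Theory Num.Theory numFieldNormedType.Exports.

Local Open Scope classical_set_scope.
Local Open Scope complex_scope.
Local Open Scope ring_scope.

(* The complex numbers R[i], packaged so that the topology and the normed space
   structure over itself of a numClosedFieldType are found. *)
Definition cplx (R : realType) : numClosedFieldType := R[i].

(* Points, and tangent vectors, of C^2; derivatives of maps out of [C2 R] in
   the sense of the library ('D_v, differentiable) are complex derivatives. *)
Notation C2 R := (cplx R * cplx R)%type.

Section RealCalculus.
Variable R : realType.
Local Notation C := (cplx R).
Implicit Types (f : C2 R -> C) (v z : C2 R).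

(* C^2 is seen as a real vector space: only real increments t are used. *)
Definition real_derivable v f z : Prop :=
  derivable (fun t : R => complex.Re (f (z + t%:C *: v))) 0 1 /\
  derivable (fun t : R => complex.Im (f (z + t%:C *: v))) 0 1.

Definition real_derive v f z : C :=
  derive1 (fun t : R => complex.Re (f (z + t%:C *: v))) 0 +i*
  derive1 (fun t : R => complex.Im (f (z + t%:C *: v))) 0.

(* For open O: class C^k, resp. C^infty, on O in the real sense. *)
Fixpoint class_Ck (k : nat) (O : set (C2 R)) f : Prop :=
  (forall z, O z -> {for z, continuous f}) /\
  if k is k'.+1 then
    forall v, (forall z, O z -> real_derivable v f z) /\
              class_Ck k' O (real_derive v f)
  else True.

Definition smooth_on (O : set (C2 R)) f : Prop := forall k, class_Ck k O f.

(* Wirtinger derivatives in the second (leaf) variable y. *)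
Definition dy f z : C :=
  (real_derive (0, 1) f z - 'i * real_derive (0, 'i) f z) / 2.
Definition dybar f z : C :=
  (real_derive (0, 1) f z + 'i * real_derive (0, 'i) f z) / 2.

(* Exterior derivative of a C-valued real 1-form on an open subset of C^2;
   z |-> alpha z Z is the contraction with the constant vector field Z. *)
Definition ext_d (alpha : C2 R -> C2 R -> C) z (Z Y : C2 R) : C :=
  real_derive Z (fun w => alpha w Y) z - real_derive Y (fun w => alpha w Z) z.

End RealCalculus.

(* f : S -> T is a covering of the open subset L of T. *)
Definition covering_map (S T : topologicalType) (f : S -> T) (L : set T) : Prop :=
  [/\ continuous f, range f = L &
    forall q, L q -> exists P : set T, [/\ open P, P q, P `<=` L &
      exists (I : Type) (W : I -> set S),
        [/\ forall i, open (W i), trivIset setT W,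
            f @^-1` P = \bigcup_i W i &
            forall i, set_bij (W i) P f /\
              forall O, open O -> O `<=` W i -> open (f @` O)]]].

(* A complex structure of dimension 2 on X together with a holomorphic
   foliation by curves, given by an atlas of foliated holomorphic charts:
   [phi a] is a homeomorphism of the open set [dom a] onto an open subset of
   C^2, with inverse [psi a] there; the transition maps are holomorphic and
   preserve the direction of the second coordinate, that is, they map leaves
   x = const to leaves x = const locally. *)
Record foliatedSurface (R : realType) (X : topologicalType) := FoliatedSurface {
  chart : Type;
  dom : chart -> set X;
  phi : chart -> X -> C2 R;
  psi : chart -> C2 R -> X;
  dom_open : forall a, open (dom a);
  dom_cover : forall p, exists a, dom a p;
  cod_open : forall a, open (phi a @` dom a);
  phi_continuous : forall a p, dom a p -> {for p, continuous (phi a)};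
  psi_continuous : forall a z, (phi a @` dom a) z -> {for z, continuous (psi a)};
  phiK : forall a p, dom a p -> psi a (phi a p) = p;
  transition_holomorphic : forall a b z, (phi a @` (dom a `&` dom b)) z ->
    differentiable (phi b \o psi a) z;
  transition_foliated : forall a b z, (phi a @` (dom a `&` dom b)) z ->
    ('D_(0, 1) (phi b \o psi a) z).1 = 0 }.

Section LeafTopology.
Variables (R : realType) (X : topologicalType) (F : foliatedSurface R X).

(* Open sets of the leaf topology, whose basis is made of the open subsets of
   the plaques x = const. *)
Definition leaf_open : set_system X := [set S : set X |
  forall p a, S p -> dom a p ->
    \forall y \near nbhs (phi (f := F) a p).2, S (psi a ((phi a p).1, y))].

(* X with the leaf topology: the disjoint union of the leaves. *)
Definition leafwise : Type := (fun=> X : Type) F.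

HB.instance Definition _ := Choice.copy leafwise X.

Lemma leaf_openT : leaf_open [set: leafwise].
Proof. by move=> p a _ _; near=> y. Unshelve. all: by end_near. Qed.

Lemma leaf_openI : setI_closed (leaf_open : set_system leafwise).
Proof.
move=> A B oA oB p a [Ap Bp] ap; near=> y; split.
  by near: y; exact: oA.
by near: y; exact: oB.
Unshelve. all: by end_near. Qed.

Lemma leaf_open_bigcup (I : Type) (f : I -> set leafwise) :
  (forall i, leaf_open (f i)) -> leaf_open (\bigcup_i f i).
Proof.
move=> of_ p a [i _ fip] ap; near=> y; exists i => //.
by near: y; exact: of_.
Unshelve. all: by end_near. Qed.

HB.instance Definition _ := isOpenTopological.Build leafwise
  leaf_openT leaf_openI leaf_open_bigcup.

Definition leaf (p : X) : set X := @connected_component leafwise setT p.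

End LeafTopology.

Section FoliatedSurface.
Variables (R : realType) (X : topologicalType) (F : foliatedSurface R X).
Local Notation C := (cplx R).

Definition disk : set C := [set x | `|x| < 1].
Definition cylinder : set (C2 R) := [set z | disk z.1].

Definition transition (a b : chart F) : C2 R -> C2 R := phi b \o psi a.

(* A tangent vector at p is the family of its coordinates in the charts around
   p (the values at the other charts are irrelevant). *)
Definition tangent (p : X) (v : chart F -> C2 R) : Prop :=
  forall a b, dom a p -> dom b p -> v b = 'D_(v a) (transition a b) (phi a p).

Definition tangentF (p : X) (v : chart F -> C2 R) : Prop :=
  tangent p v /\ forall a, dom a p -> (v a).1 = 0.

(* As C is simply connected, a holomorphic covering C -> L is a universal
   covering of L by C. *)
Definition universal_covering (f : C -> X) (L : set X) : Prop :=
  @covering_map C (leafwise F) f L /\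
  forall y a, dom a (f y) -> derivable (fun w => (phi (f := F) a (f w)).2) y 1.

Definition parabolic (L : set X) : Prop := exists f, universal_covering f L.

Definition smooth_immersion (Phi : C2 R -> X) : Prop :=
  [/\ forall z, cylinder z -> {for z, continuous Phi},
      forall a : chart F,
        smooth_on (cylinder `&` Phi @^-1` dom a) (fun z => (phi a (Phi z)).1) /\
        smooth_on (cylinder `&` Phi @^-1` dom a) (fun z => (phi a (Phi z)).2) &
      forall z (a : chart F) v, cylinder z -> dom a (Phi z) ->
        real_derive v (fun z => (phi a (Phi z)).1) z = 0 ->
        real_derive v (fun z => (phi a (Phi z)).2) z = 0 -> v = 0].

Definition holomorphic_immersion (Phi : C2 R -> X) : Prop :=
  (forall z, cylinder z -> {for z, continuous Phi}) /\
  forall z (a : chart F), cylinder z -> dom a (Phi z) ->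
    differentiable (phi a \o Phi) z /\
    forall v, 'D_v (phi a \o Phi) z = 0 -> v = 0.

Definition holomorphic_cylinder (Phi : C2 R -> X) : Prop :=
  holomorphic_immersion Phi /\
  forall x, disk x -> exists p, range (fun y => Phi (x, y)) = leaf F p.

(* The disk D = p(disk): an embedded holomorphic disk transverse to F. *)
Definition transverse_disk (p : C -> X) : Prop :=
  [/\ forall x, disk x -> {for x, continuous p},
      forall x (a : chart F), disk x -> dom a (p x) ->
        derivable (phi a \o p) x 1 /\ ('D_1 (phi a \o p) x).1 != 0,
      {in disk &, injective p} &
      forall O, open O -> O `<=` disk ->
        exists2 W : set X, open W & p @` O = W `&` p @` disk].

Definition trivialization (p : C -> X) (t : C -> chart F -> C2 R) : Prop :=
  forall x, disk x -> tangentF (p x) (t x) /\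
    forall a, dom a (p x) ->
      t x a != 0 /\ derivable (fun x' => t x' a) x 1.

Definition class_C (Phi : C2 R -> X) : Prop :=
  exists p t, [/\ transverse_disk p, trivialization p t &
    forall x, disk x ->
      [/\ universal_covering (fun y => Phi (x, y)) (leaf F (p x)),
          Phi (x, 0) = p x &
          forall a, dom a (p x) ->
            'D_1 (fun y => phi a (Phi (x, y))) 0 = t x a]].

Definition local_inverse (Phi : C2 R -> X) (V : set X) (G : X -> C2 R) : Prop :=
  exists U : set (C2 R),
    [/\ open U /\ U `<=` cylinder, U (0, 0), open V /\ V (Phi (0, 0)),
        forall z, U z -> V (Phi z) /\ G (Phi z) = z &
        forall q, V q -> U (G q) /\ Phi (G q) = q].

(* The forms lambda_F, A_F, Gamma_F in a chart, where J is multiplication by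
   'i; g is the second component of the local inverse read in the chart. As
   TF has complex rank one, A_F is determined by its defining relation for
   Y = (0, 1). *)
Section Forms.
Variable g : C2 R -> C.

Definition lambda_form (z Z : C2 R) : C :=
  real_derive ('i *: Z) g z - 'i * real_derive Z g z.

Definition A_form (z Z : C2 R) : C :=
  ext_d lambda_form z Z (0, 1) / real_derive (0, 1) g z.

Definition Gamma_form (z Z Y : C2 R) : C := ext_d A_form z Z Y.

End Forms.

(* Gamma p is a map T_pX x T_pF -> C. *)
Definition is_Gamma
    (Gamma : X -> (chart F -> C2 R) -> (chart F -> C2 R) -> C) : Prop :=
  forall Phi V G, class_C Phi -> local_inverse Phi V G ->
  forall p Z Y, V p -> tangent p Z -> tangentF p Y ->
  forall a, dom a p ->
    Gamma p Z Y =
    Gamma_form (fun z => (G (psi a z)).2) (phi a p) (Z a) (Y a).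

Definition vanishes
    (Gamma : X -> (chart F -> C2 R) -> (chart F -> C2 R) -> C) : Prop :=
  forall p Z Y, tangent p Z -> tangentF p Y -> Gamma p Z Y = 0.

(* The fiber of E at p: maps T_pX x T_pF -> C that factor through T_pN in the
   first variable, where they are antilinear, and are linear in the second. *)
Definition E_fiber (p : X) (e : (chart F -> C2 R) -> (chart F -> C2 R) -> C) :
    Prop :=
  [/\ forall Z Y, tangentF p Z -> tangentF p Y -> e Z Y = 0,
      forall c Z Z' Y, tangent p Z -> tangent p Z' -> tangentF p Y ->
        e (fun a => c *: Z a + Z' a) Y = c^* * e Z Y + e Z' Y &
      forall c Z Y Y', tangent p Z -> tangentF p Y -> tangentF p Y' ->
        e Z (fun a => c *: Y a + Y' a) = c * e Z Y + e Z Y'].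

Definition eq_E (p : X) (e e' : (chart F -> C2 R) -> (chart F -> C2 R) -> C) :
    Prop :=
  forall Z Y, tangent p Z -> tangentF p Y -> e Z Y = e' Z Y.

(* The local section dxbar (x) dy of E over the chart a. *)
Definition E_frame (a : chart F) (Z Y : chart F -> C2 R) : C :=
  ((Z a).1)^* * (Y a).2.

(* A smooth Hermitian metric on the line bundle E, given by e |-> |e|^2. *)
Definition hermitian_metric_E
    (N : X -> ((chart F -> C2 R) -> (chart F -> C2 R) -> C) -> R) : Prop :=
  [/\ forall p e e', E_fiber p e -> E_fiber p e' -> eq_E p e e' ->
        N p e = N p e',
      forall p e c, E_fiber p e ->
        (N p (fun Z Y => c * e Z Y))%:C = `|c| ^+ 2 * (N p e)%:C,
      forall p e, E_fiber p e -> ~ eq_E p e (fun _ _ => 0) -> 0 < N p e &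
      forall a, smooth_on (phi a @` dom a)
        (fun z => (N (psi a z) (E_frame a))%:C)].

(* As dxbar (x) dy is holomorphic along the leaves, the Chern curvature form of
   the metric with h = |dxbar (x) dy|^2 is - (d^2 log h / dy dybar) dy /\ dybar
   on the leaves; its sign is that of the coefficient, i dy /\ dybar being a
   positive form. *)
Definition leaf_curvature (h : C2 R -> R) (z : C2 R) : C :=
  - dy (dybar (fun w => (ln (h w))%:C)) z.

Definition E_negative : Prop :=
  exists2 N, hermitian_metric_E N &
    forall a z, (phi a @` dom a) z ->
      leaf_curvature (fun w => N (psi a w) (E_frame a)) z < 0.

End FoliatedSurface.

(* Main.v *)
(* All universal coverings of a parabolic leaf by C differ by affine maps, because
   automorphisms of C are affine. Let Phi be in class C, let (x, y) be a foliated
   chart, u = x o Phi, f = y o Phi, let the subscripts 1 and 3 denote derivatives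
   transversally to the leaves and along them, and let B = 2 d/dxbar. Then the value
   of K = - f_33 / f_3^2 at a point of X does not depend on Phi. The slope
   mu = - B f / f_3, which vanishes iff Phi is holomorphic, does not depend on the
   chart, is holomorphic along the leaves, and satisfies
   T := mu_33 / (conj(u_1) f_3) = (B K + mu K_3) / conj(u_1). The right-hand side is
   the derivative 2 d/dxbar of K as a function on X, so T does not depend on Phi, and
   T dxbar (x) dy is a section of E that is holomorphic along the leaves. Where it
   is nonzero, log |T|^2 is harmonic along the leaves while log |dxbar (x) dy|^2 is
   strictly subharmonic by the curvature hypothesis, so the maximum of
   |T|^2 |dxbar (x) dy|^2 on the compact X is 0. Hence mu is affine along the leaves;
   as the disk p and the trivialization t are holomorphic, mu and mu_3 vanish at
   y = 0, so mu = 0. Thus Phi and its local inverses are holomorphic, and already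
   lambda_F = 0. *)

From HB Require Import structures.
Require Import Defs.
From mathcomp Require Import all_boot all_order all_algebra complex.
From mathcomp Require Import all_classical all_reals all_analysis.
From mathcomp Require Import ring lra.

Set Implicit Arguments.
Unset Strict Implicit.
Unset Printing Implicit Defensive.

Import Order.TTheory GRing.Theory Num.Theory numFieldNormedType.Exports.

Local Open Scope classical_set_scope.
Local Open Scope complex_scope.
Local Open Scope ring_scope.

(** * Complex numbers and curves *)

(** A map of class C is only smooth across the leaves: the covering of each leaf is taken separately
    and normalised by the transversal and the trivialization. Replacing y by k(x) y + m(x) with k
    and m merely smooth changes mu by the factor 1/k and by the addition of an affine function of y.
    This is why two leafwise derivatives are taken before anything intrinsic appears, and why K is
    the right function on X: the factor k^2 cancels between f_33 and f_3^2. Since plaques are the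
    sets x = const, u does not vary along the leaves, and the holomorphy of the disk makes it
    holomorphic; the Cauchy-Riemann defect of Phi is therefore that of f alone. To speak of the
    derivative of K on X, the cylinders must be locally invertible with a computable differential;
    the differential is block triangular, which makes its inverse explicit. The rigidity of the
    automorphisms of the plane is reached without power series: Cauchy's formula comes from circle
    averages of a primitive, zeros are handled by iterated divided differences, and infinity is
    reached by inversion. *)

Section ComplexNorm.
Variable R : realType.
Local Notation C := (cplx R).
Local Notation Re := (@complex.Re R).
Local Notation Im := (@complex.Im R).

(** The norm of [cplx R] takes its values in [cplx R] itself. [nc] is the same modulus with values
    in [R], so that estimates become real inequalities. *)
Definition nc (z : C) : R := ComplexField.Normc.normc z.

Lemma normE (z : C) : `|z| = (nc z)%:C. Proof. by []. Qed.

Lemma nc_ge0 z : 0 <= nc z.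
Proof. by case: z => a b; exact: sqrtr_ge0. Qed.

Lemma ncE z : nc z = Num.sqrt (Re z ^+ 2 + Im z ^+ 2).
Proof. by case: z. Qed.

Lemma nc0 : nc 0 = 0. Proof. by apply: complexI; rewrite -normE normr0. Qed.
Lemma nc1 : nc 1 = 1. Proof. by apply: complexI; rewrite -normE normr1. Qed.
Lemma ncM z w : nc (z * w) = nc z * nc w.
Proof. by rewrite /nc ComplexField.Normc.normcM. Qed.
Lemma ncV z : nc z^-1 = (nc z)^-1.
Proof. by rewrite /nc ComplexField.Normc.normcV. Qed.
Lemma ncN z : nc (- z) = nc z.
Proof. exact: normcN. Qed.
Lemma ncD z w : nc (z + w) <= nc z + nc w.
Proof. exact: le_normcD. Qed.
Lemma ncB z w : nc (z - w) = nc (w - z).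
Proof. by rewrite -ncN opprB. Qed.
Lemma nc_eq0 z : (nc z == 0) = (z == 0).
Proof. by apply/eqP/eqP => [/ComplexField.Normc.eq0_normc//|->]; rewrite nc0. Qed.
Lemma nc_gt0 z : (0 < nc z) = (z != 0).
Proof. by rewrite lt_def nc_ge0 andbT nc_eq0. Qed.
Lemma ncX z n : nc (z ^+ n) = nc z ^+ n.
Proof. by elim: n => [|n IH]; rewrite ?expr0 ?nc1// !exprS ncM IH. Qed.
Lemma nc_real (x : R) : nc x%:C = `|x|.
Proof. by rewrite ncE /= expr0n addr0 sqrtr_sqr. Qed.
Lemma nci : nc 'i = 1.
Proof. by rewrite ncE /= expr0n add0r expr1n sqrtr1. Qed.
Lemma le_Re_nc z : `|Re z| <= nc z.
Proof. by rewrite ncE -sqrtr_sqr ler_wsqrtr// lerDl sqr_ge0. Qed.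
Lemma le_Im_nc z : `|Im z| <= nc z.
Proof. by rewrite ncE -sqrtr_sqr ler_wsqrtr// lerDr sqr_ge0. Qed.
Lemma ReIm z : z = (Re z)%:C + 'i * (Im z)%:C.
Proof. exact: complexE. Qed.
Lemma nc_le_ReIm z : nc z <= `|Re z| + `|Im z|.
Proof. by rewrite {1}(ReIm z) (le_trans (ncD _ _))// ncM nci mul1r !nc_real. Qed.
Lemma nc_sqr z : nc z ^+ 2 = Re z ^+ 2 + Im z ^+ 2.
Proof. by rewrite ncE sqr_sqrtr// addr_ge0// sqr_ge0. Qed.

Lemma cReD (z w : C) : Re (z + w) = Re z + Re w. Proof. by case: z; case: w. Qed.
Lemma cImD (z w : C) : Im (z + w) = Im z + Im w. Proof. by case: z; case: w. Qed.
Lemma cReN (z : C) : Re (- z) = - Re z. Proof. by case: z. Qed.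
Lemma cImN (z : C) : Im (- z) = - Im z. Proof. by case: z. Qed.
Lemma cReM (z w : C) : Re (z * w) = Re z * Re w - Im z * Im w.
Proof. by case: z; case: w. Qed.
Lemma cImM (z w : C) : Im (z * w) = Re z * Im w + Im z * Re w.
Proof. by case: z => a b; case: w => c d. Qed.
Lemma ceqP (z w : C) : Re z = Re w -> Im z = Im w -> z = w.
Proof. by case: z => a b; case: w => c d /= -> ->. Qed.

Lemma nbhs_ncP (z : C) (A : set C) :
  nbhs z A <-> exists2 d : R, 0 < d & forall w, nc (w - z) < d -> A w.
Proof.
apply: (iff_trans (iff_sym (@nbhs_ballP C C z A))); split.
  move=> [e /= e0 eA]; exists (Re e).
    by move: e0; rewrite ltcE/= => /andP[].
  move=> w wz; apply: eA; rewrite /ball/= -opprB normrN normE.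
  move: e0; rewrite !ltcE/= => /andP[/eqP ie re]; rewrite ie eqxx/=.
  exact: wz.
move=> [d d0 dA]; exists d%:C => /=; first by rewrite ltcR.
move=> w; rewrite /ball/= -opprB normrN normE ltcR; exact: dA.
Qed.

Lemma nbhs_nc2P (z : C2 R) (A : set (C2 R)) :
  nbhs z A <-> exists2 d : R, 0 < d &
    forall w : C2 R, nc (w.1 - z.1) < d -> nc (w.2 - z.2) < d -> A w.
Proof.
split.
  move=> [[U V] /= [/nbhs_ncP[d d0 dU] /nbhs_ncP[e e0 eV]] UVA].
  exists (Num.min d e); first by rewrite lt_min d0.
  move=> [w1 w2] /=; rewrite !lt_min => /andP[w1d _] /andP[_ w2e].
  by apply: UVA; split; [exact: dU|exact: eV].
move=> [d d0 dA].
exists ([set w | nc (w - z.1) < d], [set w | nc (w - z.2) < d]) => /=.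
  by split; apply/nbhs_ncP; exists d.
by move=> [w1 w2] [/= ? ?]; exact: dA.
Qed.

Lemma cvg_ncP (T : Type) (F : set_system T) (FF : Filter F) (f : T -> C) (l : C) :
  (f @ F --> l) <-> forall e : R, 0 < e -> \forall t \near F, nc (f t - l) < e.
Proof.
split=> [fl e e0|H].
  have /fl : nbhs l [set w | nc (w - l) < e] by apply/nbhs_ncP; exists e.
  by [].
move=> A /nbhs_ncP[d d0 dA]; rewrite /nbhs/=.
by apply: filterS (H _ d0) => t; exact: dA.
Qed.

Lemma continuous_Re : continuous (fun z : C => Re z : R).
Proof.
move=> z; apply/(@cvgrPdist_lt R R C (nbhs z) _) => e e0; apply/nbhs_ncP; exists e => // w wz.
by rewrite distrC (le_lt_trans _ wz)// -cReN -cReD le_Re_nc.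
Qed.

Lemma continuous_Im : continuous (fun z : C => Im z : R).
Proof.
move=> z; apply/(@cvgrPdist_lt R R C (nbhs z) _) => e e0; apply/nbhs_ncP; exists e => // w wz.
by rewrite distrC (le_lt_trans _ wz)// -cImN -cImD le_Im_nc.
Qed.

Lemma continuous_nc : continuous (fun z : C => nc z).
Proof.
move=> z; apply/(@cvgrPdist_lt R R C (nbhs z) _) => e e0; apply/nbhs_ncP; exists e => // w wz.
apply: le_lt_trans wz; rewrite ler_norml; apply/andP; split.
  have := ncD z (w - z); rewrite addrC subrK; lra.
have := ncD w (z - w); rewrite addrC subrK (ncB z); lra.
Qed.

Lemma continuous_real : continuous (fun x : R => x%:C : C).
Proof.
move=> x; apply/cvg_ncP => e e0.
near=> y; rewrite -rmorphB nc_real distrC; near: y.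
exact: cvgr_dist_lt.
Unshelve. all: by end_near. Qed.

Lemma continuous_ncP (f : C -> C) z : {for z, continuous f} <->
  forall e : R, 0 < e -> exists2 d : R, 0 < d &
    forall w, nc (w - z) < d -> nc (f w - f z) < e.
Proof.
apply: (iff_trans (@cvg_ncP C (nbhs z) _ f (f z))).
by split=> H e e0; have := H e e0; [move/nbhs_ncP|move=> ?; apply/nbhs_ncP].
Qed.

Lemma continuous_conj : continuous (fun z : C => z^* : C).
Proof.
move=> z; apply/continuous_ncP => e e0; exists e => // w.
rewrite -rmorphB; suff -> : nc (w - z)^* = nc (w - z) by [].
by rewrite !ncE; case: (w - z) => a b /=; rewrite sqrrN.
Qed.

Lemma nc_conj z : nc (z^*) = nc z.
Proof. by rewrite !ncE; case: z => a b /=; rewrite sqrrN. Qed.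

End ComplexNorm.
Arguments nc {R}.

(** First-order expansion in place of the difference quotient: the increment 0 is allowed, so later
    estimates need no case distinction. *)
Lemma is_derive1P (K : numFieldType) (f : K -> K) (t l : K) :
  is_derive t 1 f l <-> forall e, 0 < e ->
    \forall h \near (0 : K), `|f (t + h) - f t - h * l| <= e * `|h|.
Proof.
split.
  move=> [dfl dE] e e0.
  have : (fun h => h^-1 *: (f (h *: 1 + t) - f t)) @ 0^' --> l.
    by rewrite -dE; apply: dfl.
  move=> /(@cvgrPdist_le K K _ 0^' _) /(_ e e0).
  move=> /(@nbhs_ballP K K 0) [d /= d0 dP].
  apply/(@nbhs_ballP K K 0); exists d => //= h; rewrite /ball/= sub0r normrN => hd.
  have [->|h0] := eqVneq h 0.
    by rewrite addr0 subrr mul0r subr0 normr0 mulr0.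
  have := dP h _ h0; rewrite /ball/= sub0r normrN.
  move=> /(_ hd); rewrite scaler1 (addrC h) => H'.
  have -> : f (t + h) - f t - h * l = - h * (l - h^-1 * (f (t + h) - f t)).
    by field.
  by rewrite normrM normrN mulrC ler_wpM2r.
move=> H.
have C : (fun h => h^-1 *: (f (h *: 1 + t) - f t)) @ 0^' --> l.
  apply/(@cvgrPdist_le K K _ 0^' _) => e e0.
  have [d /= d0 dP] := (@nbhs_ballP K K 0 _).2 (H e e0).
  apply/(@nbhs_ballP K K 0); exists d => //= h hd h0.
  have := dP h hd; rewrite scaler1 (addrC h).
  have -> : f (t + h) - f t - h * l = - h * (l - h^-1 * (f (t + h) - f t)).
    by field.
  by rewrite normrM normrN mulrC ler_pM2r// normr_gt0.
apply: DeriveDef; first by apply/cvg_ex; exists l.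
exact: cvg_lim C.
Qed.

Section ComplexCurves.
Variable R : realType.
Local Notation C := (cplx R).
Local Notation Re := (@complex.Re R).
Local Notation Im := (@complex.Im R).

Lemma is_deriveRP (f : R -> R) (t l : R) :
  is_derive t 1 f l <-> forall e, 0 < e -> exists2 d, 0 < d &
    forall h, `|h| < d -> `|f (t + h) - f t - h * l| <= e * `|h|.
Proof.
apply: (iff_trans (is_derive1P f t l)); split=> H e e0; have := H e e0.
  move=> /(@nbhs_ballP R R 0)[d /= d0 dP]; exists d => // h hd.
  by apply: dP; rewrite /ball/= sub0r normrN.
move=> [d d0 dP]; apply/(@nbhs_ballP R R 0); exists d => //= h.
by rewrite /ball/= sub0r normrN; exact: dP.
Qed.

Lemma is_deriveCP (f : C -> C) (z l : C) :
  is_derive z 1 f l <-> forall e : R, 0 < e -> exists2 d : R, 0 < d &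
    forall h, nc h < d -> nc (f (z + h) - f z - h * l) <= e * nc h.
Proof.
apply: (iff_trans (is_derive1P f z l)); split=> H e e0.
  have e0' : 0 < e%:C :> C by rewrite ltcR.
  have /nbhs_ncP[d d0 dP] := H _ e0'.
  exists d => // h hd; have := dP h; rewrite subr0 => /(_ hd).
  by rewrite !normE -rmorphM lecR.
have [e' ee' e0'] : exists2 e', e = e'%:C & (0 < e' :> R).
  move: e0; rewrite ltcE/= => /andP[/eqP ie re]; exists (Re e) => //.
  by apply: ceqP.
have [d d0 dP] := H e' e0'; apply/nbhs_ncP; exists d => // h.
rewrite subr0 => /dP; rewrite ee' !normE -rmorphM lecR; exact.
Qed.

(** Derivative of a curve. The parameter is real while [C] is normed over itself, so [is_derive]
    does not apply and the expansion serves as definition. *)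
Definition cder (g : R -> C) (t : R) (l : C) : Prop :=
  forall e, 0 < e -> exists2 d, 0 < d &
    forall h, `|h| < d -> nc (g (t + h) - g t - h%:C * l) <= e * `|h|.

Lemma cderP g t l : cder g t l <->
  is_derive t 1 (fun s => Re (g s)) (Re l) /\ is_derive t 1 (fun s => Im (g s)) (Im l).
Proof.
have RE h : Re (g (t + h) - g t - h%:C * l) = Re (g (t + h)) - Re (g t) - h * Re l.
  by rewrite !cReD !cReN cReM /= mul0r subr0.
have IE h : Im (g (t + h) - g t - h%:C * l) = Im (g (t + h)) - Im (g t) - h * Im l.
  by rewrite !cImD !cImN cImM /= mul0r addr0.
split.
  move=> H; split; apply/is_deriveRP => e /H[d d0 dP]; exists d => // h /dP.
    by apply: le_trans; rewrite -RE le_Re_nc.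
  by apply: le_trans; rewrite -IE le_Im_nc.
move=> [/is_deriveRP H1 /is_deriveRP H2] e e0.
have e20 : 0 < e / 2 by rewrite divr_gt0.
have [d1 d10 H1d] := H1 _ e20; have [d2 d20 H2d] := H2 _ e20.
exists (Num.min d1 d2) => [|h]; first by rewrite lt_min d10.
rewrite lt_min => /andP[/H1d h1 /H2d h2].
apply: le_trans (nc_le_ReIm _) _; rewrite RE IE; lra.
Qed.

Lemma cder_eq (g g' : R -> C) t l : (forall s, g s = g' s) -> cder g t l -> cder g' t l.
Proof. by move=> /funext ->. Qed.

Lemma cder_cst c t : cder (fun=> c) t 0.
Proof. by apply/cderP; split => /=; exact: is_derive_cst. Qed.

Lemma cderD f g t l m : cder f t l -> cder g t m -> cder (fun s => f s + g s) t (l + m).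
Proof.
move=> /cderP[f1 f2] /cderP[g1 g2]; apply/cderP; rewrite cReD cImD; split.
  by under eq_fun do rewrite cReD; exact: is_deriveD.
by under eq_fun do rewrite cImD; exact: is_deriveD.
Qed.

Lemma cderN f t l : cder f t l -> cder (fun s => - f s) t (- l).
Proof.
move=> /cderP[f1 f2]; apply/cderP; rewrite cReN cImN; split.
  by under eq_fun do rewrite cReN; exact: is_deriveN.
by under eq_fun do rewrite cImN; exact: is_deriveN.
Qed.

Lemma cderB f g t l m : cder f t l -> cder g t m -> cder (fun s => f s - g s) t (l - m).
Proof. by move=> fl gm; apply: cderD => //; exact: cderN. Qed.

Lemma cderM f g t l m : cder f t l -> cder g t m ->
  cder (fun s => f s * g s) t (l * g t + f t * m).
Proof.
move=> /cderP[f1 f2] /cderP[g1 g2]; apply/cderP.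
rewrite cReD cImD !cReM !cImM; split.
  under eq_fun do rewrite cReM.
  apply: (is_derive_eq (is_deriveB (is_deriveM f1 g1) (is_deriveM f2 g2))).
  by rewrite /GRing.scale/=; ring.
under eq_fun do rewrite cImM.
apply: (is_derive_eq (is_deriveD (is_deriveM f1 g2) (is_deriveM f2 g1))).
by rewrite /GRing.scale/=; ring.
Qed.

Lemma cderMl c f t l : cder f t l -> cder (fun s => c * f s) t (c * l).
Proof.
by move=> fl; have := cderM (cder_cst c t) fl; rewrite mul0r add0r.
Qed.

Lemma cder_real (f : R -> R) (t l : R) : is_derive t 1 f l ->
  cder (fun s => (f s)%:C) t l%:C.
Proof. by move=> fl; apply/cderP; split => //=; exact: is_derive_cst. Qed.

Lemma cder_id t : cder (fun s => s%:C) t 1.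
Proof. by apply: cder_real; exact: is_derive_id. Qed.

Lemma cder_continuous g t l : cder g t l -> {for t, continuous g}.
Proof.
move=> gl; apply/(@cvg_ncP R R (nbhs t) _ g (g t)) => e e0.
have [d d0 dP] := gl 1 ltr01.
have M0 : 0 < 1 + nc l by rewrite ltr_pwDl// nc_ge0.
apply/(@nbhs_ballP R R t); exists (Num.min d (e / (1 + nc l))) => /=.
  by rewrite lt_min d0 divr_gt0.
move=> s; rewrite /ball/= lt_min distrC => /andP[s1]; rewrite ltr_pdivlMr// => s2.
have := dP _ s1; rewrite addrCA subrr addr0 mul1r => H.
have := ncD (g s - g t - (s - t)%:C * l) ((s - t)%:C * l).
rewrite subrK ncM nc_real; lra.
Qed.

Lemma cder_comp_holo (f : C -> C) (g : R -> C) (t : R) (l m : C) :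
  is_derive (g t) 1 f l -> cder g t m -> cder (f \o g) t (l * m).
Proof.
move=> /is_deriveCP fl gm e e0.
have M0 : 0 < 1 + nc l by rewrite ltr_pwDl// nc_ge0.
have N0 : 0 < 2 * (1 + nc m) by rewrite mulr_gt0// ltr_pwDl// nc_ge0.
have [d d0 dP] := fl _ (divr_gt0 e0 N0).
have [d1 d10 dP1] := gm _ (divr_gt0 e0 (mulr_gt0 (@ltr0n R 2) M0)).
have [d2 d20 dP2] := gm _ ltr01.
have /cvg_ncP /(_ d d0) := cder_continuous gm.
move=> /(@nbhs_ballP R R t)[d3 /= d30 dP3].
exists (Num.min d1 (Num.min d2 d3)) => [|h]; first by rewrite !lt_min d10 d20.
rewrite !lt_min => /andP[/dP1 h1 /andP[/dP2 h2 h3]].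
have {}h3 : nc (g (t + h) - g t) < d.
  by apply: dP3; rewrite /ball/= opprD addNKr normrN.
have := dP _ h3; rewrite addrCA subrr addr0 /=.
set D := g (t + h) - g t in h1 h2 *; move=> h4.
have -> : f (g (t + h)) - f (g t) - h%:C * (l * m) =
  (f (g (t + h)) - f (g t) - D * l) + l * (D - h%:C * m) by ring.
have h5 : nc D <= (1 + nc m) * `|h|.
  have := ncD (D - h%:C * m) (h%:C * m); rewrite subrK ncM nc_real; lra.
apply: le_trans (ncD _ _) _; rewrite ncM.
have h6 : nc (f (g (t + h)) - f (g t) - D * l) <= e / 2 * `|h|.
  apply: le_trans h4 _.
  have -> : e / 2 * `|h| = e / (2 * (1 + nc m)) * ((1 + nc m) * `|h|).
    by field; rewrite gt_eqF// ltr_pwDl// nc_ge0.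
  by rewrite ler_pM2l// divr_gt0.
have h7 : nc l * nc (D - h%:C * m) <= e / 2 * `|h|.
  apply: le_trans (_ : (1 + nc l) * nc (D - h%:C * m) <= _).
    by rewrite ler_wpM2r ?nc_ge0// lerDr.
  have -> : e / 2 * `|h| = (1 + nc l) * (e / (2 * (1 + nc l)) * `|h|).
    by field; rewrite gt_eqF.
  by rewrite ler_pM2l.
lra.
Qed.

(** A complex curve has no mean value theorem with equality. The real one is applied to the two
    coordinates, which costs the factor 2; this factor is the source of most constants below. *)
Lemma cmvt (g dg : R -> C) (a b M : R) : a <= b ->
  (forall t, a <= t <= b -> cder g t (dg t)) ->
  (forall t, a <= t <= b -> nc (dg t) <= M) ->
  nc (g b - g a) <= 2 * M * (b - a).
Proof.
move=> ab gd dgM.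
have H (p : R -> R) (dp : R -> R) :
    (forall t, a <= t <= b -> is_derive t 1 p (dp t)) ->
    (forall t, a <= t <= b -> `|dp t| <= M) -> `|p b - p a| <= M * (b - a).
  move=> pd pM.
  have [||c] := @MVT_segment R p dp a b ab.
  - by move=> x; rewrite in_itv/= => /andP[/ltW ax /ltW xb]; apply: pd; rewrite ax.
  - apply: derivable_within_continuous => x; rewrite in_itv/= => axb.
    exact: (@ex_derive _ _ _ _ _ _ _ (pd x axb)).
  rewrite in_itv/= => cab ->; rewrite normrM (@ger0_norm _ (b - a)) ?subr_ge0//.
  by rewrite ler_wpM2r ?subr_ge0// pM.
apply: le_trans (nc_le_ReIm _) _; rewrite cReD cReN cImD cImN.
have h1 := H (fun s => Re (g s)) (fun t => Re (dg t)) _ _.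
have h2 := H (fun s => Im (g s)) (fun t => Im (dg t)) _ _.
have -> : 2 * M * (b - a) = M * (b - a) + M * (b - a) by ring.
apply: lerD.
  apply: h1 => t tab; first by have /cderP[] := gd t tab.
  exact: le_trans (le_Re_nc _) (dgM t tab).
apply: h2 => t tab; first by have /cderP[] := gd t tab.
exact: le_trans (le_Im_nc _) (dgM t tab).
Qed.

End ComplexCurves.

(** * Complex line integrals *)

Section Primitive.
Variable R : realType.
Local Notation C := (cplx R).
Local Notation Re := (@complex.Re R).
Local Notation Im := (@complex.Im R).

Implicit Types (g h : R -> C) (c : C).

Lemma is_derive0_eq (f : R -> R) (a b : R) : a <= b ->
  (forall x, a <= x <= b -> is_derive x 1 f 0) -> f b = f a.
Proof.
move=> ab fd; have [||c _] := @MVT_segment R f (fun=> 0) a b ab.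
- by move=> x; rewrite in_itv/= => /andP[/ltW ax /ltW xb]; apply: fd; rewrite ax.
- apply: derivable_within_continuous => x; rewrite in_itv/= => axb.
  exact: (@ex_derive _ _ _ _ _ _ _ (fd x axb)).
by rewrite mul0r => /eqP; rewrite subr_eq0 => /eqP.
Qed.

(** The fundamental theorem is used on intervals with a fixed left end point -n. The resulting
    primitives, normalised at 0, agree where two of them are valid and so glue to one on the whole
    line. *)
Lemma real_primitive (g : R -> R) : continuous g ->
  exists G : R -> R, forall x : R, is_derive x 1 G (g x).
Proof.
move=> cg.
pose P (n : nat) (x : R) : R := \int[lebesgue_measure]_(t in `[- n%:R, x]) g t.
have Pd n (x : R) : - n%:R < x -> is_derive x 1 (P n) (g x).
  move=> nx; have xx : x < x + 1 by rewrite ltrDl.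
  have ig : lebesgue_measure.-integrable `[- n%:R, x + 1] (EFin \o g).
    apply: continuous_compact_integrable; first exact: segment_compact.
    exact: continuous_subspaceT.
  have [dP dE] := continuous_FTC1_closed xx ig nx (cg x).
  apply: DeriveDef; first exact: dP.
  rewrite -derive1E.
  exact: dE.
have Peq n m x : `|x| < n%:R -> `|x| < m%:R -> P n x - P n 0 = P m x - P m 0.
  move=> xn xm.
  have D y : - `|x| <= y <= `|x| -> is_derive y 1 (P n \- P m) 0.
    move=> /andP[y1 y2]; rewrite -(subrr (g y)).
    by apply: (is_deriveB (Pd n y _) (Pd m y _)); apply: lt_le_trans y1; rewrite ltrN2.
  have E : (P n \- P m) x = (P n \- P m) 0.
    have [x0|x0] := leP 0 x.
      apply: is_derive0_eq => // y /andP[y1 y2]; apply: D.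
      by rewrite (ger0_norm x0) y2 (le_trans _ y1)// oppr_le0.
    apply/esym/is_derive0_eq => [|y /andP[y1 y2]]; first exact: ltW.
    by apply: D; rewrite (ltr0_norm x0) opprK y1 (le_trans y2)// oppr_ge0 ltW.
  by move: E => /=; lra.
(* An integer strictly above |x|, so that x lies in the interior of the interval from -k to k. *)
pose k (x : R) := (Num.trunc `|x|).+1.
have kP x : `|x| < (k x)%:R by rewrite /k truncnS_gt.
exists (fun x => P (k x) x - P (k x) 0) => x.
have xK : - (k x).+1%:R < x.
  have := kP x; rewrite ltr_norml => /andP[+ _]; apply: lt_trans.
  by rewrite ltrN2 ltr_nat.
apply: (near_eq_is_derive (f := fun y => P (k x).+1 y - P (k x).+1 0)); last first.
  rewrite -[g x]subr0; exact: (is_deriveB (Pd _ _ xK) (is_derive_cst _ _ _)).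
near=> y; apply: Peq => //.
have yx : `|y - x| < 1.
  near: y; apply/(@nbhs_ballP R R x); exists 1 => //= y.
  by rewrite /ball/= distrC.
have := ler_normD (y - x) x; rewrite subrK => /le_lt_trans; apply.
rewrite -addn1 natrD addrC ltrD//.
Unshelve. all: by end_near. Qed.

Lemma cprimitive (g : R -> C) : continuous g ->
  exists G : R -> C, forall t, cder G t (g t).
Proof.
move=> cg.
have [G1 G1P] : exists G : R -> R, forall x : R, is_derive x 1 G (Re (g x)).
  apply: real_primitive => x.
  exact: (@continuous_comp R C R g (fun z => Re z) x (cg x) (@continuous_Re R (g x))).
have [G2 G2P] : exists G : R -> R, forall x : R, is_derive x 1 G (Im (g x)).
  apply: real_primitive => x.
  exact: (@continuous_comp R C R g (fun z => Im z) x (cg x) (@continuous_Im R (g x))).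
by exists (fun t => G1 t +i* G2 t) => t; apply/cderP; split; [exact: G1P|exact: G2P].
Qed.

(** Integrals are increments of a chosen primitive: additivity in the end points and signs are then
    plain algebra. A function without primitive is given the function 0. *)
Definition cprim (g : R -> C) : R -> C :=
  xget (fun=> 0) [set G | forall t, cder G t (g t)].

Definition cint (g : R -> C) (a b : R) : C := cprim g b - cprim g a.

Lemma cprimP g : continuous g -> forall t, cder (cprim g) t (g t).
Proof.
move=> /cprimitive[G GP].
exact: (@xgetPex _ (fun=> 0) [set G | forall t, cder G t (g t)] (ex_intro _ G GP)).
Qed.

Lemma cder_increment_eq (G H : R -> C) (g : R -> C) a b : a <= b ->
  (forall t, a <= t <= b -> cder G t (g t)) ->
  (forall t, a <= t <= b -> cder H t (g t)) -> G b - G a = H b - H a.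
Proof.
move=> ab Gd Hd; apply/eqP; rewrite -subr_eq0 -nc_eq0 eq_le nc_ge0 andbT.
have := @cmvt R (fun t => G t - H t) (fun=> 0) a b 0 ab _ _.
rewrite mulr0 mul0r (_ : G b - H b - _ = G b - G a - (H b - H a)); last by ring.
apply=> t tab; last by rewrite nc0.
by rewrite -(subrr (g t)); apply: cderB; [exact: Gd|exact: Hd].
Qed.

(** No continuity is asked: any primitive at hand computes the integral, because two primitives have
    the same increments. *)
Lemma cint_ftc (G g : R -> C) a b : (forall t, cder G t (g t)) ->
  cint g a b = G b - G a.
Proof.
move=> Gd; rewrite /cint.
have Pd : forall t, cder (cprim g) t (g t).
  exact: (@xgetPex _ (fun=> 0) [set G | forall t, cder G t (g t)] (ex_intro _ G Gd)).
have [ab|/ltW ba] := leP a b; first exact: (@cder_increment_eq _ _ g).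
by apply: oppr_inj; rewrite !opprB; apply: (@cder_increment_eq _ _ g).
Qed.

Lemma cint_bound g a b M : continuous g -> a <= b ->
  (forall t, a <= t <= b -> nc (g t) <= M) -> nc (cint g a b) <= 2 * M * (b - a).
Proof. by move=> cg ab gM; apply: (cmvt (dg := g)) => // t _; apply: cprimP. Qed.

Lemma cintZ c g a b : continuous g ->
  cint (fun t => c * g t) a b = c * cint g a b.
Proof.
move=> cg; rewrite (@cint_ftc (fun t => c * cprim g t)).
  by rewrite /cint; ring.
by move=> t; exact: (cderMl c (cprimP cg t)).
Qed.

Lemma cintB g h a b : continuous g -> continuous h ->
  cint (fun t => g t - h t) a b = cint g a b - cint h a b.
Proof.
move=> cg ch; rewrite (@cint_ftc (fun t => cprim g t - cprim h t)).
  by rewrite /cint; ring.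
by move=> t; exact: (cderB (cprimP cg t) (cprimP ch t)).
Qed.

Lemma cint_cst c a b : cint (fun=> c) a b = (b - a)%:C * c.
Proof.
rewrite (@cint_ftc (fun t => c * t%:C)); first by rewrite rmorphB; ring.
by move=> t; have := cderMl c (cder_id t); rewrite mulr1.
Qed.

Lemma cder_shift g (c t : R) l : cder g (t + c) l -> cder (fun s => g (s + c)) t l.
Proof. by move=> gl e /gl[d d0 dP]; exists d => // h /dP; rewrite (addrAC t). Qed.

End Primitive.

(** * Integrals depending on a parameter *)

Section ParametricIntegral.
Variable R : realType.
Local Notation C := (cplx R).

Lemma cder_line (z h : C) (s : R) : cder (fun s : R => z + s%:C * h) s h.
Proof.
have := cderD (cder_cst z s) (cderM (cder_id s) (cder_cst h s)).
by rewrite mulr0 addr0 add0r mul1r.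
Qed.

(** [cmvt] for f on the segment from z to z + h, with the linear part removed. The oscillation of f'
    around [l] controls the error of the linear approximation. *)
Lemma holo_mvt (f f' : C -> C) (z h l : C) (M : R) :
  (forall s : R, 0 <= s <= 1 -> is_derive (z + s%:C * h) 1 f (f' (z + s%:C * h))) ->
  (forall s : R, 0 <= s <= 1 -> nc (f' (z + s%:C * h) - l) <= M) ->
  nc (f (z + h) - f z - h * l) <= 2 * M * nc h.
Proof.
move=> fd fM.
have := @cmvt R (fun s => f (z + s%:C * h) - s%:C * (h * l))
  (fun s => (f' (z + s%:C * h) - l) * h) 0 1 (M * nc h) ler01 _ _.
rewrite subr0 mulr1 mulrA => H.
apply: le_trans (H _ _).
- by rewrite !mul1r !mul0r addr0 subr0 addrAC.
- move=> t t01; rewrite mulrBl.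
  apply: cderB; first exact: (cder_comp_holo (fd t t01) (cder_line z h t)).
  have := cderM (cder_id t) (cder_cst (h * l) t).
  by rewrite mulr0 addr0 mul1r (mulrC h).
- by move=> t t01; rewrite ncM ler_wpM2r ?nc_ge0// fM.
Qed.

Lemma continuousCB (T : topologicalType) (f g : T -> C) :
  continuous f -> continuous g -> continuous (fun t => f t - g t).
Proof. by move=> cf cg t; apply: (@cvgB C C T (nbhs t)); [exact: cf|exact: cg]. Qed.

Lemma continuousCD (T : topologicalType) (f g : T -> C) :
  continuous f -> continuous g -> continuous (fun t => f t + g t).
Proof. by move=> cf cg t; apply: (@cvgD C C T (nbhs t)); [exact: cf|exact: cg]. Qed.

Lemma continuousCM (T : topologicalType) (f g : T -> C) :
  continuous f -> continuous g -> continuous (fun t => f t * g t).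
Proof. by move=> cf cg t; apply: (@cvgM C T (nbhs t)); [exact: cf|exact: cg]. Qed.

Lemma continuousC_cst (T : topologicalType) (c : C) : continuous (fun _ : T => c).
Proof. by move=> t; exact: cvg_cst. Qed.

(** Tube lemma: joint continuity along the compact segment gives one neighbourhood of [z0] for all
    t. *)
Lemma uniform_on_segment (T : topologicalType) (g : T -> R -> C) (z0 : T)
    (a b e : R) : 0 < e ->
  (forall t, a <= t <= b ->
    {for (z0, t), continuous (fun p : T * R => g p.1 p.2)}) ->
  \forall z \near z0, forall t, a <= t <= b -> nc (g z t - g z0 t) < e.
Proof.
move=> e0 cg.
have /compact_near_coveringP K := @segment_compact R a b.
have e20 : 0 < e / 2 by rewrite divr_gt0.
have H : \forall z \near z0, `[a, b]%classic `<=` (fun t => nc (g z t - g z0 t) < e).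
  apply: (K T (nbhs z0) (fun z t => nc (g z t - g z0 t) < e)) => t; rewrite /= in_itv/= => tab.
  have /(@cvg_ncP R (T * R)%type (nbhs (z0, t)) _) /(_ _ e20)[[U V] /= [U0 V0] UV] := cg t tab.
  exists (V, U) => //= -[t' z] /= [Vt Uz].
  have z0U : U z0 by apply: nbhs_singleton.
  have h1 := UV (z, t') (conj Uz Vt); have h2 := UV (z0, t') (conj z0U Vt).
  rewrite /= in h1 h2.
  have -> : g z t' - g z0 t' = (g z t' - g z0 t) + (g z0 t - g z0 t') by ring.
  have := ncD (g z t' - g z0 t) (g z0 t - g z0 t').
  rewrite (ncB (g z0 t)); lra.
apply: filterS H => z zP t tab.
by apply: (zP t) => //=; rewrite in_itv.
Qed.

Lemma is_derive_cint (g g' : C -> R -> C) (z0 : C) (r a b : R) : 0 < r -> a <= b ->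
  (forall z t, nc (z - z0) < r -> a <= t <= b -> is_derive z 1 (g^~ t) (g' z t)) ->
  (forall z, nc (z - z0) < r -> continuous (g z)) ->
  (forall t, {for (z0, t), continuous (fun p : C * R => g' p.1 p.2)}) ->
  is_derive z0 1 (fun z => cint (g z) a b) (cint (g' z0) a b).
Proof.
move=> r0 ab gd cg cg'; apply/is_deriveCP => e e0.
have cg'0 : continuous (g' z0).
  move=> t; apply/(@cvg_ncP R R (nbhs t) _ (g' z0)) => e' e'0.
  have /(@cvg_ncP R (C * R)%type (nbhs (z0, t)) _) /(_ _ e'0)[[U V] /= [U0 V0] UV] := cg' t.
  apply: filterS V0 => t' Vt'; apply: (UV (z0, t')); split => //=.
  exact: nbhs_singleton.
(* [holo_mvt] and [cint_bound] each lose a factor 2, whence 4; the summand 1 keeps the quotient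
   meaningful when a = b. *)
have M0 : 0 < 4 * (b - a) + 1 by rewrite ltr_wpDl// mulr_ge0// subr_ge0.
have := @uniform_on_segment C g' z0 a b _ (divr_gt0 e0 M0) (fun t _ => cg' t).
move=> /nbhs_ncP[d d0 dP].
exists (Num.min d r) => [|h]; first by rewrite lt_min d0.
rewrite lt_min => /andP[hd hr].
have seg s : 0 <= s <= 1 -> nc (s%:C * h) <= nc h.
  move=> /andP[s0 s1]; rewrite ncM nc_real ger0_norm//.
  by rewrite -[leRHS]mul1r ler_wpM2r ?nc_ge0.
have c1 : continuous (g (z0 + h)) by apply: cg; rewrite addrAC subrr add0r.
have c0 : continuous (g z0) by apply: cg; rewrite subrr nc0.
have c2 : continuous (fun t => h * g' z0 t).
  exact: (continuousCM (@continuousC_cst R h) cg'0).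
have c3 : continuous (fun t => g (z0 + h) t - g z0 t).
  exact: (continuousCB c1 c0).
rewrite -(@cintB R (g (z0 + h)) (g z0) a b c1 c0).
rewrite -(@cintZ R h (g' z0) a b cg'0).
rewrite -(@cintB R _ _ a b c3 c2).
apply: le_trans (_ : 2 * (2 * (e / (4 * (b - a) + 1)) * nc h) * (b - a) <= _).
  apply: (@cint_bound R _ a b _ (continuousCB c3 c2) ab).
  move=> t tab; apply: (holo_mvt (f := g^~ t) (f' := g'^~ t)) => s s01.
    apply: gd => //; rewrite addrAC subrr add0r.
    exact: le_lt_trans (seg s s01) hr.
  apply/ltW/dP => //; rewrite addrAC subrr add0r.
  exact: le_lt_trans (seg s s01) hd.
have -> : 2 * (2 * (e / (4 * (b - a) + 1)) * nc h) * (b - a) =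
  e * nc h * ((4 * (b - a)) / (4 * (b - a) + 1)).
  by field; rewrite gt_eqF.
rewrite ler_piMr//; first by rewrite mulr_ge0 ?nc_ge0// ltW.
by rewrite ler_pdivrMr// mul1r lerDl.
Qed.

Lemma continuous_cint (T : topologicalType) (g : T -> R -> C) (z0 : T) (a b : R) :
  a <= b -> (\forall z \near z0, continuous (g z)) ->
  (forall t, {for (z0, t), continuous (fun p : T * R => g p.1 p.2)}) ->
  {for z0, continuous (fun z => cint (g z) a b)}.
Proof.
move=> ab cg cgg; apply/(@cvg_ncP R T (nbhs z0) _) => e e0.
have M0 : 0 < 2 * (b - a) + 1 by rewrite ltr_wpDl// mulr_ge0// subr_ge0.
have U := @uniform_on_segment T g z0 a b _ (divr_gt0 e0 M0) (fun t _ => cgg t).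
have cg0 : continuous (g z0) by apply: (nbhs_singleton cg).
apply: filterS2 U cg => w wd cw; rewrite -(@cintB R (g w) (g z0) a b cw cg0).
apply: le_lt_trans (_ : 2 * (e / (2 * (b - a) + 1)) * (b - a) < _).
  apply: (@cint_bound R _ a b _ (continuousCB cw cg0) ab).
  by move=> t tab; apply/ltW/wd.
have -> : 2 * (e / (2 * (b - a) + 1)) * (b - a) = e * ((2 * (b - a)) / (2 * (b - a) + 1)).
  by field; rewrite gt_eqF.
by rewrite gtr_pMr// ltr_pdivrMr// mul1r ltrDl.
Qed.

End ParametricIntegral.

(** * Bisection of squares *)

Section Squares.
Variable R : realType.

Lemma nested_intervals (p s : nat -> R) :
  (forall n k, p n <= p (n + k)%N /\ p (n + k)%N + s (n + k)%N <= p n + s n) ->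
  (forall n, 0 < s n) -> exists x, forall n, p n <= x <= p n + s n.
Proof.
move=> ps s0; pose A := [set p n | n in [set: nat]].
have ub n : ubound A (p n + s n).
  move=> _ [m _ <-]; have [] := ps n m => _ h1; have [] := ps m n => h2 _.
  move: h1 h2; rewrite addnC => h1 h2; have := s0 (m + n)%N; lra.
exists (sup A) => n; apply/andP; split.
  by apply: sup_upper_bound; [split; [exists (p 0%N), 0%N|exists (p 0%N + s 0%N); exact: ub]|exists n].
by apply: ge_sup; [exists (p 0%N), 0%N|exact: ub].
Qed.

(** If [P] fails on the square it fails on one of its four quarters; the nested bad quarters shrink
    to a point, where the local assumption is contradicted. This replaces every compactness or
    connectedness argument on the plane: Goursat's lemma, bounds on disks, continuation of
    properties, lifting. *)
Lemma square_induction (P : R -> R -> R -> Prop) (a b l : R) : 0 < l ->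
  (forall x y s, a <= x -> x + 2 * s <= a + l -> b <= y -> y + 2 * s <= b + l -> 0 < s ->
    P x y s -> P (x + s) y s -> P x (y + s) s -> P (x + s) (y + s) s ->
    P x y (2 * s)) ->
  (forall x y, a <= x <= a + l -> b <= y <= b + l -> exists2 d, 0 < d &
    forall x' y' s, a <= x' -> x' + s <= a + l -> b <= y' -> y' + s <= b + l ->
      0 < s < d -> x' <= x <= x' + s -> y' <= y <= y' + s -> P x' y' s) ->
  P a b l.
Proof.
move=> l0 glue loc; apply: contrapT => nP.
pose bad (q : R * R * R) := [/\ a <= q.1.1, q.1.1 + q.2 <= a + l, b <= q.1.2,
  q.1.2 + q.2 <= b + l & 0 < q.2 /\ ~ P q.1.1 q.1.2 q.2].
have step q : bad q -> exists q', [/\ bad q', q'.2 = q.2 / 2,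
    q.1.1 <= q'.1.1, q'.1.1 + q'.2 <= q.1.1 + q.2 &
    q.1.2 <= q'.1.2 /\ q'.1.2 + q'.2 <= q.1.2 + q.2].
  case: q => -[x y] s [/= ax xs by_ ys [s0 nPq]].
  apply: contrapT => nex; apply: nPq.
  have E : s = 2 * (s / 2) by field.
  rewrite E; apply: glue => //; try lra; apply: contrapT => nP';
    apply: nex.
  - by exists (x, y, s / 2); split => //=; try lra; rewrite /bad/=; split => //; try lra; split => //; lra.
  - by exists (x + s / 2, y, s / 2); split => //=; try lra; rewrite /bad/=; split => //; try lra; split => //; lra.
  - by exists (x, y + s / 2, s / 2); split => //=; try lra; rewrite /bad/=; split => //; try lra; split => //; lra.
  - by exists (x + s / 2, y + s / 2, s / 2); split => //=; try lra; rewrite /bad/=; split => //; try lra; split => //; lra.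
have [next nextP] : exists next, forall q, bad q -> [/\ bad (next q),
    (next q).2 = q.2 / 2,
    q.1.1 <= (next q).1.1, (next q).1.1 + (next q).2 <= q.1.1 + q.2 &
    q.1.2 <= (next q).1.2 /\ (next q).1.2 + (next q).2 <= q.1.2 + q.2].
  have H q : exists q', bad q -> [/\ bad q', q'.2 = q.2 / 2,
    q.1.1 <= q'.1.1, q'.1.1 + q'.2 <= q.1.1 + q.2 &
    q.1.2 <= q'.1.2 /\ q'.1.2 + q'.2 <= q.1.2 + q.2].
    have [bq|nb] := pselect (bad q); last by exists q.
    by have [q' ?] := step q bq; exists q'.
  by have [next nextP] := choice H; exists next.
pose Q n := iter n next (a, b, l).
have badQ n : bad (Q n).
  elim: n => [|n /nextP[] //]; rewrite /bad /=; split => //; lra.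
have QS n := nextP _ (badQ n).
have size n : (Q n).2 = l / 2 ^+ n.
  elim: n => [|n IH]; first by rewrite expr0 divr1.
  have [_ + _ _ _] := QS n; rewrite -[next _]/(Q n.+1) => ->.
  by rewrite IH exprSr invfM mulrA.
have mono n k : [/\ (Q n).1.1 <= (Q (n + k)%N).1.1,
    (Q (n + k)%N).1.1 + (Q (n + k)%N).2 <= (Q n).1.1 + (Q n).2,
    (Q n).1.2 <= (Q (n + k)%N).1.2 &
    (Q (n + k)%N).1.2 + (Q (n + k)%N).2 <= (Q n).1.2 + (Q n).2].
  elim: k => [|k [h1 h2 h3 h4]]; first by rewrite addn0.
  rewrite addnS; have [_ _] := QS (n + k)%N.
  rewrite -[next _]/(Q (n + k).+1) => i1 i2 [i3 i4].
  by split; [exact: le_trans h1 i1|exact: le_trans i2 h2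
    |exact: le_trans h3 i3|exact: le_trans i4 h4].
have s0 n : 0 < (Q n).2 by have [_ _ _ _ []] := badQ n.
have [x xP] := nested_intervals (p := fun n => (Q n).1.1) (s := fun n => (Q n).2)
  (fun n k => let: And4 h1 h2 _ _ := mono n k in conj h1 h2) s0.
have [y yP] := nested_intervals (p := fun n => (Q n).1.2) (s := fun n => (Q n).2)
  (fun n k => let: And4 _ _ h1 h2 := mono n k in conj h1 h2) s0.
have [d d0 dP] := loc x y (xP 0%N) (yP 0%N).
have [n nd] : exists n, (Q n).2 < d.
  have := @cvg_geometric _ l (2^-1 : R) _.
  rewrite ger0_norm ?invr_ge0// invf_lt1 ?ltr1n// => /(_ isT).
  move=> /(@cvgrPdist_lt R R nat _ _) /(_ d d0)[n _ /(_ n (leqnn _))].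
  rewrite sub0r normrN /geometric/= exprVn => H.
  by exists n; rewrite size (le_lt_trans (ler_norm _)).
have [h1 h2 h3 h4 [h5 h6]] := badQ n.
by apply: h6; apply: dP => //; rewrite ?h5.
Qed.

End Squares.

(** * Goursat's lemma and Cauchy's formula *)

Section Goursat.
Variable R : realType.
Local Notation C := (cplx R).
Local Notation Re := (@complex.Re R).
Local Notation Im := (@complex.Im R).
Implicit Types (f g : C -> C) (z c : C).

(** Integrals of f(z) dz over a horizontal and, next, a vertical segment; the factor 'i of the
    latter is the velocity of the path. *)
Definition hint f (y x x' : R) : C := cint (fun t => f (t +i* y)) x x'.
Definition vint f (x y y' : R) : C := 'i * cint (fun t => f (x +i* t)) y y'.

Lemma cder_hline (y t : R) : cder (fun t : R => t +i* y : C) t 1.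
Proof. by apply/cderP; split; [exact: is_derive_id|exact: is_derive_cst]. Qed.

Lemma cder_vline (x t : R) : cder (fun t : R => x +i* t : C) t 'i.
Proof. by apply/cderP; split; [exact: is_derive_cst|exact: is_derive_id]. Qed.

Lemma continuous_hline (y : R) : continuous (fun t : R => t +i* y : C).
Proof. by move=> t; exact: (cder_continuous (cder_hline y t)). Qed.

Lemma continuous_vline (x : R) : continuous (fun t : R => x +i* t : C).
Proof. by move=> t; exact: (cder_continuous (cder_vline x t)). Qed.

Lemma continuous_hcomp f y : continuous f -> continuous (fun t : R => f (t +i* y)).
Proof.
move=> cf t; apply: (@continuous_comp R C C (fun t : R => t +i* y : C) f t).
  exact: continuous_hline.
exact: cf.
Qed.

Lemma continuous_vcomp f x : continuous f -> continuous (fun t : R => f (x +i* t)).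
Proof.
move=> cf t; apply: (@continuous_comp R C C (fun t : R => x +i* t : C) f t).
  exact: continuous_vline.
exact: cf.
Qed.

Lemma hint_prim (P p : C -> C) y x x' : (forall z, is_derive z 1 P (p z)) ->
  hint p y x x' = P (x' +i* y) - P (x +i* y).
Proof.
move=> Pp; rewrite /hint (@cint_ftc R (fun t => P (t +i* y)))// => t.
have := cder_comp_holo (Pp (t +i* y)) (cder_hline y t).
by rewrite mulr1.
Qed.

Lemma vint_prim (P p : C -> C) x y y' : (forall z, is_derive z 1 P (p z)) ->
  continuous p -> vint p x y y' = P (x +i* y') - P (x +i* y).
Proof.
move=> Pp cp; rewrite /vint -(@cintZ R 'i (fun t => p (x +i* t)) y y' (@continuous_vcomp _ _ cp)).
rewrite (@cint_ftc R (fun t => P (x +i* t)))// => t.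
by have := cder_comp_holo (Pp (x +i* t)) (cder_vline x t); rewrite mulrC.
Qed.

(** Counterclockwise integral over the boundary of a rectangle. The vertical coordinate is
    multiplied by [k], so that rectangles of any shape correspond to squares and [square_induction]
    applies. *)
Definition rint f (k x y s : R) : C :=
  hint f (k * y) x (x + s) + vint f (x + s) (k * y) (k * (y + s)) -
  hint f (k * (y + s)) x (x + s) - vint f x (k * y) (k * (y + s)).

Lemma rint_split f k x y s : rint f k x y (2 * s) =
  rint f k x y s + rint f k (x + s) y s + rint f k x (y + s) s +
  rint f k (x + s) (y + s) s.
Proof.
rewrite /rint /hint /vint (_ : x + 2 * s = x + s + s); last by ring.
by rewrite (_ : y + 2 * s = y + s + s) /cint; [ring|ring].
Qed.

Lemma rintB f g k x y s : continuous f -> continuous g ->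
  rint (fun z => f z - g z) k x y s = rint f k x y s - rint g k x y s.
Proof.
move=> cf cg; have hf t := @continuous_hcomp f t cf.
have hg t := @continuous_hcomp g t cg; have vf t := @continuous_vcomp f t cf.
have vg t := @continuous_vcomp g t cg; rewrite /rint /hint /vint.
rewrite (@cintB R _ _ x (x + s) (hf (k * y)) (hg (k * y))).
rewrite (@cintB R _ _ x (x + s) (hf (k * (y + s))) (hg (k * (y + s)))).
rewrite (@cintB R _ _ (k * y) (k * (y + s)) (vf x) (vg x)).
rewrite (@cintB R _ _ (k * y) (k * (y + s)) (vf (x + s)) (vg (x + s))).
ring.
Qed.

Lemma rint_affine (al l : C) k x y s : rint (fun z => al + l * z) k x y s = 0.
Proof.
pose P (z : C) := al * z + l / 2 * (z * z).
have PP z : is_derive z 1 P (al + l * z).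
  have h1 := is_deriveZ al (is_derive_id z 1).
  have h2 := is_deriveZ (l / 2) (is_deriveM (is_derive_id z 1) (is_derive_id z 1)).
  apply: (is_derive_eq (is_deriveD h1 h2)); rewrite /GRing.scale/=.
  by field.
have cp : continuous (fun z : C => al + l * z).
  apply: continuousCD; first exact: continuousC_cst.
  by apply: continuousCM; [exact: continuousC_cst|move=> z; exact: cvg_id].
rewrite /rint !(hint_prim _ _ _ PP) !(vint_prim _ _ _ PP cp); ring.
Qed.

Lemma nc_rint_le f k x y s M : continuous f -> 0 < k -> 0 < s ->
  (forall z, x <= Re z <= x + s -> k * y <= Im z <= k * (y + s) -> nc (f z) <= M) ->
  nc (rint f k x y s) <= 4 * M * (1 + k) * s.
Proof.
move=> cf k0 s0 fM.
have ys : k * y <= k * (y + s) by rewrite ler_pM2l// lerDl ltW.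
have xs : x <= x + s by rewrite lerDl ltW.
have h1 : nc (hint f (k * y) x (x + s)) <= 2 * M * (x + s - x).
  apply: (@cint_bound R _ x (x + s) _ (continuous_hcomp (y := k * y) cf) xs) => t tx.
  by apply: fM => //=; rewrite lexx.
have h2 : nc (hint f (k * (y + s)) x (x + s)) <= 2 * M * (x + s - x).
  apply: (@cint_bound R _ x (x + s) _ (continuous_hcomp (y := k * (y + s)) cf) xs) => t tx.
  by apply: fM => //=; rewrite lexx ys.
have h3 : nc (vint f x (k * y) (k * (y + s))) <= 2 * M * (k * (y + s) - k * y).
  rewrite /vint ncM nci mul1r.
  apply: (@cint_bound R _ (k * y) (k * (y + s)) _ (continuous_vcomp (x := x) cf) ys) => t tx.
  by apply: fM => //=; rewrite lexx.
have h4 : nc (vint f (x + s) (k * y) (k * (y + s))) <= 2 * M * (k * (y + s) - k * y).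
  rewrite /vint ncM nci mul1r.
  apply: (@cint_bound R _ (k * y) (k * (y + s)) _ (continuous_vcomp (x := x + s) cf) ys) => t tx.
  by apply: fM => //=; rewrite lexx xs.
rewrite /rint.
have := ncD (hint f (k * y) x (x + s) + vint f (x + s) (k * y) (k * (y + s)) -
  hint f (k * (y + s)) x (x + s)) (- vint f x (k * y) (k * (y + s))).
have := ncD (hint f (k * y) x (x + s) + vint f (x + s) (k * y) (k * (y + s)))
  (- hint f (k * (y + s)) x (x + s)).
have := ncD (hint f (k * y) x (x + s)) (vint f (x + s) (k * y) (k * (y + s))).
rewrite !ncN => a1 a2 a3.
have -> : 4 * M * (1 + k) * s =
  2 * M * (x + s - x) + 2 * M * (k * (y + s) - k * y) + 2 * M * (x + s - x)
   + 2 * M * (k * (y + s) - k * y) by ring.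
by move: a1 a2 a3 h1 h2 h3 h4; lra.
Qed.

(** Goursat: the bound e s^2 is additive under division into four quarters, and it holds on small
    squares because near a point f differs from an affine function, whose boundary integral
    vanishes, by a small multiple of the distance. *)
Lemma rint_eq0 f k a b l : continuous f -> 0 < k -> 0 < l ->
  (forall z, a <= Re z <= a + l -> k * b <= Im z <= k * (b + l) -> derivable f z 1) ->
  rint f k a b l = 0.
Proof.
move=> cf k0 l0 df; apply/eqP; rewrite -nc_eq0 eq_le nc_ge0 andbT.
apply/ler_addgt0Pr => e e0; rewrite add0r.
have e1 : 0 < e / l ^+ 2 by rewrite divr_gt0// exprn_gt0.
rewrite -[leRHS](divfK (x := l ^+ 2)) ?gt_eqF ?exprn_gt0//.
move: (e / _) e1 => {e0}e e0.
apply: (square_induction (P := fun x y s => nc (rint f k x y s) <= e * s ^+ 2)) => //.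
  move=> x y s _ _ _ _ s0 h1 h2 h3 h4; rewrite rint_split.
  have := ncD (rint f k x y s + rint f k (x + s) y s + rint f k x (y + s) s) (rint f k (x + s) (y + s) s).
  have := ncD (rint f k x y s + rint f k (x + s) y s) (rint f k x (y + s) s).
  have := ncD (rint f k x y s) (rint f k (x + s) y s).
  by move: h1 h2 h3 h4; rewrite exprMn; lra.
move=> x y xP yP.
pose z0 : C := x +i* (k * y).
have dz0 : derivable f z0 1.
  apply: df => //=; move: yP => /andP[y1 y2].
  by rewrite !ler_pM2l// y1.
have /is_deriveCP dfz := derivableP dz0; set L := 'D_1 f z0 in dfz.
(* Points of the rectangle are within (1 + k) s of [z0], and [nc_rint_le] multiplies by 4 (1 + k) s;
   the product has to be e s^2. *)
have e' : 0 < e / (4 * (1 + k) ^+ 2).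
  by rewrite divr_gt0// mulr_gt0// exprn_gt0// addr_gt0.
have [d d0 dP] := dfz _ e'.
exists (d / (1 + k)) => [|x' y' s ax xl by_ yl /andP[s0 sd] xx yy].
  by rewrite divr_gt0// addr_gt0.
pose q z := (f z0 - L * z0) + L * z.
have cq : continuous q.
  apply: continuousCD; first exact: continuousC_cst.
  by apply: continuousCM; [exact: continuousC_cst|move=> z; exact: cvg_id].
have := rintB k x' y' s cf cq; rewrite rint_affine subr0 => <-.
have k1 : 0 < 1 + k by rewrite addr_gt0.
have -> : e * s ^+ 2 = 4 * (e / (4 * (1 + k) ^+ 2) * ((1 + k) * s)) * (1 + k) * s.
  by field; rewrite gt_eqF.
apply: (@nc_rint_le _ k x' y' s _ (continuousCB cf cq) k0 s0).
move=> z xz yz.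
have zz : nc (z - z0) <= (1 + k) * s.
  apply: le_trans (nc_le_ReIm _) _; rewrite cReD cReN cImD cImN /=.
  rewrite mulrDl mul1r; apply: lerD.
    by rewrite ler_norml; move: xz xx; lra.
  move: yz yy => /andP[y1 y2] /andP[y3 y4].
  have y3' : k * y' <= k * y by rewrite ler_pM2l.
  have y4' : k * y <= k * (y' + s) by rewrite ler_pM2l.
  rewrite ler_norml; move: y1 y2 y3' y4'; rewrite mulrDr; lra.
have zd : nc (z - z0) < d.
  by apply: le_lt_trans zz _; rewrite mulrC -ltr_pdivlMr.
have := dP _ zd; rewrite addrCA subrr addr0 /q.
rewrite (_ : f z - (f z0 - L * z0 + L * z) = f z - f z0 - (z - z0) * L); last by ring.
by move=> /le_trans; apply; rewrite ler_pM2l.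
Qed.

Lemma rectangle_eq0 f (x1 x2 y1 y2 : R) : continuous f -> x1 <= x2 -> y1 <= y2 ->
  (forall z, x1 <= Re z <= x2 -> y1 <= Im z <= y2 -> derivable f z 1) ->
  hint f y1 x1 x2 + vint f x2 y1 y2 = vint f x1 y1 y2 + hint f y2 x1 x2.
Proof.
move=> cf; rewrite le_eqVlt => /predU1P[->|x12].
  by rewrite /hint /cint !subrr add0r addr0.
rewrite le_eqVlt => /predU1P[->|y12 df].
  by rewrite /vint /cint !subrr !mulr0 add0r addr0.
have l0 : 0 < x2 - x1 by rewrite subr_gt0.
pose k := (y2 - y1) / (x2 - x1).
have k0 : 0 < k by rewrite divr_gt0// subr_gt0.
have := @rint_eq0 f k x1 (y1 / k) (x2 - x1) cf k0 l0.
have E1 : k * (y1 / k) = y1 by field; rewrite gt_eqF.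
have E2 : k * (y1 / k + (x2 - x1)) = y2.
  by rewrite mulrDr E1 /k divfK ?gt_eqF// addrC subrK.
have E3 : x1 + (x2 - x1) = x2 by rewrite addrC subrK.
rewrite /rint E1 E2 E3 => H.
apply/eqP; rewrite -subr_eq0 -(H df); apply/eqP; ring.
Qed.

Lemma cint_bound_dist (g : R -> C) (a b M : R) : continuous g ->
  (forall t, `|t - a| <= `|b - a| -> nc (g t) <= M) ->
  nc (cint g a b) <= 2 * M * `|b - a|.
Proof.
move=> cg gM; have [ab|ba] := leP a b.
  rewrite ger0_norm ?subr_ge0//; apply: cint_bound => // t /andP[t1 t2]; apply: gM.
  by rewrite !ger0_norm ?subr_ge0// lerB.
rewrite ltr0_norm ?subr_lt0// opprB -ncN opprB.
apply: cint_bound => //; first exact: ltW.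
move=> t /andP[t1 t2]; apply: gM.
by rewrite (@ltr0_norm _ (b - a)) ?subr_lt0// ler_norml; lra.
Qed.

(** The primitive integrates f first horizontally, then vertically. By Goursat the other order gives
    the same value, so that both a vertical and a horizontal increment are single integrals. *)
Lemma primitive_square f (a b l : R) : continuous f -> 0 < l ->
  (forall z, a <= Re z <= a + l -> b <= Im z <= b + l -> derivable f z 1) ->
  exists F, forall z, a < Re z < a + l -> b < Im z < b + l ->
    is_derive z 1 F (f z).
Proof.
move=> cf l0 df.
pose F z := hint f b a (Re z) + vint f (Re z) b (Im z).
have F2 z : a <= Re z <= a + l -> b <= Im z <= b + l ->
    F z = vint f a b (Im z) + hint f (Im z) a (Re z).
  move=> /andP[z1 z2] /andP[z3 z4]; apply: rectangle_eq0 => // w /andP[w1 w2] /andP[w3 w4].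
  by apply: df; rewrite ?w1 ?w3/= ?(le_trans w2)// (le_trans w4).
exists F => z /andP[z1 z2] /andP[z3 z4]; apply/is_deriveCP => e e0.
have e40 : 0 < e / 4 by rewrite divr_gt0.
have /continuous_ncP /(_ _ e40)[d d0 dP] := cf z.
pose m := Num.min (Num.min (Re z - a) (a + l - Re z)) (Num.min (Im z - b) (b + l - Im z)).
have m0 : 0 < m by rewrite !lt_min !subr_gt0 z1 z2 z3 z4.
exists (Num.min m (d / 2)) => [|h]; first by rewrite lt_min m0 divr_gt0.
rewrite lt_min => /andP[hm hd].
have hR := le_Re_nc h; have hI := le_Im_nc h.
move: hm; rewrite !lt_min => /andP[/andP[m1 m2] /andP[m3 m4]].
have [r1 r2] : - nc h <= Re h /\ Re h <= nc h by move: hR; rewrite ler_norml => /andP[].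
(* The corner of the path from z to z + h; the two halves of the increment use the two expressions
   of F. *)
pose w : C := (Re z + Re h) +i* Im z.
have FE : F (z + h) - F z = hint f (Im z) (Re z) (Re z + Re h) +
    vint f (Re z + Re h) (Im z) (Im z + Im h).
  have -> : F (z + h) - F z = (F (z + h) - F w) + (F w - F z) by ring.
  rewrite {1 2}/F cReD cImD /= (@F2 w) ?(@F2 z) ?(ltW z1) ?(ltW z2) ?(ltW z3) ?(ltW z4)//=.
    by rewrite /hint /vint /cint; ring.
  by apply/andP; split; lra.
rewrite FE.
have vE : cint (fun=> f z) (Re z) (Re z + Re h) = (Re h)%:C * f z.
  by rewrite cint_cst addrAC subrr add0r.
have vE' : cint (fun=> f z) (Im z) (Im z + Im h) = (Im h)%:C * f z.
  by rewrite cint_cst addrAC subrr add0r.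
have -> : hint f (Im z) (Re z) (Re z + Re h) +
    vint f (Re z + Re h) (Im z) (Im z + Im h) - h * f z =
   cint (fun t => f (t +i* Im z) - f z) (Re z) (Re z + Re h) +
   'i * cint (fun t => f ((Re z + Re h) +i* t) - f z) (Im z) (Im z + Im h).
  rewrite (@cintB R _ _ _ _ (continuous_hcomp (y := Im z) cf) (@continuousC_cst R R (f z))).
  rewrite (@cintB R _ _ _ _ (continuous_vcomp (x := Re z + Re h) cf) (@continuousC_cst R R (f z))).
  have hE : h * f z = (Re h)%:C * f z + 'i * (Im h)%:C * f z.
    by rewrite {1}(ReIm h) mulrDl.
  by rewrite vE vE' hE /hint /vint; ring.
apply: le_trans (ncD _ _) _; rewrite ncM nci mul1r.
have B1 : nc (cint (fun t => f (t +i* Im z) - f z) (Re z) (Re z + Re h)) <= 2 * (e / 4) * `|Re h|.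
  have -> : `|Re h| = `|Re z + Re h - Re z| by rewrite addrAC subrr add0r.
  apply: cint_bound_dist.
    exact: (continuousCB (continuous_hcomp (y := Im z) cf) (@continuousC_cst R R (f z))).
  rewrite addrAC subrr add0r => t tz; apply/ltW/dP.
  apply: le_lt_trans (nc_le_ReIm _) _; rewrite cReD cImD cReN cImN /= subrr normr0 addr0.
  by move: tz hR hd (nc_ge0 h); lra.
have B2 : nc (cint (fun t => f ((Re z + Re h) +i* t) - f z) (Im z) (Im z + Im h)) <= 2 * (e / 4) * `|Im h|.
  have -> : `|Im h| = `|Im z + Im h - Im z| by rewrite addrAC subrr add0r.
  apply: cint_bound_dist.
    exact: (continuousCB (continuous_vcomp (x := Re z + Re h) cf) (@continuousC_cst R R (f z))).
  rewrite addrAC subrr add0r => t tz; apply/ltW/dP.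
  apply: le_lt_trans (nc_le_ReIm _) _; rewrite cReD cImD cReN cImN /= addrAC subrr add0r.
  by move: tz hR hI hd (nc_ge0 h); lra.
apply: le_trans (lerD B1 B2) _.
have := ler_wpM2l (ltW e0) hR; have := ler_wpM2l (ltW e0) hI; lra.
Qed.

End Goursat.

Section CauchyFormula.
Variable R : realType.
Local Notation C := (cplx R).
Implicit Types (f g : C -> C) (z c : C).

Definition eit (t : R) : C := cos t +i* sin t.
Definition emit (t : R) : C := cos t -i* sin t.

Lemma eitM t : eit t * emit t = 1.
Proof.
apply: ceqP; rewrite ?cReM ?cImM /=; last by ring.
by rewrite -(cos2Dsin2 t); ring.
Qed.

Lemma nc_eit t : nc (eit t) = 1.
Proof. by rewrite ncE /= cos2Dsin2 sqrtr1. Qed.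

Lemma nc_emit t : nc (emit t) = 1.
Proof. by rewrite ncE /= sqrrN cos2Dsin2 sqrtr1. Qed.

Lemma cder_eit t : cder eit t ('i * eit t).
Proof.
apply/cderP; rewrite cReM cImM /= !mul0r !mul1r sub0r add0r.
by split; [exact: is_derive_cos|exact: is_derive_sin].
Qed.

Lemma cder_emit t : cder emit t (- 'i * emit t).
Proof.
apply/cderP; rewrite cReM cImM /= oppr0 !mul0r mulN1r sub0r add0r opprK mulN1r.
split; first by have := @is_derive_cos R t; rewrite -[X in is_derive _ _ _ X]opprK opprK.
by apply: is_deriveN; exact: is_derive_sin.
Qed.

Lemma continuous_eit : continuous eit.
Proof. by move=> t; exact: (cder_continuous (cder_eit t)). Qed.

Lemma continuous_emit : continuous emit.
Proof. by move=> t; exact: (cder_continuous (cder_emit t)). Qed.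

Lemma eit_period : eit (2 * pi) = eit 0.
Proof. by rewrite /eit mulr_natl cos2pi sin2pi cos0 sin0. Qed.

Lemma emit_period : emit (2 * pi) = emit 0.
Proof. by rewrite /emit mulr_natl cos2pi sin2pi cos0 sin0. Qed.

Lemma pi2_ge0 : 0 <= 2 * pi :> R. Proof. by rewrite mulr_ge0// pi_ge0. Qed.

Section Formula.
Variables (F f : C -> C) (c : C) (r : R).
Hypothesis r0 : 0 < r.
Hypothesis Ff : forall z, nc (z - c) < r -> is_derive z 1 F (f z).
Hypothesis cf : forall z, nc (z - c) < r -> {for z, continuous f}.

Let cF z : nc (z - c) < r -> {for z, continuous F}.
Proof.
move=> /Ff [dF _]; apply: differentiable_continuous.
exact/derivable1_diffP.
Qed.

Let circ_in z w t : nc (z - c) < r / 2 -> nc w < r / 2 -> nc (z + w * eit t - c) < r.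
Proof.
move=> zc wr; rewrite addrAC; apply: le_lt_trans (ncD _ _) _.
rewrite ncM nc_eit mulr1; lra.
Qed.

(** Cauchy's formula without kernel. Differentiating [J] in w gives [K], and a full turn of the
    circle gives w [K] = [J]; hence [K] is constant in the radius and equals its limit 2 pi f(z) at
    radius 0. Thus f(z) is a circle average of the differentiable function F. *)
Let J z w := cint (fun t => F (z + w * eit t) * emit t) 0 (2 * pi).
Let K z w := cint (fun t => f (z + w * eit t)) 0 (2 * pi).

Let continuous_circ2 (h : C -> C) z w t :
  {for z + w * eit t, continuous h} ->
  {for (w, t), continuous (fun p : C * R => h (z + p.1 * eit p.2))}.
Proof.
move=> ch; apply: (@continuous_comp (C * R)%type C C (fun p => z + p.1 * eit p.2) h).
  apply: (@cvgD C C (C * R)%type (nbhs (w, t))); first exact: cvg_cst.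
  apply: (@cvgM C (C * R)%type (nbhs (w, t))); first exact: cvg_fst.
  apply: (@continuous_comp (C * R)%type R C snd eit); first exact: cvg_snd.
  exact: continuous_eit.
exact: ch.
Qed.

Let continuous_circ3 (h : C -> C) z w t :
  {for z + w * eit t, continuous h} ->
  {for (z, t), continuous (fun p : C * R => h (p.1 + w * eit p.2))}.
Proof.
move=> ch; apply: (@continuous_comp (C * R)%type C C (fun p => p.1 + w * eit p.2) h).
  apply: (@cvgD C C (C * R)%type (nbhs (z, t))); first exact: cvg_fst.
  apply: (@cvgM C (C * R)%type (nbhs (z, t))); first exact: cvg_cst.
  apply: (@continuous_comp (C * R)%type R C snd eit); first exact: cvg_snd.
  exact: continuous_eit.
exact: ch.
Qed.

Let continuous_circ (h : C -> C) z w :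
  (forall t, {for z + w * eit t, continuous h}) ->
  continuous (fun t => h (z + w * eit t)).
Proof.
move=> ch t; apply: (@continuous_comp R C C (fun t => z + w * eit t) h); last exact: ch.
apply: (@cvgD C C R (nbhs t)); first exact: cvg_cst.
apply: (@cvgM C R (nbhs t)); [exact: cvg_cst|exact: continuous_eit].
Qed.

Let dJ z w : nc (z - c) < r / 2 -> nc w < r / 2 -> is_derive w 1 (J z) (K z w).
Proof.
move=> zc wr.
have w'r w' : nc (w' - w) < r / 2 - nc w -> nc w' < r / 2.
  by have := ncD (w' - w) w; rewrite subrK; lra.
apply: (@is_derive_cint R (fun w t => F (z + w * eit t) * emit t)
  (fun w t => f (z + w * eit t)) w (r / 2 - nc w)).
- by rewrite subr_gt0.
- exact: pi2_ge0.
- move=> w' t /w'r w'r2 _.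
  have Fd := Ff (circ_in t zc w'r2).
  apply/is_deriveCP => e e0; have /is_deriveCP /(_ e e0)[d d0 dP] := Fd.
  exists d => // h hd; have := dP (h * eit t); rewrite !ncM nc_eit mulr1 => /(_ hd).
  apply: le_trans; rewrite -[leRHS]mulr1 -(nc_emit t) -ncM le_eqVlt; apply/orP; left.
  apply/eqP; congr nc; rewrite -[in LHS](mulr1 (h * _)) -(eitM t).
  rewrite (_ : (w' + h) * eit t = w' * eit t + h * eit t); last by ring.
  rewrite (addrA z); ring.
- move=> w' /w'r w'r2; apply: continuousCM; last exact: continuous_emit.
  by apply: continuous_circ => t; apply: cF; exact: circ_in.
- by move=> t; apply: continuous_circ2; apply: cf; exact: circ_in.
Qed.

(** The difference of the two integrands is the t-derivative of -i F(z + w e^(it)) e^(-it), a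
    periodic function, so its integral over a turn is 0. *)
Let wK z w : nc (z - c) < r / 2 -> nc w < r / 2 -> w * K z w = J z w.
Proof.
move=> zc wr.
have cK : continuous (fun t => f (z + w * eit t)).
  by apply: continuous_circ => t; apply: cf; exact: circ_in.
have cJ : continuous (fun t => F (z + w * eit t) * emit t).
  apply: continuousCM; last exact: continuous_emit.
  by apply: continuous_circ => t; apply: cF; exact: circ_in.
have cwK : continuous (fun t => w * f (z + w * eit t)).
  exact: (continuousCM (@continuousC_cst R R w) cK).
apply: subr0_eq.
have E1 : cint (fun t => w * f (z + w * eit t)) 0 (2 * pi) = w * K z w.
  exact: (@cintZ R w _ 0 (2 * pi) cK).
have E2 : cint (fun t => w * f (z + w * eit t) - F (z + w * eit t) * emit t) 0 (2 * pi) =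
    cint (fun t => w * f (z + w * eit t)) 0 (2 * pi) - J z w.
  exact: (@cintB R _ _ 0 (2 * pi) cwK cJ).
rewrite -E1 -E2.
have := @cint_ftc R (fun t => - 'i * (F (z + w * eit t) * emit t))
   (fun t => w * f (z + w * eit t) - F (z + w * eit t) * emit t) 0 (2 * pi).
rewrite eit_period emit_period subrr => -> // t.
have d1 : cder (fun t => z + w * eit t) t (w * ('i * eit t)).
  by have := cderD (cder_cst z t) (cderMl w (cder_eit t)); rewrite add0r.
have d2 := cder_comp_holo (Ff (circ_in t zc wr)) d1.
have := cderMl (- 'i) (cderM d2 (cder_emit t)).
set X := (X in cder _ _ X -> _); set Y := (Y in _ -> cder _ _ Y).
suff -> : X = Y by [].
have i2 : 'i * 'i = -1 :> C by rewrite -expr2 sqr_i.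
rewrite /X /Y /=; have e1 := eitM t.
transitivity (- ('i * 'i) * (w * f (z + w * eit t) * (eit t * emit t) - F (z + w * eit t) * emit t)).
  by ring.
by rewrite i2 e1; ring.
Qed.

Let J_formula z (p : R) : nc (z - c) < r / 2 -> 0 < p < r / 2 ->
  J z p%:C = p%:C * ((2 * pi)%:C * f z).
Proof.
move=> zc /andP[p0 pr].
have zr : nc (z - c) < r by lra.
have nr (s : R) : 0 < s <= p -> nc s%:C < r / 2.
  by move=> /andP[s0 sp]; rewrite nc_real gtr0_norm//; lra.
have Kcst s : 0 < s <= p -> K z s%:C = K z p%:C.
  move=> sp'; have /andP[s0 sp] := sp'.
  (* [Q] is [K] on positive radii, written so that it can be differentiated; its derivative is ([K]
     - [J] / s) / s, which is 0 by [wK]. *)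
  pose Q s := (s^-1)%:C * J z s%:C.
  have KQ x : 0 < x <= p -> K z x%:C = Q x.
    move=> xp; rewrite /Q -wK ?nr// mulrA -rmorphM mulVf ?mul1r//.
    by case/andP: xp => /gt_eqF ->.
  rewrite (KQ s sp') (KQ p) ?p0 ?lexx//.
  have Qd t : s <= t <= p -> cder Q t 0.
    move=> /andP[st tp]; have t0 : 0 < t by lra.
    have ntr : nc t%:C < r / 2 by apply: nr; rewrite t0.
    have h1 : cder (fun s : R => (s^-1)%:C : C) t (- t ^- 2)%:C.
      have tn : id t != 0 :> R by rewrite gt_eqF.
      apply: cder_real; have := is_deriveV tn (is_derive_id (t : R) 1).
      by rewrite /GRing.scale/= mulr1.
    have h2 := cder_comp_holo (dJ zc ntr) (cder_id t).
    have := cderM h1 h2; set X := (X in cder _ _ X -> _); suff -> : X = 0 by [].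
    rewrite /X /= mulr1 -wK// mulrA -rmorphM -mulrDl -rmorphD /=.
    rewrite (_ : - t ^- 2 * t + t^-1 = 0); first by rewrite mul0r.
    by field; rewrite gt_eqF.
  apply/eqP; rewrite eq_sym -subr_eq0 -nc_eq0 eq_le nc_ge0 andbT.
  have := @cmvt R Q (fun=> 0) s p 0 sp Qd; rewrite mulr0 mul0r; apply.
  by move=> *; rewrite nc0.
have K0 : K z 0 = (2 * pi)%:C * f z.
  rewrite /K; under eq_fun do rewrite mul0r addr0.
  by rewrite cint_cst subr0.
have cK : {for 0, continuous (K z)}.
  apply: (@continuous_cint R C (fun w t => f (z + w * eit t)) 0).
  - exact: pi2_ge0.
  - apply/nbhs_ncP; exists (r / 2) => [|w]; first by rewrite divr_gt0.
    rewrite subr0 => wr; apply: continuous_circ => t; apply: cf.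
    exact: circ_in.
  - by move=> t; apply: continuous_circ2; apply: cf; rewrite mul0r addr0.
rewrite -wK ?nr ?p0 ?lexx//; congr (_ * _); rewrite -K0.
apply/eqP; rewrite -subr_eq0 -nc_eq0 eq_le nc_ge0 andbT.
apply/ler_addgt0Pr => e e0; rewrite add0r.
have /continuous_ncP /(_ e e0)[d d0 dP] := cK.
have m0 : 0 < Num.min p (d / 2) by rewrite lt_min p0 divr_gt0.
rewrite -(Kcst (Num.min p (d / 2))); last by rewrite m0 ge_min lexx.
apply/ltW/dP; rewrite subr0 nc_real gtr0_norm//.
by rewrite gt_min; apply/orP; right; lra.
Qed.

Lemma mean_value (p : R) : 0 < p < r / 2 ->
  cint (fun t => f (c + p%:C * eit t)) 0 (2 * pi) = (2 * pi)%:C * f c.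
Proof.
move=> pr; have /andP[p0 pr2] := pr.
have cc : nc (c - c) < r / 2 by rewrite subrr nc0 divr_gt0.
have pp : p%:C != 0 :> C by rewrite (inj_eq (@complexI R) p 0) gt_eqF.
apply: (mulfI pp); rewrite -J_formula// -wK//.
by rewrite nc_real gtr0_norm.
Qed.

Let k0 := ((r / 4)%:C * (2 * pi)%:C : C)^-1.

Let fE z : nc (z - c) < r / 2 ->
  f z = k0 * cint (fun t => F (z + (r / 4)%:C * eit t) * emit t) 0 (2 * pi).
Proof.
move=> zc; have r4 : 0 < r / 4 < r / 2 by move: r0 => ?; apply/andP; split; lra.
have := J_formula zc r4; rewrite /J => ->.
rewrite (mulrA (r / 4)%:C) mulrA mulVf ?mul1r// mulf_neq0//.
  by rewrite (inj_eq (@complexI R) _ 0) gt_eqF// divr_gt0.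
by rewrite (inj_eq (@complexI R) _ 0) gt_eqF// mulr_gt0// pi_gt0.
Qed.

(** f was only assumed continuous with primitive F. Written as an average of F over circles of the
    fixed radius r/4, it can be differentiated under the integral sign. *)
Lemma derive_circle_formula z : nc (z - c) < r / 2 ->
  is_derive z 1 f
    (k0 * cint (fun t => f (z + (r / 4)%:C * eit t) * emit t) 0 (2 * pi)).
Proof.
move=> zc.
have r4 : nc (r / 4)%:C < r / 2 by move: r0 => ?; rewrite nc_real gtr0_norm; lra.
have w'r w' : nc (w' - z) < r / 2 - nc (z - c) -> nc (w' - c) < r / 2.
  by have := ncD (w' - z) (z - c); rewrite addrA subrK; lra.
have d0 : 0 < r / 2 - nc (z - c) by rewrite subr_gt0.
have H : is_derive z 1 (fun z => cint (fun t => F (z + (r / 4)%:C * eit t) * emit t) 0 (2 * pi))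
    (cint (fun t => f (z + (r / 4)%:C * eit t) * emit t) 0 (2 * pi)).
  apply: (@is_derive_cint R (fun z t => F (z + (r / 4)%:C * eit t) * emit t)
    (fun z t => f (z + (r / 4)%:C * eit t) * emit t) z (r / 2 - nc (z - c))) => //.
  - exact: pi2_ge0.
  - move=> w' t /w'r w'r2 _.
    have Fd := Ff (circ_in t w'r2 r4).
    apply/is_deriveCP => e e0; have /is_deriveCP /(_ e e0)[d dd dP] := Fd.
    exists d => // h hd; have := dP h hd.
    apply: le_trans; rewrite -[leRHS]mulr1 -(nc_emit t) -ncM le_eqVlt; apply/orP; left.
    by apply/eqP; congr nc; rewrite (addrAC w'); ring.
  - move=> w' /w'r w'r2; apply: continuousCM; last exact: continuous_emit.
    by apply: continuous_circ => t; apply: cF; exact: circ_in.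
  - move=> t; apply: (@cvgM C (C * R)%type (nbhs (z, t))).
      by apply: continuous_circ3; apply: cf; exact: circ_in.
    apply: (@continuous_comp (C * R)%type R C snd emit); first exact: cvg_snd.
    exact: continuous_emit.
apply: (near_eq_is_derive (f := fun z => k0 * cint (fun t => F (z + (r / 4)%:C * eit t) * emit t) 0 (2 * pi))).
  apply/nbhs_ncP; exists (r / 2 - nc (z - c)) => // w /w'r wc.
  by rewrite [RHS]fE.
Qed.

Lemma continuous_circle_formula : {for c, continuous ('D_1 f)}.
Proof.
have cc : nc (c - c) < r / 2 by rewrite subrr nc0 divr_gt0.
have r4 : nc (r / 4)%:C < r / 2 by move: r0 => ?; rewrite nc_real gtr0_norm; lra.
have H : {for c, continuous (fun z => k0 * cint (fun t => f (z + (r / 4)%:C * eit t) * emit t) 0 (2 * pi))}.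
  apply: (@cvgM C C (nbhs c)); first exact: cvg_cst.
  apply: (@continuous_cint R C (fun z t => f (z + (r / 4)%:C * eit t) * emit t) c).
  - exact: pi2_ge0.
  - apply/nbhs_ncP; exists (r / 2) => [|w wr]; first by rewrite divr_gt0.
    apply: continuousCM; last exact: continuous_emit.
    by apply: continuous_circ => t; apply: cf; exact: circ_in.
  - move=> t; apply: (@cvgM C (C * R)%type (nbhs (c, t))).
      by apply: continuous_circ3; apply: cf; exact: circ_in.
    apply: (@continuous_comp (C * R)%type R C snd emit); first exact: cvg_snd.
    exact: continuous_emit.
apply/continuous_ncP => e e0; have /continuous_ncP /(_ e e0)[d d0 dP] := H.
exists (Num.min d (r / 2)) => [|w]; first by rewrite lt_min d0 divr_gt0.
rewrite lt_min => /andP[wd wr].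
have [_ ->] := derive_circle_formula wr; have [_ ->] := derive_circle_formula cc.
exact: dP.
Qed.

End Formula.
End CauchyFormula.

(** * Holomorphic functions of one variable *)

Section Holomorphic.
Variable R : realType.
Local Notation C := (cplx R).
Local Notation Re := (@complex.Re R).
Local Notation Im := (@complex.Im R).
Implicit Types (f g : C -> C) (z c : C) (r : R).

(** Retraction of the line onto a segment; [clamp] retracts the plane onto a rectangle. Composition
    with it extends a function given near a point to a continuous function on the plane, and later
    restricts lifting problems to a rectangle without changing their source. *)
Definition clampR (a b x : R) : R := Num.max a (Num.min x b).
Definition clamp (a1 b1 a2 b2 : R) (z : C) : C :=
  clampR a1 b1 (Re z) +i* clampR a2 b2 (Im z).

Lemma clampR_in a b x : a <= b -> a <= clampR a b x <= b.
Proof. by move=> ab; rewrite /clampR le_max lexx ge_max ab ge_min lexx orbT. Qed.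

Lemma clampR_id a b x : a <= x <= b -> clampR a b x = x.
Proof. by move=> /andP[ax xb]; rewrite /clampR (min_idPl xb) (max_idPr ax). Qed.

Lemma clampR_dist a b x y : `|clampR a b x - clampR a b y| <= `|x - y|.
Proof.
suff H u v : u <= v -> 0 <= clampR a b v - clampR a b u <= v - u.
  have [xy|/ltW yx] := leP x y.
    have /andP[h1 h2] := H _ _ xy; rewrite distrC (distrC x) ger0_norm//.
    by rewrite (le_trans h2)// ler_norm.
  have /andP[h1 h2] := H _ _ yx; rewrite ger0_norm//.
  by rewrite (le_trans h2)// ler_norm.
rewrite /clampR => uv.
have [ub|ub] := leP u b; have [vb|vb] := leP v b.
- by have [au|au] := leP a u; have [av|av] := leP a v; lra.
- by have [au|au] := leP a u; have [av|av] := leP a b; lra.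
- by lra.
- by have [au|au] := leP a b; lra.
Qed.

Lemma continuous_clamp a1 b1 a2 b2 : continuous (clamp a1 b1 a2 b2).
Proof.
move=> z; apply/continuous_ncP => e e0; exists (e / 2) => [|w]; first by rewrite divr_gt0.
move=> wz; apply: le_lt_trans (nc_le_ReIm _) _; rewrite cReD cImD cReN cImN /=.
have := clampR_dist a1 b1 (Re w) (Re z); have := clampR_dist a2 b2 (Im w) (Im z).
have := le_Re_nc (w - z); have := le_Im_nc (w - z).
rewrite cReD cImD cReN cImN; move: wz; lra.
Qed.

Lemma continuous_derivable f z : derivable f z 1 -> {for z, continuous f}.
Proof.
by move=> df; apply: differentiable_continuous; apply/derivable1_diffP.
Qed.

Lemma local_primitive f c r : 0 < r ->
  (forall z, nc (z - c) < r -> derivable f z 1) ->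
  exists F, forall z, nc (z - c) < r / 4 -> is_derive z 1 F (f z).
Proof.
(* The square of half side r/3 lies in the disk, as 2 r/3 < r, and it contains that of half side r/4
   with the margin r/12, on which the retraction is the identity. *)
move=> r0 df; pose p := r / 3.
pose k := clamp (Re c - p) (Re c + p) (Im c - p) (Im c + p).
have kin z : nc (k z - c) < r.
  apply: le_lt_trans (nc_le_ReIm _) _; rewrite cReD cImD cReN cImN /=.
  have pp (x : R) : x - p <= x + p by rewrite /p; lra.
  have := clampR_in (Re z) (pp (Re c)); have := clampR_in (Im z) (pp (Im c)).
  move=> /andP[i1 i2] /andP[r1 r2].
  have h1 : `|clampR (Re c - p) (Re c + p) (Re z) - Re c| <= p by rewrite ler_norml; lra.
  have h2 : `|clampR (Im c - p) (Im c + p) (Im z) - Im c| <= p by rewrite ler_norml; lra.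
  by move: h1 h2; rewrite /p; lra.
have kid z : `|Re z - Re c| <= p -> `|Im z - Im c| <= p -> k z = z.
  rewrite !ler_norml => z1 z2; apply: ceqP => /=; apply: clampR_id; lra.
have ck : continuous (f \o k).
  move=> z; apply: (@continuous_comp C C C k f z); first exact: continuous_clamp.
  exact: continuous_derivable (df _ (kin z)).
have r20 : 0 < r / 2 by lra.
have [] := @primitive_square R (f \o k) (Re c - r / 4) (Im c - r / 4) (r / 2) ck r20.
  move=> z z1 z2; apply: (near_eq_derivable (f := f)); last first.
    apply: df; apply: le_lt_trans (nc_le_ReIm _) _; rewrite cReD cImD cReN cImN /=.
    have h1 : `|Re z - Re c| <= r / 4 by rewrite ler_norml; lra.
    have h2 : `|Im z - Im c| <= r / 4 by rewrite ler_norml; lra.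
    by move: h1 h2; lra.
  apply/nbhs_ncP; exists (r / 12) => [|w wz]; first lra.
  rewrite /= kid//.
    have := le_Re_nc (w - z); rewrite cReD cReN /p !ler_norml; move: wz z1; lra.
  have := le_Im_nc (w - z); rewrite cImD cImN /p !ler_norml; move: wz z2; lra.
move=> F FP; exists F => z zc.
have := le_Re_nc (z - c); have := le_Im_nc (z - c).
rewrite cReD cReN cImD cImN !ler_norml => i1 i2.
have := FP z; rewrite /= kid; last 2 first.
- rewrite ler_norml /p; lra.
- rewrite ler_norml /p; lra.
by apply; lra.
Qed.

(** The circle formula is used twice: with a primitive of f it shows that f' is continuous; then f
    is itself a primitive of the continuous function f', and the formula shows that f' is
    differentiable. *)
Lemma holo_derivable f c r : 0 < r ->
  (forall z, nc (z - c) < r -> derivable f z 1) -> derivable ('D_1 f) c 1.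
Proof.
move=> r0 df; have [F FP] := local_primitive r0 df.
have r4 : 0 < r / 4 by lra.
have cf z : nc (z - c) < r / 4 -> {for z, continuous f}.
  by move=> zc; apply/continuous_derivable/df; lra.
have cdf z : nc (z - c) < r / 8 -> {for z, continuous ('D_1 f)}.
  move=> zc; have sub w : nc (w - z) < r / 8 -> nc (w - c) < r / 4.
    by have := ncD (w - z) (z - c); rewrite addrA subrK; lra.
  have r8 : 0 < r / 8 by lra.
  apply: (continuous_circle_formula r8 (F := F)) => w /sub wc; first exact: FP.
  exact: cf.
have r8 : 0 < r / 8 by lra.
have := @derive_circle_formula R f ('D_1 f) c (r / 8) r8 _ cdf c.
rewrite subrr nc0 divr_gt0// => H; apply: (ex_derive (is_derive := H _ isT)) => z zc.
by apply: derivableP; apply: df; lra.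
Qed.

Lemma mean_value_holo f c r (p : R) : (forall z, nc (z - c) < r -> derivable f z 1) ->
  0 < p < r / 8 ->
  cint (fun t => f (c + p%:C * eit t)) 0 (2 * pi) = (2 * pi)%:C * f c.
Proof.
move=> df pr; have r0 : 0 < r by case/andP: pr; lra.
have [F FP] := local_primitive r0 df.
have r4 : 0 < r / 4 by lra.
apply: (@mean_value R F f c (r / 4) r4 FP); last by lra.
by move=> z zc; apply/continuous_derivable/df; lra.
Qed.

(** The primitive lives on the disk of radius r/4 and the circle has a quarter of that radius, hence
    r/16. *)
Lemma derive_circle f c r : 0 < r -> (forall z, nc (z - c) < r -> derivable f z 1) ->
  is_derive c 1 f (((r / 16)%:C * (2 * pi)%:C)^-1 *
    cint (fun t => f (c + (r / 16)%:C * eit t) * emit t) 0 (2 * pi)).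
Proof.
move=> r0 df; have [F FP] := local_primitive r0 df.
have r4 : 0 < r / 4 by lra.
have cf z : nc (z - c) < r / 4 -> {for z, continuous f}.
  by move=> zc; apply/continuous_derivable/df; lra.
have := derive_circle_formula r4 FP cf (z := c).
rewrite subrr nc0 divr_gt0// (_ : r / 4 / 4 = r / 16); last by field.
exact.
Qed.

Lemma circle_bound f c (p M : R) : 0 <= p ->
  (forall z, nc (z - c) = p -> {for z, continuous f}) ->
  (forall z, nc (z - c) = p -> nc (f z) <= M) ->
  continuous (fun t => f (c + p%:C * eit t)) /\
  (forall t, nc (f (c + p%:C * eit t)) <= M).
Proof.
move=> p0 cf fM.
have H t : nc (c + p%:C * eit t - c) = p.
  by rewrite addrAC subrr add0r ncM nc_eit mulr1 nc_real ger0_norm.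
split=> t; last exact: fM.
apply: (@continuous_comp R C C (fun t => c + p%:C * eit t) f); last exact/cf/H.
apply: continuousCD; first exact: continuousC_cst.
by apply: continuousCM; [exact: continuousC_cst|exact: continuous_eit].
Qed.

Lemma mean_value_bound f c r (p M : R) : (forall z, nc (z - c) < r -> derivable f z 1) ->
  0 < p < r / 8 -> (forall z, nc (z - c) = p -> nc (f z) <= M) -> nc (f c) <= 2 * M.
Proof.
move=> df pr fM; have /andP[p0 pr8] := pr.
have cf z : nc (z - c) = p -> {for z, continuous f}.
  by move=> zc; apply/continuous_derivable/df; lra.
have [cc cM] := circle_bound (ltW p0) cf fM.
have := @cint_bound R _ 0 (2 * pi) M cc (pi2_ge0 R) (fun t _ => cM t).
have pi0 : 0 < 2 * pi :> R by rewrite mulr_gt0// pi_gt0.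
rewrite (mean_value_holo df pr) subr0 ncM nc_real gtr0_norm// mulrC.
by rewrite ler_pM2r.
Qed.

Lemma cauchy_estimate f c r M : 0 < r ->
  (forall z, nc (z - c) < r -> derivable f z 1) ->
  (forall z, nc (z - c) < r -> nc (f z) <= M) -> nc ('D_1 f c) <= 32 * M / r.
Proof.
move=> r0 df fM; have [_ ->] := derive_circle r0 df.
have r16 : 0 <= r / 16 by lra.
have [||cc cM] := @circle_bound f c (r / 16) M r16.
- by move=> z zc; apply/continuous_derivable/df; lra.
- by move=> z zc; apply: fM; lra.
have ce : continuous (fun t => f (c + (r / 16)%:C * eit t) * emit t).
  exact: (continuousCM cc (@continuous_emit R)).
have eM t : nc (f (c + (r / 16)%:C * eit t) * emit t) <= M.
  by rewrite ncM nc_emit mulr1.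
have := @cint_bound R _ 0 (2 * pi) M ce (pi2_ge0 R) (fun t _ => eM t).
have pi0 : 0 < 2 * pi :> R by rewrite mulr_gt0// pi_gt0.
rewrite subr0 => H; rewrite ncM ncV ncM !nc_real (gtr0_norm pi0) ger0_norm//.
rewrite mulrC ler_pdivrMr ?mulr_gt0//; last by lra.
apply: le_trans H _; rewrite le_eqVlt; apply/orP; left; apply/eqP.
by field; rewrite gt_eqF.
Qed.

Lemma is_derive_subc (c z : C) : is_derive z 1 (fun w : C => w - c) 1.
Proof.
exact: (is_derive_eq (is_deriveB (is_derive_id z 1) (is_derive_cst c z 1)) (subr0 _)).
Qed.

(** By continuity of f, the product H = (z - c) f is differentiable at c too, hence holomorphic and
    twice differentiable. Its second-order expansion at c, divided by z - c, is the first-order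
    expansion of f, with derivative H''(c)/2. *)
Lemma removable f c r : 0 < r ->
  (forall z, nc (z - c) < r -> z != c -> derivable f z 1) ->
  {for c, continuous f} -> derivable f c 1.
Proof.
move=> r0 df cf; pose H z := (z - c) * f z.
have Hc : is_derive c 1 H (f c).
  apply/is_deriveCP => e e0; have /continuous_ncP /(_ e e0)[d d0 dP] := cf.
  exists d => // h hd; rewrite /H subrr mul0r subr0 (addrC c) addrK -mulrBr ncM mulrC.
  by rewrite ler_wpM2r ?nc_ge0// ltW// dP// addrK.
have dH z : nc (z - c) < r -> derivable H z 1.
  have [->|zc zr] := eqVneq z c; first by move=> _; exact: (ex_derive (is_derive := Hc)).
  exact: (derivableM (ex_derive (is_derive := is_derive_subc c z)) (df z zr zc)).
have dDH := holo_derivable r0 dH.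
have /is_deriveCP DP := derivableP dDH; set l := 'D_1 ('D_1 H) c in DP.
suff : is_derive c 1 f (l / 2) by move=> X; exact: ex_derive.
apply/is_deriveCP => e e0.
have e2 : 0 < e / 2 by rewrite divr_gt0.
have [d d0 dP] := DP _ e2.
exists (Num.min d r) => [|h]; first by rewrite lt_min d0.
rewrite lt_min => /andP[hd hr].
have [->|h0] := eqVneq h 0; first by rewrite addr0 subrr mul0r subr0 nc0 mulr0.
have hh : 0 < nc h by rewrite nc_gt0.
rewrite -(ler_pM2l hh) -ncM.
(* Subtracting the quadratic Taylor term leaves a function whose derivative varies by o(h) on the
   segment, so [holo_mvt] gives the second-order expansion of H. *)
pose G z := H z - l / 2 * ((z - c) * (z - c)).
have seg (s : R) : 0 <= s <= 1 -> nc (s%:C * h) <= nc h.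
  move=> /andP[s0 s1]; rewrite ncM nc_real ger0_norm//.
  by rewrite -[leRHS]mul1r ler_wpM2r ?nc_ge0.
have -> : h * (f (c + h) - f c - h * (l / 2)) = G (c + h) - G c - h * 'D_1 H c.
  have [_ ->] := Hc; rewrite /G /H subrr !mul0r (addrC c) addrK !mulr0; ring.
have -> : nc h * (e * nc h) = 2 * (e / 2 * nc h) * nc h by field.
apply: (@holo_mvt R G (fun z => 'D_1 H z - l * (z - c)) c h) => s s01.
  have sr : nc (c + s%:C * h - c) < r.
    by rewrite (addrC c) addrK; exact: le_lt_trans (seg s s01) hr.
  have h1 := is_derive_subc c (c + s%:C * h).
  have h2 := is_deriveZ (l / 2) (is_deriveM h1 h1).
  apply: (is_derive_eq (is_deriveB (derivableP (dH _ sr)) h2)).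
  by rewrite /GRing.scale/=; field.
have := dP (s%:C * h) (le_lt_trans (seg s s01) hd).
set X := 'D_1 H (c + s%:C * h); set Y := 'D_1 H c => XY.
have -> : X - l * (c + s%:C * h - c) - Y = X - Y - s%:C * h * l by ring.
apply: le_trans XY _; rewrite ler_pM2l//; exact: seg.
Qed.

Lemma zero_derive_eq f z h :
  (forall s : R, 0 <= s <= 1 -> is_derive (z + s%:C * h) 1 f 0) -> f (z + h) = f z.
Proof.
move=> df; apply/eqP; rewrite -subr_eq0 -nc_eq0 eq_le nc_ge0 andbT.
have := @holo_mvt R f (fun=> 0) z h 0 0 df.
rewrite !(mulr0, subr0, mul0r); apply=> s _.
by rewrite nc0.
Qed.

End Holomorphic.

(** * Zeros and inverses of holomorphic functions *)

Section Zeros.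
Variable R : realType.
Local Notation C := (cplx R).
Implicit Types (f g : C -> C) (z c : C) (r : R).

(** Divided difference at c, completed by the derivative. It stays holomorphic by [removable], and
    iterating it plays the role of the Taylor expansion. *)
Definition dquot c g : C -> C :=
  fun z => if z == c then 'D_1 g c else (g z - g c) / (z - c).

Lemma dquot_derivable c g r : (forall z, nc (z - c) < r -> derivable g z 1) ->
  forall z, nc (z - c) < r -> derivable (dquot c g) z 1.
Proof.
move=> dg; have off z : nc (z - c) < r -> z != c -> derivable (dquot c g) z 1.
  move=> zr zc.
  have h1 : derivable (fun w => g w - g c) z 1.
    exact: (derivableB (dg z zr) (derivable_cst (g c) z 1)).
  have h2 : derivable (fun w : C => (w - c)^-1) z 1.
    by apply: (@derivableV C C (fun w => w - c)); [rewrite subr_eq0|exact: (ex_derive (is_derive := is_derive_subc c z))].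
  apply: (near_eq_derivable (f := fun w => (g w - g c) / (w - c))); last exact: (derivableM h1 h2).
  apply/nbhs_ncP; exists (nc (z - c)) => [|w wz]; first by rewrite nc_gt0 subr_eq0.
  rewrite /dquot ifF//; apply/eqP => wc; move: wz.
  by rewrite wc ncB ltxx.
move=> z zr; have [zc|] := eqVneq z c; last exact: off.
have r0 : 0 < r by apply: le_lt_trans zr; exact: nc_ge0.
rewrite zc; apply: (removable r0 off); apply/continuous_ncP => e e0.
have cr : nc (c - c) < r by rewrite subrr nc0.
have e2 : 0 < e / 2 by rewrite divr_gt0.
have /is_deriveCP /(_ _ e2)[d d0 dP] := derivableP (dg c cr).
exists d => // w wd; rewrite /dquot eqxx; case: eqP => [_|/eqP wc].
  by rewrite subrr nc0.
have := dP _ wd; rewrite (addrC c) subrK => H.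
have wc0 : w - c != 0 by rewrite subr_eq0.
have wcp : 0 < nc (w - c) by rewrite nc_gt0.
rewrite -(ltr_pM2l wcp) -ncM.
have -> : (w - c) * ((g w - g c) / (w - c) - 'D_1 g c) = g w - g c - (w - c) * 'D_1 g c.
  by rewrite mulrBr mulrCA mulfV// mulr1.
apply: le_lt_trans H _; rewrite mulrC ltr_pM2l//; lra.
Qed.

Lemma isolated_zeros g c r : 0 < r -> (forall z, nc (z - c) < r -> derivable g z 1) ->
  (exists2 d, 0 < d & forall z, nc (z - c) < d -> g z = 0) \/
  (exists2 d, 0 < d & forall z, nc (z - c) < d -> z != c -> g z != 0).
Proof.
move=> r0 dg.
pose G n := iter n (dquot c) g.
have dG n z : nc (z - c) < r -> derivable (G n) z 1.
  by elim: n z => [|n IH] z zr; [exact: dg|exact: (dquot_derivable IH)].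
have GE n : (forall m, (m < n)%N -> G m c = 0) -> forall z, g z = (z - c) ^+ n * G n z.
  elim: n => [|n IH] H z; first by rewrite expr0 mul1r.
  rewrite IH => [|m mn]; last by apply: H; exact: ltnW.
  rewrite [G n.+1]/G iterS -/(G n) /dquot; case: eqP => [->|/eqP zc].
    by rewrite subrr exprS mul0r mul0r H// mulr0.
  by rewrite H// subr0 exprS; field; rewrite subr_eq0.
have [[n nG]|nex] := pselect (exists n, G n c != 0).
  right; have [m mG mmin] := ex_minnP (ex_intro (fun n => G n c != 0) n nG).
  have E := GE m; have {}E : forall z, g z = (z - c) ^+ m * G m z.
    apply: E => k km; apply/eqP/negPn/negP => /mmin; by rewrite leqNgt km.
  have cr : nc (c - c) < r by rewrite subrr nc0.
  have := continuous_derivable (dG m c cr).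
  have Gp : 0 < nc (G m c) by rewrite nc_gt0.
  move=> /continuous_ncP /(_ _ Gp)[d d0 dP]; exists d => // z /dP zd zc.
  rewrite E mulf_neq0// ?expf_neq0 ?subr_eq0//.
  by apply/eqP => Gz; move: zd; rewrite Gz sub0r ncN ltxx.
left.
have {nex}Gc n : G n c = 0 by apply/eqP/negPn/negP => H; apply: nex; exists n.
have E n z : g z = (z - c) ^+ n * G n z by apply: GE.
have cr : nc (c - c) < r by rewrite subrr nc0.
have [d d0 dP] := (continuous_ncP g c).1 (continuous_derivable (dg c cr)) 1 ltr01.
pose q := Num.min r d.
have q0 : 0 < q by rewrite lt_min r0.
have gq z : nc (z - c) < q -> nc (g z) <= 1.
  rewrite lt_min => /andP[_ /dP]; have := Gc 0%N; rewrite /G /= => ->.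
  by rewrite subr0 => /ltW.
exists (q / 100) => [|y yq]; first by rewrite divr_gt0.
(* On the circle of radius p around y one has |z - c| >= 3p/4, because |y - c| < q/100 = p/5, and |y
   - c| is below a third of 3p/4; this ratio produces the 3^(-n). Also p < (q/2)/8, as the mean
   value bound requires. *)
pose p := q / 20.
have bound n : nc (g y) <= 2 * (3^-1) ^+ n.
  have p3 : 0 < (3 / 4 * p) ^+ n by rewrite exprn_gt0// /p; lra.
  have H : nc (G n y) <= 2 * ((3 / 4 * p) ^+ n)^-1.
    apply: (@mean_value_bound R (G n) y (q / 2) p).
    - move=> z zy; apply: dG; have := ncD (z - y) (y - c).
      rewrite addrA subrK => ?; have : q <= r by rewrite ge_min lexx.
      lra.
    - by rewrite /p; apply/andP; split; lra.
    move=> z zy.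
    have zc : 3 / 4 * p <= nc (z - c).
      have := ncD (z - c) (c - y); rewrite addrA subrK (ncB c) zy /p; lra.
    have zq : nc (z - c) < q.
      have := ncD (z - y) (y - c); rewrite addrA subrK zy /p; lra.
    have := gq z zq; rewrite (E n) ncM ncX => H1.
    have H2 : (3 / 4 * p) ^+ n <= nc (z - c) ^+ n.
      by rewrite lerXn2r ?nnegrE ?nc_ge0// /p; lra.
    rewrite -[leRHS]mulr1 ler_pdivlMl//; apply: le_trans H1.
    by rewrite ler_wpM2r ?nc_ge0.
  rewrite (E n) ncM ncX.
  have yp : nc (y - c) <= 3^-1 * (3 / 4 * p) by rewrite /p; lra.
  have H2 : nc (y - c) ^+ n <= (3^-1 * (3 / 4 * p)) ^+ n.
    rewrite lerXn2r ?nnegrE ?nc_ge0//; apply: le_trans yp; exact: nc_ge0.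
  apply: le_trans (ler_pM _ (nc_ge0 _) H2 H) _; first by rewrite exprn_ge0 ?nc_ge0.
  rewrite exprMn; move: p3; set Y := (3 / 4 * p) ^+ n; set Z := 3^-1 ^+ n => Y0.
  by rewrite le_eqVlt; apply/orP; left; apply/eqP; field; rewrite gt_eqF.
apply/eqP; rewrite -nc_eq0 eq_le nc_ge0 andbT.
apply/ler_addgt0Pr => e e0; rewrite add0r.
have := @cvg_geometric _ 2 (3^-1 : R) _.
rewrite ger0_norm ?invr_ge0// invf_lt1 ?ltr1n// => /(_ isT).
move=> /(@cvgrPdist_lt R R nat _ _) /(_ e e0)[n _ /(_ n (leqnn _))].
rewrite sub0r normrN /geometric/= => H.
by apply: le_trans (bound n) _; apply: ltW; apply: le_lt_trans H; exact: ler_norm.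
Qed.

Lemma is_derive_compC f g (z a b : C) : is_derive (g z) 1 f a -> is_derive z 1 g b ->
  is_derive z 1 (f \o g) (a * b).
Proof.
move=> /is_deriveCP fl gm; apply/is_deriveCP => e e0.
have cg := continuous_derivable (ex_derive (is_derive := gm)).
have {}gm := (is_deriveCP g z b).1 gm.
have M0 : 0 < 1 + nc a by rewrite ltr_pwDl// nc_ge0.
have N0 : 0 < 2 * (1 + nc b) by rewrite mulr_gt0// ltr_pwDl// nc_ge0.
have [d d0 dP] := fl _ (divr_gt0 e0 N0).
have [d1 d10 dP1] := gm _ (divr_gt0 e0 (mulr_gt0 (@ltr0n R 2) M0)).
have [d2 d20 dP2] := gm _ ltr01.
have [d3 d30 dP3] := (continuous_ncP g z).1 cg d d0.
exists (Num.min d1 (Num.min d2 d3)) => [|h]; first by rewrite !lt_min d10 d20.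
rewrite !lt_min => /andP[/dP1 h1 /andP[/dP2 h2 h3]].
have {}h3 : nc (g (z + h) - g z) < d by apply: dP3; rewrite addrAC subrr add0r.
have := dP _ h3; rewrite addrCA subrr addr0 /=.
set D := g (z + h) - g z in h1 h2 *; move=> h4.
have -> : f (g (z + h)) - f (g z) - h * (a * b) =
  (f (g (z + h)) - f (g z) - D * a) + a * (D - h * b) by ring.
have h5 : nc D <= (1 + nc b) * nc h.
  have := ncD (D - h * b) (h * b); rewrite subrK ncM; lra.
apply: le_trans (ncD _ _) _; rewrite ncM.
have h6 : nc (f (g (z + h)) - f (g z) - D * a) <= e / 2 * nc h.
  apply: le_trans h4 _.
  have -> : e / 2 * nc h = e / (2 * (1 + nc b)) * ((1 + nc b) * nc h).
    by field; rewrite gt_eqF// ltr_pwDl// nc_ge0.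
  by rewrite ler_pM2l// divr_gt0.
have h7 : nc a * nc (D - h * b) <= e / 2 * nc h.
  apply: le_trans (_ : (1 + nc a) * nc (D - h * b) <= _).
    by rewrite ler_wpM2r ?nc_ge0// lerDr.
  have -> : e / 2 * nc h = (1 + nc a) * (e / (2 * (1 + nc a)) * nc h).
    by field; rewrite gt_eqF.
  by rewrite ler_pM2l.
lra.
Qed.

Lemma is_derive_inverseC f g (y0 l : C) : is_derive y0 1 f l -> l != 0 ->
  g (f y0) = y0 -> {for f y0, continuous g} ->
  (\forall w \near f y0, f (g w) = w) -> is_derive (f y0) 1 g l^-1.
Proof.
move=> /is_deriveCP df l0 gf cg /nbhs_ncP[d1 d10 dP1]; apply/is_deriveCP => e e0.
have lp : 0 < nc l by rewrite nc_gt0.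
(* The first bound gives |k| <= 2 |h| / |l| for the increment k of the inverse, the second turns
   this into the required precision. *)
pose e' := Num.min (nc l / 2) (e * nc l ^+ 2 / 2).
have e'0 : 0 < e' by rewrite lt_min !divr_gt0// mulr_gt0// exprn_gt0.
have [d2 d20 dP2] := df _ e'0.
have [d3 d30 dP3] := (continuous_ncP g (f y0)).1 cg d2 d20.
exists (Num.min d1 d3) => [|h]; first by rewrite lt_min d10.
rewrite lt_min => /andP[h1 h3].
have fg : f (g (f y0 + h)) = f y0 + h by apply: dP1; rewrite addrAC subrr add0r.
have kd : nc (g (f y0 + h) - g (f y0)) < d2 by apply: dP3; rewrite addrAC subrr add0r.
set k := g (f y0 + h) - g (f y0) in kd *.
have := dP2 k kd; rewrite {1}/k gf (addrC y0) subrK fg (addrAC (f y0)) subrr add0r => H.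
have e1 : e' <= nc l / 2 by rewrite ge_min lexx.
have e2 : e' <= e * nc l ^+ 2 / 2 by rewrite ge_min lexx orbT.
have H1 : nc k * nc l <= 2 * nc h.
  have := ncD (k * l - h) h; rewrite subrK ncM (ncB (k * l)) => H'.
  have := ler_wpM2r (nc_ge0 k) e1; lra.
have -> : k - h * l^-1 = - (h - k * l) * l^-1.
  by rewrite opprB mulrBl mulfK.
rewrite ncM ncN ncV ler_pdivrMr//; apply: le_trans H _.
have := ler_wpM2r (nc_ge0 k) e2.
have : e * nc l ^+ 2 / 2 * nc k = e * nc l / 2 * (nc k * nc l) by ring.
have := ler_wpM2l (ltW (mulr_gt0 e0 lp)) H1.
lra.
Qed.

(** Suppose f'(y0) = 0. If f' vanishes near y0, f is constant there and not injective. Otherwise f'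
    is non-zero off y0, so the continuous inverse g is differentiable off f(y0), hence also at f(y0)
    by [removable], and the chain rule reads 1 = g' . 0. *)
Lemma derive_injective_neq0 f g y0 r : 0 < r ->
  (forall y, nc (y - y0) < r -> derivable f y 1) ->
  (forall y, nc (y - y0) < r -> g (f y) = y) ->
  (forall y, nc (y - y0) < r -> {for f y, continuous g}) ->
  (forall y, nc (y - y0) < r -> \forall w \near f y, f (g w) = w) ->
  'D_1 f y0 != 0.
Proof.
move=> r0 df gf cg fg; apply/eqP => f0.
have y0r : nc (y0 - y0) < r by rewrite subrr nc0.
have r2 : 0 < r / 2 by rewrite divr_gt0.
have ddf z : nc (z - y0) < r / 2 -> derivable ('D_1 f) z 1.
  move=> zr; apply: (holo_derivable (r := r / 2)) => // w wz; apply: df.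
  by have := ncD (w - z) (z - y0); rewrite addrA subrK; lra.
have [[d d0 dP]|[d d0 dP]] := isolated_zeros r2 ddf.
  pose q := Num.min d r / 2.
  have q0 : 0 < q by rewrite divr_gt0// lt_min d0.
  have qd : q < d /\ q < r.
    have := q0; rewrite /q; have [] := leP d r; lra.
  have ncq : nc q%:C = q by rewrite nc_real gtr0_norm.
  have E : f (y0 + q%:C) = f y0.
    apply: zero_derive_eq => s /andP[s0 s1].
    have sq : nc (s%:C * q%:C) <= q.
      rewrite ncM ncq nc_real ger0_norm// -[leRHS]mul1r.
      by rewrite ler_wpM2r// ltW.
    rewrite -(dP (y0 + s%:C * q%:C)); last by rewrite (addrC y0) addrK; lra.
    by apply/derivableP/df; rewrite (addrC y0) addrK; lra.
  have := gf (y0 + q%:C); rewrite E gf// (addrC y0) addrK ncq => /(_ qd.2).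
  move=> /(congr1 (fun w => w - y0)); rewrite subrr addrK => /esym/(congr1 nc).
  by rewrite ncq nc0 => q00; rewrite q00 ltxx in q0.
have [d1 d10 dP1] := (nbhs_ncP _ _).1 (fg y0 y0r).
have m0 : 0 < Num.min d r by rewrite lt_min d0.
have [d2 d20 dP2] := (continuous_ncP g (f y0)).1 (cg _ y0r) _ m0.
have q0 : 0 < Num.min d1 d2 by rewrite lt_min d10.
have dg : derivable g (f y0) 1.
  apply: (removable q0); last exact: cg.
  move=> w; rewrite lt_min => /andP[w1 w2] wf.
  have fgw := dP1 w w1; have := dP2 w w2; rewrite gf// lt_min => /andP[gw1 gw2].
  have gy : g w != y0 by apply: contra_neq wf => gw; rewrite -fgw gw.
  rewrite -fgw; apply: (@ex_derive _ _ _ _ _ _ _ (@is_derive_inverseC f g (g w) ('D_1 f (g w)) _ _ _ _ _)).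
  - exact: derivableP (df _ gw2).
  - exact: dP.
  - exact: gf.
  - exact: cg.
  - exact: fg.
have D1 := is_derive_compC (derivableP dg) (derivableP (df y0 y0r)).
have [_ D1'] := D1.
have D2 : 'D_1 (g \o f) y0 = 'D_1 id y0.
  apply: near_eq_derive.
  by apply/nbhs_ncP; exists r => // w wr /=; exact: gf.
move: D1'; rewrite D2 derive_id f0 mulr0 => /eqP; apply/negP; exact: oner_neq0.
Qed.

End Zeros.

(** * Automorphisms of the complex plane *)

Section AffineAutomorphism.
Variable R : realType.
Local Notation C := (cplx R).
Local Notation Re := (@complex.Re R).
Local Notation Im := (@complex.Im R).
Implicit Types (f g : C -> C) (z c : C) (r : R).

Lemma bounded_on_disk f (p : R) : continuous f ->
  exists2 N : R, 0 < N & forall z, nc z <= p -> nc (f z) <= N.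
Proof.
move=> cf; pose q := Num.max p 1.
have q0 : 0 < q by rewrite lt_max ltr01 orbT.
have l0 : 0 < 2 * q by lra.
have [] := @square_induction R (fun x y s => exists N, forall z,
  x <= Re z <= x + s -> y <= Im z <= y + s -> nc (f z) <= N) (- q) (- q) (2 * q) l0.
- move=> x y s _ _ _ _ s0 [N1 H1] [N2 H2] [N3 H3] [N4 H4].
  exists (Num.max (Num.max N1 N2) (Num.max N3 N4)) => z z1 z2.
  rewrite !le_max -!orbA.
  have [zx|zx] := leP (Re z) (x + s); have [zy|zy] := leP (Im z) (y + s).
  + by rewrite H1//; lra.
  + by rewrite H3 ?orbT//; lra.
  + by rewrite H2 ?orbT//; lra.
  + by rewrite H4 ?orbT//; lra.
- move=> x y _ _.
  have [d d0 dP] := (continuous_ncP f (x +i* y)).1 (cf _) 1 ltr01.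
  exists (d / 2) => [|x' y' s _ _ _ _ /andP[s0 sd] xx yy]; first by rewrite divr_gt0.
  exists (nc (f (x +i* y)) + 1) => z z1 z2.
  have zd : nc (z - (x +i* y)) < d.
    apply: le_lt_trans (nc_le_ReIm _) _; rewrite cReD cImD cReN cImN /=.
    have h1 : `|Re z - x| <= s by rewrite ler_norml; lra.
    have h2 : `|Im z - y| <= s by rewrite ler_norml; lra.
    by move: h1 h2; lra.
  have := dP z zd; have := ncD (f z - f (x +i* y)) (f (x +i* y)).
  rewrite subrK; lra.
- move=> N HN; exists (Num.max N 1) => [|z zp]; first by rewrite lt_max ltr01 orbT.
  rewrite le_max HN//.
    have := le_Re_nc z; have : p <= q by rewrite le_max lexx.
    rewrite ler_norml; move: zp; lra.
  have := le_Im_nc z; have : p <= q by rewrite le_max lexx.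
  rewrite ler_norml; move: zp; lra.
Qed.

(** The map H in the coordinate 1/w at infinity, for H normalised by H(0) = 0, with the point at
    infinity sent to itself. *)
Definition at_infinity (H : C -> C) (w : C) : C := if w == 0 then 0 else (H w^-1)^-1.

Lemma at_infinityK (H K : C -> C) : H 0 = 0 -> K 0 = 0 -> cancel H K ->
  cancel (at_infinity H) (at_infinity K).
Proof.
move=> H0 K0 HK w; rewrite /at_infinity; case: (eqVneq w 0) => [->|w0].
  by rewrite eqxx.
rewrite ifF; first by rewrite invrK HK invrK.
apply/negbTE; rewrite invr_eq0; apply/eqP => Hw.
by have := HK w^-1; rewrite Hw K0 => /esym/eqP; rewrite invr_eq0; apply/negP.
Qed.

(** At 0 this is properness of H: its inverse K is bounded by some N on the disk of radius 1/e, so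
    |z| > N forces |H(z)| > 1/e. *)
Lemma at_infinity_continuous (H K : C -> C) : H 0 = 0 -> K 0 = 0 -> cancel H K ->
  continuous H -> continuous K -> continuous (at_infinity H).
Proof.
move=> H0 K0 HK cH cK w; have [->|w0] := eqVneq w 0; last first.
  have Hw : H w^-1 != 0.
    apply/eqP => Hw; have := HK w^-1; rewrite Hw K0 => /esym/eqP.
    by rewrite invr_eq0; apply/negP.
  have cH' : {for w, continuous (fun w : C => (H w^-1)^-1)}.
    apply: (@cvgV C C (nbhs w) _ (fun w : C => H w^-1) (H w^-1) Hw).
    apply: (@continuous_comp C C C (fun w : C => w^-1) H w); last exact: cH.
    exact: inv_continuous.
  apply/continuous_ncP => e e0; have [d d0 dP] := (continuous_ncP _ _).1 cH' e e0.
  exists (Num.min d (nc w)) => [|v]; first by rewrite lt_min d0 nc_gt0.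
  rewrite lt_min => /andP[vd vw]; rewrite /at_infinity (negbTE w0) ifF; first exact: dP.
  by apply/eqP => v0; move: vw; rewrite v0 sub0r ncN ltxx.
apply/continuous_ncP => e e0.
have [N N0 NP] := bounded_on_disk (e^-1) cK.
exists N^-1 => [|v]; first by rewrite invr_gt0.
rewrite subr0 {2}/at_infinity eqxx subr0 /at_infinity => vN.
case: eqP => [_|/eqP v0]; first by rewrite nc0.
rewrite ncV -(invrK e) ltf_pV2 ?posrE ?invr_gt0//.
  rewrite ltNge; apply/negP => /NP; rewrite HK ncV => H1.
  have vp : 0 < nc v by rewrite nc_gt0.
  have : N < (nc v)^-1 by rewrite -(invrK N) ltf_pV2 ?posrE// invr_gt0.
  by move: H1; lra.
rewrite nc_gt0; apply/eqP => Hw; have := HK v^-1; rewrite Hw K0 => /esym/eqP.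
by rewrite invr_eq0; apply/negP.
Qed.

Lemma is_derive_mulc (c z : C) : is_derive z 1 (fun w : C => c * w) c.
Proof.
apply: (is_derive_eq (is_deriveZ c (is_derive_id z 1))).
exact: mulr1.
Qed.

Lemma is_derive_invc (c : C) : c != 0 -> is_derive c 1 (fun w : C => w^-1) (- c ^- 2).
Proof.
move=> c0; have [di dE] := is_derive_id c (1 : C).
apply: DeriveDef; first exact: (@derivableV C C id c 1 c0 di).
have := @deriveV C C id c 1 c0 di; rewrite dE => ->.
exact: mulr1.
Qed.

Lemma entire_linear_growth f (A B : R) : 0 <= A -> 0 <= B ->
  (forall z, derivable f z 1) -> (forall z, nc (f z) <= A * nc z + B) ->
  forall z, f z = f 0 + 'D_1 f 0 * z.
Proof.
move=> A0 B0 df fAB.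
have ddf z : derivable ('D_1 f) z 1.
  by apply: (@holo_derivable R f z 1).
have dfb z : nc ('D_1 f z) <= 32 * (2 * A + 1).
  (* On the disk of this radius around z one has |w| <= 2r, hence |f| <= (2A + 1) r, and r cancels
     in the Cauchy estimate. *)
  pose r := nc z + B + 1.
  have r0 : 0 < r by have := nc_ge0 z; rewrite /r; lra.
  have fb w : nc (w - z) < r -> nc (f w) <= (2 * A + 1) * r.
    move=> wz; apply: le_trans (fAB w) _.
    have : nc w <= 2 * r.
      have := ncD (w - z) z; rewrite subrK; rewrite /r in wz *; lra.
    move=> /(ler_wpM2l A0); have := nc_ge0 z; rewrite /r; lra.
  have := cauchy_estimate r0 (fun w _ => df w) fb.
  by rewrite mulrA mulfK// gt_eqF.
have ddf0 z : 'D_1 ('D_1 f) z = 0.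
  apply/eqP; rewrite -nc_eq0 eq_le nc_ge0 andbT; apply/ler_addgt0Pr => e e0.
  have M0 : 0 < 32 * (32 * (2 * A + 1)) by lra.
  have r0 := divr_gt0 M0 e0; rewrite add0r.
  have := @cauchy_estimate R ('D_1 f) z _ (32 * (2 * A + 1)) r0 (fun w _ => ddf w) (fun w _ => dfb w).
  have E (X : R) : 0 < X -> X / (X / e) = e by move=> X0; field; rewrite !gt_eqF.
  by rewrite E.
have df0 z : 'D_1 f z = 'D_1 f 0.
  have := @zero_derive_eq R ('D_1 f) 0 z; rewrite add0r; apply=> s _.
  by have := derivableP (ddf (0 + s%:C * z)); rewrite ddf0.
move=> z; pose L := 'D_1 f 0.
have : f (0 + z) - L * (0 + z) = f 0 - L * 0.
  apply: (@zero_derive_eq R (fun w => f w - L * w) 0 z) => s _.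
  apply: (is_derive_eq (is_deriveB (derivableP (df _)) (is_derive_mulc L _))).
  by rewrite df0 subrr.
by rewrite add0r mulr0 subr0 => <-; rewrite subrK.
Qed.

(** Conjugated by inversion, the normalised automorphism is an injective entire map q with q(0) = 0,
    so q'(0) is non-zero. Hence |q(w)| >= c |w| near 0, which says that the automorphism grows at
    most linearly; Liouville's argument finishes. *)
Lemma automorphism_affine (h k : C -> C) : cancel h k -> cancel k h ->
  (forall z, derivable h z 1) -> continuous k ->
  exists2 a, a != 0 & forall z, h z = a * z + h 0.
Proof.
move=> hk kh dh ck.
pose H z := h z - h 0; pose K w := k (w + h 0).
have H0 : H 0 = 0 by rewrite /H subrr.
have K0 : K 0 = 0 by rewrite /K add0r hk.
have HK : cancel H K by move=> z; rewrite /H /K subrK hk.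
have KH : cancel K H by move=> z; rewrite /H /K kh addrK.
have dH z : derivable H z 1 by exact: (derivableB (dh z) (derivable_cst (h 0) z 1)).
have cH : continuous H by move=> z; exact: continuous_derivable.
have cK : continuous K.
  move=> z; apply: (@continuous_comp C C C (fun w => w + h 0) k); last exact: ck.
  apply: (@continuousCD R C id (fun=> h 0)); last exact: continuousC_cst.
  by move=> ?; exact: cvg_id.
pose q := at_infinity H; pose p := at_infinity K.
have cq : continuous q by exact: (at_infinity_continuous H0 K0 HK cH cK).
have cp : continuous p by exact: (at_infinity_continuous K0 H0 KH cK cH).
have qp : cancel q p by exact: (at_infinityK H0 K0 HK).
have pq : cancel p q by exact: (at_infinityK K0 H0 KH).
have Hn0 w : w != 0 -> H w != 0.
  by apply: contra_neq => Hw; rewrite -(HK w) Hw.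
have dq w : derivable q w 1.
  have off v : nc (v - 0) < 1 -> v != 0 -> derivable q v 1.
    move=> _ v0.
    have dv := is_derive_invc v0.
    have d1 : derivable (H \o (fun w : C => w^-1)) v 1.
      exact: (ex_derive (is_derive := is_derive_compC (derivableP (dH v^-1)) dv)).
    have d2 : derivable (fun w : C => (H w^-1)^-1) v 1.
      by apply: (@derivableV C C (H \o (fun w : C => w^-1)) v 1 _ d1); apply: Hn0; rewrite invr_eq0.
    apply: (near_eq_derivable (f := fun w : C => (H w^-1)^-1)); last exact: d2.
    apply/nbhs_ncP; exists (nc v) => [|u uv]; first by rewrite nc_gt0.
    rewrite /q /at_infinity ifF//; apply/eqP => u0; move: uv.
    by rewrite u0 sub0r ncN ltxx.
  have [->|w0] := eqVneq w 0; first by apply: (removable ltr01 off (cq 0)).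
  have dv := is_derive_invc w0.
  have d1 : derivable (H \o (fun w : C => w^-1)) w 1.
    exact: (ex_derive (is_derive := is_derive_compC (derivableP (dH w^-1)) dv)).
  have d2 : derivable (fun w : C => (H w^-1)^-1) w 1.
    by apply: (@derivableV C C (H \o (fun w : C => w^-1)) w 1 _ d1); apply: Hn0; rewrite invr_eq0.
  apply: (near_eq_derivable (f := fun w : C => (H w^-1)^-1)); last exact: d2.
  apply/nbhs_ncP; exists (nc w) => [|u uv]; first by rewrite nc_gt0.
  rewrite /q /at_infinity ifF//; apply/eqP => u0; move: uv.
  by rewrite u0 sub0r ncN ltxx.
have q'0 : 'D_1 q 0 != 0.
  apply: (@derive_injective_neq0 R q p 0 1) => // y _; first exact: cp.
  by near=> w; exact: pq.
have q00 : q 0 = 0 by rewrite /q /at_infinity eqxx.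
pose l := 'D_1 q 0.
have lp : 0 < nc l by rewrite nc_gt0.
have l2 : 0 < nc l / 2 by rewrite divr_gt0.
have [d d0 dP] := (is_deriveCP q 0 l).1 (derivableP (dq 0)) _ l2.
have [N N0 NP] := bounded_on_disk (d^-1) cH.
have HB z : nc (H z) <= 2 / nc l * nc z + N.
  have A0 : 0 <= 2 / nc l * nc z by rewrite mulr_ge0 ?nc_ge0// divr_ge0// ltW.
  have [zd|zd] := leP (nc z) d^-1; first by have := NP z zd; lra.
  have zp : 0 < nc z by apply: lt_trans zd; rewrite invr_gt0.
  have z0 : z != 0 by rewrite -nc_gt0.
  have zi : nc z^-1 < d by rewrite ncV -(invrK d) ltf_pV2 ?posrE// invr_gt0.
  have := dP _ zi; rewrite add0r q00 subr0 => Hq.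
  have Hp : 0 < nc (H z) by rewrite nc_gt0 Hn0.
  have qz : q z^-1 = (H z)^-1 by rewrite /q /at_infinity invr_eq0 (negbTE z0) invrK.
  have : nc l / 2 * nc z^-1 <= nc (q z^-1).
    have := ncD (z^-1 * l - q z^-1) (q z^-1); rewrite subrK ncM (ncB (z^-1 * l)); lra.
  rewrite qz !ncV => H1.
  have : nc l / 2 / nc z * (nc z * nc (H z)) <= (nc (H z))^-1 * (nc z * nc (H z)).
    by rewrite ler_pM2r// mulr_gt0.
  rewrite (_ : nc l / 2 / nc z * _ = nc l / 2 * nc (H z)); last by field; rewrite gt_eqF.
  rewrite (_ : (nc (H z))^-1 * _ = nc z); last by field; rewrite gt_eqF.
  have -> : 2 / nc l * nc z = nc z / (nc l / 2) by field; rewrite gt_eqF.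
  by rewrite mulrC -ler_pdivlMr// => H2; lra.
have A0 : 0 <= 2 / nc l by rewrite divr_ge0// ltW.
have lin := entire_linear_growth A0 (ltW N0) dH HB.
exists ('D_1 H 0) => [|z].
  apply/eqP => D0; have := Hn0 1 (oner_neq0 _).
  by rewrite lin D0 mul0r H0 addr0 eqxx.
by have := lin z; rewrite H0 add0r /H => <-; rewrite subrK.
Unshelve. all: by end_near. Qed.

End AffineAutomorphism.

(** * Coverings by the complex plane *)

Section Lifting.
Variables (R : realType) (T : topologicalType).
Local Notation C := (cplx R).
Local Notation Re := (@complex.Re R).
Local Notation Im := (@complex.Im R).
Implicit Types (z c : C) (r : R).

Lemma continuous_nbhs_ncP (f : C -> T) z (A : set T) : {for z, continuous f} ->
  nbhs (f z) A -> exists2 d : R, 0 < d & forall w, nc (w - z) < d -> A (f w).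
Proof. by move=> cf /cf /nbhs_ncP. Qed.

Lemma in_square_nc (x y x' y' s : R) z : x' <= x <= x' + s -> y' <= y <= y' + s ->
  x' <= Re z <= x' + s -> y' <= Im z <= y' + s -> nc (z - (x +i* y)) <= 2 * s.
Proof.
move=> xx yy z1 z2; apply: le_trans (nc_le_ReIm _) _; rewrite cReD cImD cReN cImN /=.
have h1 : `|Re z - x| <= s by rewrite ler_norml; lra.
have h2 : `|Im z - y| <= s by rewrite ler_norml; lra.
by move: h1 h2; lra.
Qed.

(** Connectedness of the plane, by bisection. It is also the principle of continuation along a leaf,
    where [P] will quantify over all charts at a point. *)
Lemma locally_constant_prop (P : C -> Prop) :
  (forall z, exists2 d : R, 0 < d & forall w, nc (w - z) < d -> (P w <-> P z)) ->
  forall z w, P z -> P w.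
Proof.
move=> locP z w Pz.
pose m := nc z + nc w + 1.
have m0 : 0 < 2 * m by have := nc_ge0 z; have := nc_ge0 w; rewrite /m; lra.
have zm : - m <= Re z <= - m + 2 * m /\ - m <= Im z <= - m + 2 * m.
  have := le_Re_nc z; have := le_Im_nc z; have := nc_ge0 w; rewrite /m !ler_norml; lra.
have wm : - m <= Re w <= - m + 2 * m /\ - m <= Im w <= - m + 2 * m.
  have := le_Re_nc w; have := le_Im_nc w; have := nc_ge0 z; rewrite /m !ler_norml; lra.
move: Pz; have [] := @square_induction R (fun x y s => forall z w,
  x <= Re z <= x + s -> y <= Im z <= y + s ->
  x <= Re w <= x + s -> y <= Im w <= y + s -> (P z <-> P w)) (- m) (- m) (2 * m) m0 _ _ z w zm.1 zm.2 wm.1 wm.2.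
- move=> x y s _ _ _ _ s0 H1 H2 H3 H4.
  pose o : C := (x + s) +i* (y + s).
  have H v : x <= Re v <= x + 2 * s -> y <= Im v <= y + 2 * s -> (P v <-> P o).
    move=> v1 v2.
    have [vx|vx] := leP (Re v) (x + s); have [vy|vy] := leP (Im v) (y + s).
    + by apply: H1 => /=; lra.
    + by apply: H3 => /=; lra.
    + by apply: H2 => /=; lra.
    + by apply: H4 => /=; lra.
  by move=> v v' v1 v2 v3 v4; rewrite (H v)// (H v').
- move=> x y _ _; have [d d0 dP] := locP (x +i* y).
  exists (d / 2) => [|x' y' s _ _ _ _ /andP[s0 sd] xx yy]; first by rewrite divr_gt0.
  move=> v v' v1 v2 v3 v4; rewrite (dP v) ?(dP v')//.
    by apply: le_lt_trans (in_square_nc xx yy v3 v4) _; lra.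
  by apply: le_lt_trans (in_square_nc xx yy v1 v2) _; lra.
- by [].
Qed.

Variables (f1 : C -> T) (L : set T).
Hypothesis cov1 : covering_map f1 L.

Lemma lift_unique (h h' : C -> C) y0 : continuous h -> continuous h' ->
  (forall y, f1 (h y) = f1 (h' y)) -> h y0 = h' y0 -> forall y, h y = h' y.
Proof.
move=> ch ch' E E0 y; move: E0; apply: (@locally_constant_prop (fun y => h y = h' y)) => z.
have [_ rf cov] := cov1.
have Lz : L (f1 (h z)) by rewrite -rf; exists (h z).
have [P [oP Pz _ [I [W [oW tW fW WP]]]]] := cov _ Lz.
have [i _ Wi] : (\bigcup_i W i) (h z) by rewrite -fW.
have [j _ Wj] : (\bigcup_i W i) (h' z) by rewrite -fW /preimage/= -E.
have [d d0 dP] := (nbhs_ncP _ _).1 (ch z _ (open_nbhs_nbhs (conj (oW i) Wi))).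
have [d' d'0 dP'] := (nbhs_ncP _ _).1 (ch' z _ (open_nbhs_nbhs (conj (oW j) Wj))).
exists (Num.min d d') => [|w]; first by rewrite lt_min d0.
rewrite lt_min => /andP[/dP wi /dP' wj].
have injW k : set_inj (W k) f1 by have [[_ ? _] _] := WP k.
have ij a b : W i a -> W j b -> a = b -> i = j.
  by move=> Wa Wb ab; apply: tW => //; exists a; split => //; rewrite ab.
split=> hE.
  have e := ij _ _ wi wj hE; subst j.
  by apply: (injW i); rewrite ?inE.
have e := ij _ _ Wi Wj hE; subst j.
by apply: (injW i); rewrite ?inE.
Qed.

Variable f2 : C -> T.
Hypothesis cf2 : continuous f2.
Hypothesis rf2 : forall y, L (f2 y).

(** Lifting is stated for [f2] composed with a map of the plane to itself. With [k] a retraction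
    onto a square, this expresses lifting over the square while all functions keep the whole plane
    as source. *)
Definition lifts (k : C -> C) := forall y0 z0, f1 z0 = f2 (k y0) ->
  exists h, [/\ continuous h, forall y, f1 (h y) = f2 (k y) & h y0 = z0].

Lemma if_continuous (p : C -> R) (c : R) (hA hB : C -> C) : continuous p ->
  continuous hA -> continuous hB -> (forall y, p y = c -> hA y = hB y) ->
  continuous (fun y => if p y <= c then hA y else hB y).
Proof.
move=> cp cA cB AB y; apply/continuous_ncP => e e0.
have [dA dA0 dAP] := (continuous_ncP hA y).1 (cA y) e e0.
have [dB dB0 dBP] := (continuous_ncP hB y).1 (cB y) e e0.
have [pyc|pyc|pyc] := ltgtP (p y) c.
- have /(@cvgrPdist_lt R R C (nbhs y) _) /(_ (c - p y)) := cp y.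
  rewrite subr_gt0 => /(_ pyc) /nbhs_ncP[d d0 dP].
  exists (Num.min d dA) => [|w]; first by rewrite lt_min d0.
  rewrite lt_min => /andP[/dP wd /dAP]; rewrite ifT//.
  by move: wd; rewrite ltr_norml => /andP[w1 w2]; lra.
- have /(@cvgrPdist_lt R R C (nbhs y) _) /(_ (p y - c)) := cp y.
  rewrite subr_gt0 => /(_ pyc) /nbhs_ncP[d d0 dP].
  exists (Num.min d dB) => [|w]; first by rewrite lt_min d0.
  rewrite lt_min => /andP[/dP wd /dBP]; rewrite ifF//.
  by apply/negbTE; rewrite -ltNge; move: wd; rewrite ltr_norml => /andP[w1 w2]; lra.
- exists (Num.min dA dB) => [|w]; first by rewrite lt_min dA0.
  rewrite lt_min => /andP[/dAP wA /dBP wB]; case: ifP => // _.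
  by rewrite AB.
Qed.

(** Two lifts on the half planes p <= c and p >= c are matched at one point of the line p = c.
    Composed with the projection [pj] to this line they become lifts of one map on the plane, so
    [lift_unique] makes them agree along the line. *)
Lemma lifts_glue (k kA kB pj : C -> C) (p : C -> R) (c : R) :
  continuous p -> continuous pj ->
  (forall y, p y <= c -> k y = kA y) -> (forall y, c <= p y -> k y = kB y) ->
  (forall y, p (pj y) = c) -> (forall y, p y = c -> pj y = y) ->
  lifts kA -> lifts kB -> lifts k.
Proof.
move=> cp cpj kkA kkB ppj pjid lA lB y0 z0 E0.
have kAB y : p y = c -> kA y = kB y by move=> py; rewrite -kkA -?kkB ?py.
suff [hA [hB [cA cB liftA liftB [eAB start]]]] : exists hA hB, [/\ continuous hA, continuous hB,
    forall y, f1 (hA y) = f2 (kA y), forall y, f1 (hB y) = f2 (kB y) &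
    hA (pj 0) = hB (pj 0) /\ (if p y0 <= c then hA y0 else hB y0) = z0].
  have AB y : p y = c -> hA y = hB y.
    move=> py; rewrite -(pjid y py).
    apply: (@lift_unique (hA \o pj) (hB \o pj) 0 _ _ _ eAB).
    - by move=> w; apply: (@continuous_comp C C C pj hA); [exact: cpj|exact: cA].
    - by move=> w; apply: (@continuous_comp C C C pj hB); [exact: cpj|exact: cB].
    - by move=> w /=; rewrite liftA liftB kAB.
  exists (fun y => if p y <= c then hA y else hB y); split; last exact: start.
    exact: (if_continuous cp cA cB AB).
  move=> y; case: ifPn => [yc|]; first by rewrite liftA kkA.
  by rewrite -ltNge => /ltW yc; rewrite liftB kkB.
have [yc|yc] := leP (p y0) c.
  have [hA [cA liftA A0]] := lA y0 z0 ltac:(by rewrite -kkA).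
  have [hB [cB liftB B0]] := lB (pj 0) (hA (pj 0)) ltac:(by rewrite liftA kAB).
  by exists hA, hB; split.
have [hB [cB liftB B0]] := lB y0 z0 ltac:(by rewrite -kkB// ltW).
have [hA [cA liftA A0]] := lA (pj 0) (hB (pj 0)) ltac:(by rewrite liftB kAB).
by exists hA, hB; split.
Qed.

(** Over an evenly covered set the lift is the local inverse on the sheet of the starting point; it
    is continuous because the covering is open on that sheet. *)
Lemma lifts_local (z : C) : exists2 d : R, 0 < d & forall k : C -> C, continuous k ->
  (forall y, nc (k y - z) < d) -> lifts k.
Proof.
have [cf1 rf1 cov] := cov1.
have [P [oP Pz _ [I [W [oW tW fW WP]]]]] := cov _ (rf2 z).
have [d d0 dP] := continuous_nbhs_ncP (cf2 (x:=z)) (open_nbhs_nbhs (conj oP Pz)).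
exists d => // k ck kd y0 z0 E0.
have [i _ Wi] : (\bigcup_i W i) z0 by rewrite -fW /preimage/= E0; exact/dP.
have [[_ injW surW] openW] := WP i.
have H y : exists w, W i w /\ f1 w = f2 (k y).
  by have [w Ww fw] := surW _ (dP _ (kd y)); exists w.
have [h hP] := choice H.
exists h; split=> [y|y|]; last 2 first.
- by have [] := hP y.
- by apply: injW; rewrite ?inE ?E0//; have [] := hP y0.
move=> A /= nA.
have [Wy fy] := hP y.
pose O := A^° `&` W i.
have oO : open O by apply: openI; [exact: open_interior|exact: oW].
have oF := openW O oO (@subIsetr _ _ _).
have Fy : (f1 @` O) (f2 (k y)).
  by exists (h y) => //; split => //; exact: nA.
have c2 : {for y, continuous (f2 \o k)}.
  by apply: (@continuous_comp C C T k f2); [exact: ck|exact: cf2].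
have H2 : nbhs y [set y' | (f1 @` O) (f2 (k y'))] := c2 _ (open_nbhs_nbhs (conj oF Fy)).
change (nbhs y [set y' | A (h y')]).
apply: filterS H2 => y' [w [Aw Ww] fw].
have [Wy' fy'] := hP y'.
have hw : h y' = w by apply: injW; rewrite ?inE// fy'.
by change (A (h y')); rewrite hw; apply: interior_subset.
Qed.

Lemma clampR_le (a b t x : R) : a <= b -> b <= t -> x <= b -> clampR a t x = clampR a b x.
Proof.
by move=> ab bt xb; rewrite /clampR (min_idPl xb) (min_idPl (le_trans xb bt)).
Qed.

Lemma clampR_ge (a b t x : R) : a <= b -> b <= t -> b <= x -> clampR a t x = clampR b t x.
Proof.
move=> ab bt bx; rewrite /clampR.
have h : b <= Num.min x t by rewrite le_min bx bt.
by rewrite (max_idPr h) (max_idPr (le_trans ab h)).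
Qed.

Lemma lifts_square (a b l : R) : 0 < l -> lifts (clamp a (a + l) b (b + l)).
Proof.
move=> l0; apply: (@square_induction R (fun x y s => lifts (clamp x (x + s) y (y + s))) a b l l0).
- move=> x y s _ _ _ _ s0 H1 H2 H3 H4.
  have xs : x + 2 * s = x + s + s by ring.
  have ys : y + 2 * s = y + s + s by ring.
  have x1 : x <= x + s by lra.
  have x2 : x + s <= x + s + s by lra.
  have y1 : y <= y + s by lra.
  have y2 : y + s <= y + s + s by lra.
  have cv : continuous (fun w : C => (x + s) +i* Im w : C).
    move=> w; apply: (@continuous_comp C R C (fun w => Im w) (fun t => (x + s) +i* t : C)).
      exact: continuous_Im.
    exact: continuous_vline.
  have chh : continuous (fun w : C => Re w +i* (y + s) : C).
    move=> w; apply: (@continuous_comp C R C (fun w => Re w) (fun t => t +i* (y + s) : C)).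
      exact: continuous_Re.
    exact: continuous_hline.
  (* Quarters are joined side by side along a vertical line; the two resulting halves are then
     joined along a horizontal one. *)
  have glueR y' t' : lifts (clamp x (x + s) y' t') -> lifts (clamp (x + s) (x + s + s) y' t') ->
      lifts (clamp x (x + s + s) y' t').
    apply: (@lifts_glue _ _ _ (fun w => (x + s) +i* Im w) (fun w => Re w) (x + s) (@continuous_Re R) cv) => //.
    + by move=> w wx; rewrite /clamp (clampR_le x1 x2 wx).
    + by move=> w wx; rewrite /clamp (clampR_ge x1 x2 wx).
    + by move=> [u v] /= ->.
  rewrite xs ys.
  apply: (@lifts_glue _ _ _ (fun w => Re w +i* (y + s)) (fun w => Im w) (y + s) (@continuous_Im R) chh _ _ _ _
    (glueR _ _ H1 H2) (glueR _ _ H3 H4)) => //.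
  + by move=> w wx; rewrite /clamp (clampR_le y1 y2 wx).
  + by move=> w wx; rewrite /clamp (clampR_ge y1 y2 wx).
  + by move=> [u v] /= ->.
- move=> x y _ _; have [d d0 dP] := lifts_local (x +i* y).
  exists (d / 2) => [|x' y' s _ _ _ _ /andP[s0 sd] xx yy]; first by rewrite divr_gt0.
  apply: dP; first exact: continuous_clamp.
  move=> w; apply: le_lt_trans (@in_square_nc x y x' y' s _ xx yy _ _) _; last by lra.
    by apply: clampR_in; lra.
  by apply: clampR_in; lra.
Qed.

(** Lifts over the squares of half side n + 1 with the same value at 0 agree on smaller squares by
    uniqueness, so they define a lift on the plane. *)
Lemma lift_exists z1 : f1 z1 = f2 0 ->
  exists h, [/\ continuous h, forall y, f1 (h y) = f2 y & h 0 = z1].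
Proof.
move=> E0; pose k (n : nat) : C -> C := clamp (- n.+1%:R) (- n.+1%:R + 2 * n.+1%:R)
   (- n.+1%:R) (- n.+1%:R + 2 * n.+1%:R).
have kid n z : nc z < n.+1%:R -> k n z = z.
  move=> zn; apply: ceqP; apply: clampR_id.
    by have := le_Re_nc z; rewrite ler_norml; lra.
  by have := le_Im_nc z; rewrite ler_norml; lra.
have kk m n z : (m <= n)%N -> k n (k m z) = k m z.
  move=> mn; have mn' : m.+1%:R <= n.+1%:R :> R by rewrite ler_nat.
  have m0 : - m.+1%:R <= - m.+1%:R + 2 * m.+1%:R :> R by have := @ltr0Sn R m; lra.
  apply: ceqP; apply: clampR_id.
    by have := clampR_in (Re z) m0; rewrite /=; lra.
  by have := clampR_in (Im z) m0; rewrite /=; lra.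
have k0 n : k n 0 = 0 by apply: kid; rewrite nc0.
have H n : exists h, [/\ continuous h, forall y, f1 (h y) = f2 (k n y) & h 0 = z1].
  by apply: lifts_square; [have := @ltr0Sn R n; lra|rewrite -/(k n) k0].
have [h hP] := choice H.
have hh m n z : (m <= n)%N -> nc z < m.+1%:R -> h n z = h m z.
  move=> mn zm; have [cn fn hn] := hP n; have [cm fm hm] := hP m.
  rewrite -[in LHS](kid m z zm).
  apply: (@lift_unique (h n \o k m) (h m) 0 _ cm) => /=.
  - by move=> w; apply: (@continuous_comp C C C (k m) (h n)); [exact: continuous_clamp|exact: cn].
  - by move=> y; rewrite fn fm kk.
  - by rewrite k0 hn hm.
pose N z := Num.trunc (nc z).
have NP z : nc z < (N z).+1%:R by rewrite /N truncnS_gt.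
have hN n z : nc z < n.+1%:R -> h n z = h (N z) z.
  move=> zn; have [nN|/ltnW nN] := leqP n (N z); first exact/esym/hh.
  exact: hh.
exists (fun z => h (N z) z); split.
- move=> z; have [cn _ _] := hP (N z).
  apply/continuous_ncP => e e0; have [d d0 dP] := (continuous_ncP _ _).1 (cn z) e e0.
  exists (Num.min d ((N z).+1%:R - nc z)) => [|w]; first by rewrite lt_min d0 subr_gt0 NP.
  rewrite lt_min => /andP[/dP wd wz]; rewrite -(hN (N z) w)//.
  by have := ncD (w - z) z; rewrite subrK; lra.
- by move=> y; have [_ -> _] := hP (N y); rewrite kid.
- by have [_ _ ->] := hP (N 0).
Qed.

End Lifting.

Section DeckTransformations.
Variables (R : realType) (T : topologicalType).
Local Notation C := (cplx R).

Lemma lift_at (f1 f2 : C -> T) (L : set T) (y1 y2 : C) : covering_map f1 L ->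
  continuous f2 -> (forall y, L (f2 y)) -> f1 y1 = f2 y2 ->
  exists h, [/\ continuous h, forall y, f1 (h y) = f2 y & h y2 = y1].
Proof.
move=> cov1 cf2 rf2 E.
have ct (a : C) : continuous (fun y : C => y + a).
  by move=> y; apply: (@cvgD C C C (nbhs y)); [exact: cvg_id|exact: cvg_cst].
have cf2' : continuous (fun y => f2 (y + y2)).
  move=> y; apply: (@continuous_comp C C T (fun y => y + y2) f2); first exact: ct.
  exact: cf2.
have [|h [ch fh h0]] := @lift_exists R T f1 L cov1 _ cf2' (fun y => rf2 (y + y2)) y1.
  by rewrite add0r.
exists (fun y => h (y - y2)); split.
- move=> y; apply: (@continuous_comp C C C (fun y => y - y2) h); first exact: ct.
  exact: ch.
- by move=> y; rewrite fh subrK.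
- by rewrite subrr.
Qed.

Lemma covering_homeomorphism (f1 f2 : C -> T) (L : set T) (y1 y2 : C) :
  covering_map f1 L -> covering_map f2 L -> f1 y1 = f2 y2 ->
  exists h k, [/\ continuous h /\ continuous k, cancel h k, cancel k h,
    forall y, f1 (h y) = f2 y & h y2 = y1].
Proof.
move=> cov1 cov2 E; have [c1 r1 _] := cov1; have [c2 r2 _] := cov2.
have [|h [ch fh h0]] := lift_at cov1 c2 _ E; first by move=> y; rewrite -r2; exists y.
have [|k [ck fk k0]] := lift_at cov2 c1 _ (esym E); first by move=> y; rewrite -r1; exists y.
have cid : continuous (id : C -> C) by move=> y; exact: cvg_id.
exists h, k; split; [by split| | |exact: fh|exact: h0].
- apply: (@lift_unique R T f2 L cov2 (k \o h) id y2 _ cid) => /=.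
  + by move=> y; apply: (@continuous_comp C C C h k); [exact: ch|exact: ck].
  + by move=> y; rewrite fk fh.
  + by rewrite h0 k0.
- apply: (@lift_unique R T f1 L cov1 (h \o k) id y1 _ cid) => /=.
  + by move=> y; apply: (@continuous_comp C C C k h); [exact: ck|exact: ch].
  + by move=> y; rewrite fh fk.
  + by rewrite k0 h0.
Qed.

End DeckTransformations.

(** * Real calculus on C^2 *)

Section RealCalculusC2.
Variable R : realType.
Local Notation C := (cplx R).
Local Notation Re := (@complex.Re R).
Local Notation Im := (@complex.Im R).
Implicit Types (f g : C2 R -> C) (v w z h : C2 R) (O : set (C2 R)).

Definition n2 z : R := nc z.1 + nc z.2.

Lemma n2_ge0 z : 0 <= n2 z. Proof. by rewrite addr_ge0 ?nc_ge0. Qed.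
Lemma n2_0 : n2 0 = 0. Proof. have -> : n2 0 = nc 0 + nc 0 by []. by rewrite nc0 addr0. Qed.
Lemma n2D z w : n2 (z + w) <= n2 z + n2 w.
Proof. by rewrite /n2 /=; have := ncD z.1 w.1; have := ncD z.2 w.2; lra. Qed.
Lemma n2B z w : n2 (z - w) = n2 (w - z).
Proof. by rewrite /n2 /= (ncB z.1) (ncB z.2). Qed.
Lemma n2Z (c : C) z : n2 (c *: z) = nc c * n2 z.
Proof. by rewrite /n2 /= !ncM mulrDr. Qed.

Lemma nbhs_n2P z (A : set (C2 R)) :
  nbhs z A <-> exists2 d : R, 0 < d & forall w, n2 (w - z) < d -> A w.
Proof.
apply: (iff_trans (nbhs_nc2P z A)); split=> -[d d0 dP].
  exists d => // w; rewrite /n2 /= => wd; apply: dP.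
    by have := nc_ge0 (w.2 - z.2); lra.
  by have := nc_ge0 (w.1 - z.1); lra.
exists (d / 2) => [|w w1 w2]; first by rewrite divr_gt0.
by apply: dP; rewrite /n2 /=; lra.
Qed.

Lemma continuous_n2P f z : {for z, continuous f} <->
  forall e : R, 0 < e -> exists2 d : R, 0 < d &
    forall w, n2 (w - z) < d -> nc (f w - f z) < e.
Proof.
apply: (iff_trans (@cvg_ncP R (C2 R) (nbhs z) _ f (f z))).
by split=> H e e0; have := H e e0; [move/nbhs_n2P|move=> ?; apply/nbhs_n2P].
Qed.

(** Carries differentiability together with the value, which the total function [real_derive] does
    not. *)
Definition rder v f z (l : C) : Prop := cder (fun t : R => f (z + t%:C *: v)) 0 l.

Lemma real_deriveP v f z : real_derivable v f z -> rder v f z (real_derive v f z).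
Proof.
move=> [d1 d2]; apply/cderP; split.
  by have := derivableP d1; rewrite -derive1E.
by have := derivableP d2; rewrite -derive1E.
Qed.

Lemma rder_val v f z l : rder v f z l -> real_derivable v f z /\ real_derive v f z = l.
Proof.
move=> /cderP[[d1 e1] [d2 e2]]; split; first exact: (conj d1 d2).
by rewrite /real_derive !derive1E e1 e2; case: (l).
Qed.

Lemma rder_near v f g z l : (\forall w \near z, f w = g w) -> rder v f z l -> rder v g z l.
Proof.
move=> /nbhs_n2P[d d0 dP] fl e e0; have [d' d'0 dP'] := fl e e0.
have n0 : 0 < n2 v + 1 by rewrite ltr_wpDl// n2_ge0.
have E0 : f (z + (0 : R)%:C *: v) = g (z + (0 : R)%:C *: v).
  by apply: dP; rewrite scale0r addr0 subrr n2_0.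
exists (Num.min d' (d / (n2 v + 1))) => [|h]; first by rewrite lt_min d'0 divr_gt0.
rewrite lt_min => /andP[/dP' h1 h2]; rewrite -E0 -dP//.
rewrite add0r (addrC z) addrK n2Z nc_real; apply: le_lt_trans (_ : `|h| * (n2 v + 1) < _).
  by rewrite ler_wpM2l// lerDl.
by rewrite -ltr_pdivlMr.
Qed.

Lemma rder_line v f z (s : R) l :
  rder v f (z + s%:C *: v) l -> cder (fun t : R => f (z + t%:C *: v)) s l.
Proof.
move=> fl; have := @cder_shift R (fun t : R => f (z + s%:C *: v + t%:C *: v)) (- s) s l.
rewrite subrr => /(_ fl); apply: cder_eq => t.
by rewrite -addrA -scalerDl -rmorphD (addrC s) subrK.
Qed.

Lemma rderD v f g z l m : rder v f z l -> rder v g z m -> rder v (fun w => f w + g w) z (l + m).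
Proof. by move=> fl gm; exact: (cderD fl gm). Qed.

Lemma rderB v f g z l m : rder v f z l -> rder v g z m -> rder v (fun w => f w - g w) z (l - m).
Proof. by move=> fl gm; exact: (cderB fl gm). Qed.

Lemma rderM v f g z l m : rder v f z l -> rder v g z m ->
  rder v (fun w => f w * g w) z (l * g z + f z * m).
Proof.
by move=> fl gm; have := cderM fl gm; rewrite scale0r addr0.
Qed.

Lemma rder_cst v (c : C) z : rder v (fun=> c) z 0.
Proof. exact: cder_cst. Qed.

Lemma rderZ v (c : C) f z l : rder v f z l -> rder v (fun w => c * f w) z (c * l).
Proof. by move=> fl; exact: (cderMl c fl). Qed.

Lemma rder_conj v f z l : rder v f z l -> rder v (fun w => (f w)^*) z (l^*).
Proof.
have cRe (c : C) : Re (c^*) = Re c by case: c.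
have cIm (c : C) : Im (c^*) = - Im c by case: c.
move=> /cderP[h1 h2]; apply/cderP; rewrite cRe cIm; split.
  by under eq_fun do rewrite cRe.
by under eq_fun do rewrite cIm; exact: is_deriveN.
Qed.

Lemma class_Ck_cont k O f : class_Ck k O f -> forall z, O z -> {for z, continuous f}.
Proof. by case: k => [[]|k []]. Qed.

Lemma class_CkW k O f : class_Ck k.+1 O f -> class_Ck k O f.
Proof.
elim: k f => [|k IH] f [cf H]; first by split.
by split; [exact: cf|move=> v; have [dv Cv] := H v; split; [exact: dv|exact: IH]].
Qed.

Lemma class_Ck_eq k O f g : open O -> (forall z, O z -> f z = g z) ->
  class_Ck k O f -> class_Ck k O g.
Proof.
move=> oO; elim: k f g => [|k IH] f g fg.
  move=> [cf _]; split; [move=> z Oz|by []]; apply/continuous_n2P => e e0.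
  have [d d0 dP] := (continuous_n2P f z).1 (cf z Oz) e e0.
  have /nbhs_n2P[d' d'0 dP'] := open_nbhs_nbhs (conj oO Oz).
  exists (Num.min d d') => [|w]; first by rewrite lt_min d0.
  by rewrite lt_min => /andP[w1 w2]; rewrite -!fg//; [exact: dP|exact: dP'].
move=> [cf H]; have nfg z : O z -> \forall w \near z, f w = g w.
  by move=> Oz; apply: filterS (open_nbhs_nbhs (conj oO Oz)) => w; exact: fg.
split.
  move=> z Oz; apply/continuous_n2P => e e0.
  have [d d0 dP] := (continuous_n2P f z).1 (cf z Oz) e e0.
  have /nbhs_n2P[d' d'0 dP'] := open_nbhs_nbhs (conj oO Oz).
  exists (Num.min d d') => [|w]; first by rewrite lt_min d0.
  by rewrite lt_min => /andP[w1 w2]; rewrite -!fg//; [exact: dP|exact: dP'].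
move=> v; have [dv Cv] := H v.
have gd z : O z -> rder v g z (real_derive v f z).
  by move=> Oz; exact: (rder_near (nfg z Oz) (real_deriveP (dv z Oz))).
split; first by move=> z Oz; have [] := rder_val (gd z Oz).
by apply: IH Cv => z Oz; have [_ ->] := rder_val (gd z Oz).
Qed.

(** The derivative may be given by any expression valid on the open set; off [O] it may differ from
    [real_derive]. *)
Lemma class_Ck_intro k O f : open O -> (forall z, O z -> {for z, continuous f}) ->
  (forall v, exists2 f', forall z, O z -> rder v f z (f' z) & class_Ck k O f') ->
  class_Ck k.+1 O f.
Proof.
move=> oO cf H; split; [exact: cf|move=> v]; have [f' fd Cf'] := H v; split.
  by move=> z Oz; have [] := rder_val (fd z Oz).
by apply: (class_Ck_eq oO _ Cf') => z Oz; have [_ ->] := rder_val (fd z Oz).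
Qed.

Lemma class_Ck_sub k O O' f : O' `<=` O -> class_Ck k O f -> class_Ck k O' f.
Proof.
move=> OO'; elim: k f => [|k IH] f [cf H].
  by split; [move=> z /OO' Oz; exact: cf|].
split=> [z /OO' Oz|v]; first exact: cf.
have [dv Cv] := H v; split=> [z /OO' Oz|]; [exact: dv|exact: IH].
Qed.

Section Closure.
Variable O : set (C2 R).
Hypothesis oO : open O.

Lemma class_Ck_cst k (c : C) : class_Ck k O (fun=> c).
Proof.
elim: k c => [|k IH] c; first by split; [move=> z _; exact: cvg_cst|].
apply: (class_Ck_intro oO) => [z _|v]; first exact: cvg_cst.
by exists (fun=> 0) => [z _|]; [exact: rder_cst|exact: IH].
Qed.

Lemma class_CkD k f g : class_Ck k O f -> class_Ck k O g ->
  class_Ck k O (fun z => f z + g z).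
Proof.
elim: k f g => [|k IH] f g [cf Hf] [cg Hg].
  by split; [move=> z Oz; apply: (@cvgD C C (C2 R) (nbhs z)); [exact: cf|exact: cg]|].
apply: (class_Ck_intro oO) => [z Oz|v].
  by apply: (@cvgD C C (C2 R) (nbhs z)); [exact: cf|exact: cg].
have [df Cf] := Hf v; have [dg Cg] := Hg v.
exists (fun z => real_derive v f z + real_derive v g z) => [z Oz|]; last exact: IH.
exact: (rderD (real_deriveP (df z Oz)) (real_deriveP (dg z Oz))).
Qed.

Lemma class_CkM k f g : class_Ck k O f -> class_Ck k O g ->
  class_Ck k O (fun z => f z * g z).
Proof.
elim: k f g => [|k IH] f g Cf Cg; have [cf Hf] := Cf; have [cg Hg] := Cg.
  by split; [move=> z Oz; apply: (@cvgM C (C2 R) (nbhs z)); [exact: cf|exact: cg]|].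
apply: (class_Ck_intro oO) => [z Oz|v].
  by apply: (@cvgM C (C2 R) (nbhs z)); [exact: cf|exact: cg].
have [df Cdf] := Hf v; have [dg Cdg] := Hg v.
exists (fun z => real_derive v f z * g z + f z * real_derive v g z) => [z Oz|].
  exact: (rderM (real_deriveP (df z Oz)) (real_deriveP (dg z Oz))).
exact: (class_CkD (IH _ _ Cdf (class_CkW Cg)) (IH _ _ (class_CkW Cf) Cdg)).
Qed.

Lemma rderV v f z l : f z != 0 -> rder v f z l ->
  rder v (fun w => (f w)^-1) z (- (f z) ^- 2 * l).
Proof.
move=> fz fl.
have := @cder_comp_holo R (fun w : C => w^-1) (fun t : R => f (z + t%:C *: v)) 0 (- (f z) ^- 2) l.
by rewrite scale0r addr0 => /(_ (is_derive_invc fz) fl).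
Qed.

Lemma class_CkV k f : (forall z, O z -> f z != 0) -> class_Ck k O f ->
  class_Ck k O (fun z => (f z)^-1).
Proof.
move=> f0; have cV z : O z -> {for z, continuous f} -> {for z, continuous (fun z => (f z)^-1)}.
  by move=> Oz cf; apply: (@cvgV C (C2 R) (nbhs z) _ f (f z) (f0 z Oz)).
elim: k => [|k IH] Cf; have [cf Hf] := Cf.
  by split; [move=> z Oz; apply: (cV z Oz (cf z Oz))|].
apply: (class_Ck_intro oO) => [z Oz|v]; first exact: (cV z Oz (cf z Oz)).
have [df Cdf] := Hf v; have CV := IH (class_CkW Cf).
exists (fun z => (-1 * ((f z)^-1 * (f z)^-1)) * real_derive v f z) => [z Oz|].
  have := rderV (f0 z Oz) (real_deriveP (df z Oz)).
  by rewrite -exprVn expr2 mulN1r.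
exact: (class_CkM (class_CkM (class_Ck_cst _ _) (class_CkM CV CV)) Cdf).
Qed.

Lemma class_Ck_conj k f : class_Ck k O f -> class_Ck k O (fun z => (f z)^*).
Proof.
elim: k f => [|k IH] f [cf Hf].
  split; [move=> z Oz; apply: (@continuous_comp (C2 R) C C f (fun w : C => w^*)); [exact: cf|exact: continuous_conj]|by []].
apply: (class_Ck_intro oO) => [z Oz|v].
  apply: (@continuous_comp (C2 R) C C f (fun w : C => w^*)); first exact: cf.
  exact: continuous_conj.
have [df Cf] := Hf v.
exists (fun z => (real_derive v f z)^*) => [z Oz|]; last exact: IH.
exact: (rder_conj (real_deriveP (df z Oz))).
Qed.

End Closure.
End RealCalculusC2.

(** * Strict differentiability *)

Section StrictDifferentiability.
Variable R : realType.
Local Notation C := (cplx R).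
Local Notation Re := (@complex.Re R).
Local Notation Im := (@complex.Im R).
Implicit Types (f g : C2 R -> C) (v w z h : C2 R) (O : set (C2 R)).

Definition e1 : C2 R := (1, 0).
Definition e2 : C2 R := ('i, 0).
Definition e3 : C2 R := (0, 1).
Definition e4 : C2 R := (0, 'i).

Definition rlin f z v : C :=
  (Re v.1)%:C * real_derive e1 f z + (Im v.1)%:C * real_derive e2 f z +
  (Re v.2)%:C * real_derive e3 f z + (Im v.2)%:C * real_derive e4 f z.

Lemma fstD v w : (v + w).1 = v.1 + w.1. Proof. by []. Qed.
Lemma sndD v w : (v + w).2 = v.2 + w.2. Proof. by []. Qed.
Lemma fstN v : (- v).1 = - v.1. Proof. by []. Qed.
Lemma sndN v : (- v).2 = - v.2. Proof. by []. Qed.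
Lemma fstZ (c : C) v : (c *: v).1 = c * v.1. Proof. by []. Qed.
Lemma sndZ (c : C) v : (c *: v).2 = c * v.2. Proof. by []. Qed.
Lemma rcD (a b : R) : (a + b)%:C = a%:C + b%:C :> C. Proof. exact: rmorphD. Qed.
Lemma rcN (a : R) : (- a)%:C = - a%:C :> C. Proof. exact: rmorphN. Qed.
Lemma rcM (a b : R) : (a * b)%:C = a%:C * b%:C :> C. Proof. exact: rmorphM. Qed.
Lemma Re_realM (a : R) (c : C) : Re (a%:C * c) = a * Re c.
Proof. by rewrite cReM /= mul0r subr0. Qed.
Lemma Im_realM (a : R) (c : C) : Im (a%:C * c) = a * Im c.
Proof. by rewrite cImM /= mul0r addr0. Qed.

Lemma rlinD f z v w : rlin f z (v + w) = rlin f z v + rlin f z w.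
Proof.
rewrite /rlin fstD sndD !cReD !cImD !rcD; move: (real_derive _ _ _) => A.
by move: (real_derive e2 f z) (real_derive e3 f z) (real_derive e4 f z) => B D E; ring.
Qed.

Lemma rlinZ f z (a : R) v : rlin f z (a%:C *: v) = a%:C * rlin f z v.
Proof.
rewrite /rlin fstZ sndZ !Re_realM !Im_realM !rcM; move: (real_derive _ _ _) => A.
by move: (real_derive e2 f z) (real_derive e3 f z) (real_derive e4 f z) => B D E; ring.
Qed.

Lemma rlinN f z v : rlin f z (- v) = - rlin f z v.
Proof.
rewrite /rlin fstN sndN !cReN !cImN !rcN; move: (real_derive _ _ _) => A.
by move: (real_derive e2 f z) (real_derive e3 f z) (real_derive e4 f z) => B D E; ring.
Qed.

Lemma nc_lin_le (A B D E a b c d : C) (N : R) : nc a <= N -> nc b <= N ->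
  nc c <= N -> nc d <= N ->
  nc (a * A + b * B + c * D + d * E) <= (nc A + nc B + nc D + nc E) * N.
Proof.
move=> aN bN cN dN.
have H (p q : C) : nc p <= N -> nc (p * q) <= nc q * N.
  by move=> pN; rewrite ncM mulrC ler_wpM2l// nc_ge0.
apply: le_trans (ncD _ _) _; rewrite [leRHS]mulrDl; apply: lerD; last exact: H.
apply: le_trans (ncD _ _) _; rewrite [leRHS]mulrDl; apply: lerD; last exact: H.
by apply: le_trans (ncD _ _) _; rewrite [leRHS]mulrDl; apply: lerD; exact: H.
Qed.

Lemma nc_rlin f z : exists2 K : R, 0 < K & forall v, nc (rlin f z v) <= K * n2 v.
Proof.
rewrite /rlin; move: (real_derive e1 f z) (real_derive e2 f z) => A B.
move: (real_derive e3 f z) (real_derive e4 f z) => D E.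
exists (nc A + nc B + nc D + nc E + 1).
  by rewrite ltr_wpDl// !addr_ge0// nc_ge0.
move=> v; have N1 : nc v.1 <= n2 v by rewrite lerDl nc_ge0.
have N2 : nc v.2 <= n2 v by rewrite lerDr nc_ge0.
apply: le_trans (_ : (nc A + nc B + nc D + nc E) * n2 v <= _); last first.
  by rewrite ler_wpM2r ?n2_ge0// lerDl.
apply: nc_lin_le; rewrite ?nc_real.
- exact: le_trans (le_Re_nc _) N1.
- exact: le_trans (le_Im_nc _) N1.
- exact: le_trans (le_Re_nc _) N2.
- exact: le_trans (le_Im_nc _) N2.
Qed.

Lemma n2e : [/\ n2 e1 = 1, n2 e2 = 1, n2 e3 = 1 & n2 e4 = 1].
Proof.
have E (a b : C) : n2 (a, b) = nc a + nc b by [].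
split; rewrite E.
- by rewrite nc1 nc0 addr0.
- by rewrite nci nc0 addr0.
- by rewrite nc0 nc1 add0r.
- by rewrite nc0 nci add0r.
Qed.

Lemma decomp4 v : v = (Re v.1)%:C *: e1 + (Im v.1)%:C *: e2 +
  (Re v.2)%:C *: e3 + (Im v.2)%:C *: e4.
Proof.
case: v => [[a b] [c d]]; congr pair; apply: ceqP => /=;
  rewrite ?cReD ?cImD ?cReM ?cImM /=; ring.
Qed.

Lemma cder_scale (g : R -> C) (a t : R) l : cder g (a * t) l ->
  cder (fun s => g (a * s)) t (a%:C * l).
Proof.
move=> /cderP[h1 h2]; apply/cderP; rewrite cReM cImM /= !mul0r subr0 addr0.
have d : is_derive t 1 (fun s : R => a * s) a.
  apply: (is_derive_eq (is_deriveZ a (is_derive_id t 1))).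
  exact: mulr1.
rewrite ![a * _]mulrC.
by split; [exact: (is_derive1_comp h1 d)|exact: (is_derive1_comp h2 d)].
Qed.

Lemma rder_scale f z v (a : R) l : rder v f z l -> rder (a%:C *: v) f z (a%:C * l).
Proof.
move=> fl; have := @cder_scale (fun t : R => f (z + t%:C *: v)) a 0 l.
rewrite mulr0 => /(_ fl); apply: cder_eq => s.
by rewrite scalerA -rmorphM mulrC.
Qed.

Lemma increment_step f z0 e D (d ep : R) p (a : R) : n2 e = 1 ->
  (forall q, n2 (q - z0) < d ->
     real_derivable e f q /\ nc (real_derive e f q - D) <= ep) ->
  n2 (p - z0) + `|a| < d -> nc (f (p + a%:C *: e) - f p - a%:C * D) <= 2 * ep * `|a|.
Proof.
move=> ne H pa.
have In (t : R) : 0 <= t <= 1 -> n2 (p + t%:C *: (a%:C *: e) - z0) < d.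
  move=> /andP[t0 t1]; rewrite addrAC; apply: le_lt_trans (n2D _ _) _.
  rewrite !n2Z !nc_real ne mulr1 (ger0_norm t0).
  by have := ler_wpM2r (normr_ge0 a) t1; lra.
have := @cmvt R (fun t => f (p + t%:C *: (a%:C *: e)) - t%:C * (a%:C * D))
  (fun t => a%:C * (real_derive e f (p + t%:C *: (a%:C *: e)) - D)) 0 1 (`|a| * ep) ler01 _ _.
rewrite subr0 mulr1 scale1r scale0r addr0 mul0r subr0 mul1r => B.
have -> : 2 * ep * `|a| = 2 * (`|a| * ep) by ring.
rewrite addrAC; apply: B => t t01; have [dq Dq] := H _ (In t t01).
  rewrite mulrBr; apply: cderB.
    exact: (rder_line (rder_scale a (real_deriveP dq))).
  by have := cderM (cder_id t) (cder_cst (a%:C * D) t); rewrite mulr0 addr0 mul1r.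
by rewrite ncM nc_real ler_wpM2l.
Qed.

(** Both points vary: this uniform form of differentiability, which continuity of the partial
    derivatives provides, is what Newton's method needs. The segment between the points is replaced
    by a path along the four real coordinate axes. *)
Lemma strict_diff O f z0 : open O -> O z0 -> class_Ck 1 O f ->
  forall ep : R, 0 < ep -> exists2 d : R, 0 < d & forall w w',
    n2 (w - z0) < d -> n2 (w' - z0) < d ->
    nc (f w - f w' - rlin f z0 (w - w')) <= ep * n2 (w - w').
Proof.
move=> oO Oz [cf Hf] ep ep0.
have eq0 : 0 < ep / 4 by rewrite divr_gt0.
have near e : exists2 d : R, 0 < d & forall q, n2 (q - z0) < d ->
    real_derivable e f q /\ nc (real_derive e f q - real_derive e f z0) <= ep / 4.
  have [df [cdf _]] := Hf e.
  have [d d0 dP] := (continuous_n2P _ z0).1 (cdf z0 Oz) _ eq0.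
  have /nbhs_n2P[d' d'0 dP'] := open_nbhs_nbhs (conj oO Oz).
  exists (Num.min d d') => [|q]; first by rewrite lt_min d0.
  by rewrite lt_min => /andP[/dP q1 /dP' q2]; split; [exact: df|exact: ltW].
have [d1 d10 H1] := near e1; have [d2 d20 H2] := near e2.
have [d3 d30 H3] := near e3; have [d4 d40 H4] := near e4.
have [d d0 [l1 l2 l3 l4]] : exists2 d, 0 < d & [/\ d <= d1, d <= d2, d <= d3 & d <= d4].
  exists (Num.min (Num.min d1 d2) (Num.min d3 d4)); first by rewrite !lt_min d10 d20 d30 d40.
  by rewrite !ge_min !lexx !orbT.
(* The path starts within d/10 of [z0] and its total length is at most 2 [n2 h] < 2d/5, so it stays
   where the partial derivatives are controlled. *)
exists (d / 10) => [|w w' wd wd']; first by rewrite divr_gt0.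
set h := w - w'.
have hd : n2 h < d / 5.
  have := n2D (w - z0) (z0 - w'); rewrite addrA subrK -/h (n2B z0); lra.
have [n1 nn2 n3 n4] := n2e.
have b1 := le_Re_nc h.1; have b2 := le_Im_nc h.1.
have b3 := le_Re_nc h.2; have b4 := le_Im_nc h.2.
have nh : n2 h = nc h.1 + nc h.2 by [].
pose p1 := w' + (Re h.1)%:C *: e1; pose p2 := p1 + (Im h.1)%:C *: e2.
pose p3 := p2 + (Re h.2)%:C *: e3; pose p4 := p3 + (Im h.2)%:C *: e4.
have wE : w = p4.
  have := decomp4 h; rewrite /p4 /p3 /p2 /p1 -!addrA => <-.
  by rewrite /h addrC subrK.
have q1 : n2 (p1 - z0) <= n2 (w' - z0) + `|Re h.1|.
  by rewrite /p1 addrAC (le_trans (n2D _ _))// n2Z nc_real n1 mulr1.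
have q2 : n2 (p2 - z0) <= n2 (p1 - z0) + `|Im h.1|.
  by rewrite /p2 addrAC (le_trans (n2D _ _))// n2Z nc_real nn2 mulr1.
have q3 : n2 (p3 - z0) <= n2 (p2 - z0) + `|Re h.2|.
  by rewrite /p3 addrAC (le_trans (n2D _ _))// n2Z nc_real n3 mulr1.
have s1 := @increment_step f z0 e1 _ d1 _ w' (Re h.1) n1 H1.
have s2 := @increment_step f z0 e2 _ d2 _ p1 (Im h.1) nn2 H2.
have s3 := @increment_step f z0 e3 _ d3 _ p2 (Re h.2) n3 H3.
have s4 := @increment_step f z0 e4 _ d4 _ p3 (Im h.2) n4 H4.
have r1 : `|Re h.1| <= n2 h by rewrite nh; apply: le_trans b1 _; rewrite lerDl nc_ge0.
have r2 : `|Im h.1| <= n2 h by rewrite nh; apply: le_trans b2 _; rewrite lerDl nc_ge0.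
have r3 : `|Re h.2| <= n2 h by rewrite nh; apply: le_trans b3 _; rewrite lerDr nc_ge0.
have r4 : `|Im h.2| <= n2 h by rewrite nh; apply: le_trans b4 _; rewrite lerDr nc_ge0.
have w1 : n2 (w' - z0) + `|Re h.1| < d1 by clear - wd' r1 hd l1 d0; lra.
have w2 : n2 (p1 - z0) + `|Im h.1| < d2 by clear - wd' r1 r2 q1 hd l2 d0; lra.
have w3 : n2 (p2 - z0) + `|Re h.2| < d3 by clear - wd' r1 r2 r3 q1 q2 hd l3 d0; lra.
have w4 : n2 (p3 - z0) + `|Im h.2| < d4.
  have q3' : n2 (p3 - z0) <= n2 (w' - z0) + `|Re h.1| + `|Im h.1| + `|Re h.2|.
    by clear - q1 q2 q3; lra.
  have r36 : `|Re h.1| + `|Im h.1| + `|Re h.2| + `|Im h.2| <= 2 * n2 h.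
    by rewrite nh; clear - b1 b2 b3 b4; lra.
  by clear - wd' q3' r36 hd l4 d0; lra.
have {}s1 := s1 w1; have {}s2 := s2 w2; have {}s3 := s3 w3; have {}s4 := s4 w4.
rewrite -/p1 in s1; rewrite -/p2 in s2; rewrite -/p3 in s3; rewrite -/p4 in s4.
have -> : f w - f w' - rlin f z0 h =
  (f p1 - f w' - (Re h.1)%:C * real_derive e1 f z0) +
  (f p2 - f p1 - (Im h.1)%:C * real_derive e2 f z0) +
  (f p3 - f p2 - (Re h.2)%:C * real_derive e3 f z0) +
  (f p4 - f p3 - (Im h.2)%:C * real_derive e4 f z0).
  rewrite wE /rlin; move: (real_derive e1 f z0) (real_derive e2 f z0) => A B.
  by move: (real_derive e3 f z0) (real_derive e4 f z0) => D E; ring.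
have t1 := ncD ((f p1 - f w' - (Re h.1)%:C * real_derive e1 f z0) +
  (f p2 - f p1 - (Im h.1)%:C * real_derive e2 f z0) +
  (f p3 - f p2 - (Re h.2)%:C * real_derive e3 f z0))
  (f p4 - f p3 - (Im h.2)%:C * real_derive e4 f z0).
have t2 := ncD ((f p1 - f w' - (Re h.1)%:C * real_derive e1 f z0) +
  (f p2 - f p1 - (Im h.1)%:C * real_derive e2 f z0))
  (f p3 - f p2 - (Re h.2)%:C * real_derive e3 f z0).
have t3 := ncD (f p1 - f w' - (Re h.1)%:C * real_derive e1 f z0)
  (f p2 - f p1 - (Im h.1)%:C * real_derive e2 f z0).
have m1 := ler_wpM2l (ltW ep0) b1; have m2 := ler_wpM2l (ltW ep0) b2.
have m3 := ler_wpM2l (ltW ep0) b3; have m4 := ler_wpM2l (ltW ep0) b4.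
apply: le_trans t1 _; apply: le_trans (lerD (le_trans t2 (lerD (le_trans t3 (lerD s1 s2)) s3)) s4) _.
by rewrite nh; clear - m1 m2 m3 m4; lra.
Qed.

(** [class_Ck] speaks of each direction separately; linearity of the derivative in the direction is
    a consequence of strict differentiability. *)
Lemma real_derive_rlin O f z v : open O -> O z -> class_Ck 1 O f ->
  real_derive v f z = rlin f z v.
Proof.
move=> oO Oz Cf; suff /rder_val[_ ->] : rder v f z (rlin f z v) by [].
move=> e e0.
have n0 : 0 < n2 v + 1 by rewrite ltr_wpDl// n2_ge0.
have [d d0 dP] := strict_diff oO Oz Cf (divr_gt0 e0 n0).
exists (d / (n2 v + 1)) => [|h]; first by rewrite divr_gt0.
rewrite ltr_pdivlMr// => hd.
rewrite add0r scale0r addr0 -rlinZ.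
have hv : n2 (z + h%:C *: v - z) = `|h| * n2 v by rewrite addrAC subrr add0r n2Z nc_real.
have hle : `|h| * n2 v <= `|h| * (n2 v + 1) by rewrite ler_wpM2l// lerDl.
have := dP (z + h%:C *: v) z; rewrite hv subrr n2_0 => /(_ (le_lt_trans hle hd) d0).
have -> : z + h%:C *: v - z = h%:C *: v by rewrite addrAC subrr add0r.
move=> /le_trans; apply.
have -> : e * `|h| = e / (n2 v + 1) * (`|h| * (n2 v + 1)) by field; rewrite gt_eqF.
by rewrite ler_wpM2l// divr_ge0// ltW.
Qed.

End StrictDifferentiability.

Lemma differentiable_intro (K : numFieldType) (V W : normedModType K) (f : V -> W)
    (x : V) (L : {linear V -> W}) : continuous L ->
  (forall e : K, 0 < e -> \forall h \near (0 : V), `|f (h + x) - f x - L h| <= e * `|h|) ->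
  differentiable f x /\ 'd f x = L :> (V -> W).
Proof.
move=> cL H; have E : f \o shift x = cst (f x) + L +o_ (0 : V) id.
  apply/eqaddoP => e e0; apply: filterS (H e e0) => h.
  suff -> : (f \o shift x - (cst (f x) + L)) h = f (h + x) - f x - L h by [].
  by rewrite -addrA -opprD.
have dE : 'd f x = L :> (V -> W) by apply: diff_unique E.
by split=> //; apply/diff_locallyP; rewrite dE; split.
Qed.

Section ComplexDifferentiability.
Variable R : realType.
Local Notation C := (cplx R).
Local Notation Re := (@complex.Re R).
Implicit Types (v w z h : C2 R) (O : set (C2 R)).

Lemma pair_normE (p : C2 R) : `|p| = (Num.max (nc p.1) (nc p.2))%:C.
Proof.
rewrite prod_normE; have [h|h] := leP (nc p.1) (nc p.2); rewrite /Num.max !normE ltcR.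
  by case: ltP => // h'; congr (_%:C); apply/eqP; rewrite eq_le h h'.
by rewrite ltNge (ltW h).
Qed.

Lemma differentiable_n2 (f : C2 R -> C2 R) z : differentiable f z ->
  forall e : R, 0 < e -> exists2 d : R, 0 < d &
    forall h, n2 h < d -> n2 (f (z + h) - f z - 'd f z h) <= e * n2 h.
Proof.
move=> df e e0; have e2 : 0 < (e / 2)%:C :> C by rewrite ltcR divr_gt0.
have /eqaddoP /(_ _ e2) /nbhs_n2P[d d0 dP] := diff_locally df.
exists d => // h hd; have := dP h; rewrite subr0 => /(_ hd).
have -> : (f \o shift z - (cst (f z) + 'd f z)) h = f (z + h) - f z - 'd f z h.
  by rewrite -[LHS]/(f (h + z) - (f z + 'd f z h)) opprD addrA (addrC h).
rewrite !pair_normE -rcM lecR.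
move: (f (z + h) - f z - 'd f z h) => q H.
have q1 : nc q.1 <= Num.max (nc q.1) (nc q.2) by rewrite le_max lexx.
have q2 : nc q.2 <= Num.max (nc q.1) (nc q.2) by rewrite le_max lexx orbT.
have hh : Num.max (nc h.1) (nc h.2) <= n2 h.
  by rewrite ge_max lerDl lerDr !nc_ge0.
have := ler_wpM2l (ltW e0) hh; move: H q1 q2.
have -> : n2 q = nc q.1 + nc q.2 by [].
clear; lra.
Qed.

Lemma linear_differentiable_n2 (f : C2 R -> C) z (A B : C) :
  (forall e : R, 0 < e -> exists2 d : R, 0 < d & forall h, n2 h < d ->
     nc (f (z + h) - f z - (h.1 * A + h.2 * B)) <= e * n2 h) ->
  differentiable f z /\ forall v, 'D_v f z = v.1 * A + v.2 * B.
Proof.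
move=> H; pose L (v : C2 R) : C := v.1 * A + v.2 * B.
have linL : linear L.
  by move=> a u v; rewrite /L fstD sndD fstZ sndZ -[a *: (_ : C)]/(a * _); ring.
pose linM := GRing.isLinear.Build _ _ _ _ _ linL.
pose LL : {linear C2 R -> C} := HB.pack L linM.
have LE : L = LL by [].
have cL : continuous L.
  move=> v; apply: (@cvgD C C (C2 R) (nbhs v)).
    by apply: (@cvgM C (C2 R) (nbhs v)); [exact: cvg_fst|exact: cvg_cst].
  by apply: (@cvgM C (C2 R) (nbhs v)); [exact: cvg_snd|exact: cvg_cst].
have [|df dE] := @differentiable_intro C (C2 R) C f z LL cL.
  move=> ep ep0.
  have [e eE e0] : exists2 e : R, ep = e%:C & 0 < e.
    move: ep0; rewrite ltcE/= => /andP[/eqP ie re]; exists (Re ep) => //.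
    by apply: ceqP.
  have e2 : 0 < e / 2 by rewrite divr_gt0.
  have [d d0 dP] := H _ e2; apply/nbhs_n2P; exists d => // h; rewrite subr0 => /dP.
  rewrite (addrC h) eE pair_normE normE -rcM lecR => /le_trans; apply.
  have h1 : nc h.1 <= Num.max (nc h.1) (nc h.2) by rewrite le_max lexx.
  have h2 : nc h.2 <= Num.max (nc h.1) (nc h.2) by rewrite le_max lexx orbT.
  have := ler_wpM2l (ltW e0) h1; have := ler_wpM2l (ltW e0) h2.
  have -> : n2 h = nc h.1 + nc h.2 by [].
  clear; lra.
by split; [exact: df|move=> v; rewrite (deriveE v df) dE].
Qed.

Lemma c2P v w : v.1 = w.1 -> v.2 = w.2 -> v = w.
Proof. by case: v => a b; case: w => c d /= -> ->. Qed.

Lemma n2_linear_le (L : {linear C2 R -> C2 R}) :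
  exists2 K : R, 0 < K & forall w, n2 (L w) <= K * n2 w.
Proof.
pose p : C2 R := L (1, 0); pose q : C2 R := L (0, 1).
have N (w : C2 R) : L w = w.1 *: p + w.2 *: q.
  have {1}-> : w = w.1 *: (1, 0) + w.2 *: (0, 1).
    apply: c2P; first by rewrite fstD !fstZ mulr1 mulr0 addr0.
    by rewrite sndD !sndZ mulr1 mulr0 add0r.
  by rewrite linearD !linearZ.
move: p q N => p q N.
exists (n2 p + n2 q + 1); first by rewrite ltr_wpDl// addr_ge0 ?n2_ge0.
move=> w; rewrite N; apply: le_trans (n2D _ _) _; rewrite !n2Z.
move: (n2_ge0 p) (n2_ge0 q); move: (n2 p) (n2 q) => a b a0 b0.
have -> : n2 w = nc w.1 + nc w.2 by [].
move: (nc_ge0 w.1) (nc_ge0 w.2); move: (nc w.1) (nc w.2) => x y x0 y0.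
have := mulr_ge0 a0 y0; have := mulr_ge0 b0 x0; lra.
Qed.

(** The bridge between the two calculi: transition maps have complex differentials, while the
    cylinders are differentiated along real lines. *)
Lemma cder_diff_comp (f : C2 R -> C2 R) (c1 c2 : R -> C) (t : R) v :
  differentiable f (c1 t, c2 t) -> cder c1 t v.1 -> cder c2 t v.2 ->
  cder (fun s => (f (c1 s, c2 s)).1) t ('D_v f (c1 t, c2 t)).1 /\
  cder (fun s => (f (c1 s, c2 s)).2) t ('D_v f (c1 t, c2 t)).2.
Proof.
move=> df d1 d2; rewrite (deriveE v df); set z := (c1 t, c2 t) in df *.
suff H : forall e : R, 0 < e -> exists2 d : R, 0 < d & forall h : R, `|h| < d ->
    n2 (f (c1 (t + h), c2 (t + h)) - f z - h%:C *: 'd f z v) <= e * `|h|.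
  split=> e /H[d d0 dP]; exists d => // h /dP; apply: le_trans.
    by rewrite /n2 lerDl nc_ge0.
  by rewrite /n2 lerDr nc_ge0.
have [K K0 KP] := n2_linear_le ('d f z).
move=> e e0.
have n0 : 0 < 2 * (n2 v + 1) + 2 * K by have := n2_ge0 v; lra.
(* The bound 1 gives an increment of at most ([n2 v] + 1) |h| for the curve; the other bound absorbs
   the norms of the velocity and of the differential. *)
pose ep := Num.min 1 (e / (2 * (n2 v + 1) + 2 * K)).
have ep0 : 0 < ep by rewrite lt_min ltr01 divr_gt0.
have ep1 : ep <= 1 by rewrite ge_min lexx.
have epe : ep * (2 * (n2 v + 1) + 2 * K) <= e.
  by rewrite -ler_pdivlMr// ge_min lexx orbT.
have [d d0 dP] := differentiable_n2 df ep0.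
have ep2 : 0 < ep / 2 by rewrite divr_gt0.
have [a1 a10 A1] := d1 _ ep2; have [a2 a20 A2] := d2 _ ep2.
exists (Num.min (Num.min a1 a2) (d / (n2 v + 2))) => [|h].
  by rewrite !lt_min a10 a20 divr_gt0// ltr_wpDl// n2_ge0.
rewrite !lt_min -andbA => /and3P[/A1 h1 /A2 h2 hd].
set w := (c1 (t + h), c2 (t + h)).
have wv : n2 (w - z - h%:C *: v) <= ep * `|h|.
  have -> : ep * `|h| = ep / 2 * `|h| + ep / 2 * `|h| by field.
  exact: lerD h1 h2.
have wz : n2 (w - z) <= (n2 v + 1) * `|h|.
  have := n2D (w - z - h%:C *: v) (h%:C *: v); rewrite subrK n2Z nc_real.
  have := ler_wpM2r (normr_ge0 h) ep1; clear - wv; lra.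
have wd : n2 (w - z) < d.
  have nv : 0 < n2 v + 2 by rewrite ltr_wpDl// n2_ge0.
  move: hd; rewrite ltr_pdivlMr// => hd; apply: le_lt_trans wz _.
  by apply: le_lt_trans hd; rewrite mulrC ler_wpM2l// lerD2l ler1n.
have := dP _ wd; rewrite (addrC z) subrK => H.
have -> : f w - f z - h%:C *: 'd f z v =
   (f w - f z - 'd f z (w - z)) + 'd f z (w - z - h%:C *: v).
  move: ('d f z) => L; have LZ : L (h%:C *: v) = h%:C *: L v by rewrite linearZ.
  by rewrite (linearB L (w - z)) LZ addrA subrK.
apply: le_trans (n2D _ _) _.
have k1 := KP (w - z - h%:C *: v).
have k2 := ler_wpM2l (ltW K0) wv; have k3 := ler_wpM2l (ltW ep0) wz.
have := ler_wpM2r (normr_ge0 h) epe.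
have : 0 <= K * (ep * `|h|) by rewrite !mulr_ge0// ltW.
have : 0 <= ep * ((n2 v + 1) * `|h|).
  apply: mulr_ge0; first exact: ltW.
  by apply: mulr_ge0 => //; apply: addr_ge0 => //; exact: n2_ge0.
move: H k1 k2 k3; clear.
move: (n2 _) (n2 _) (n2 _) (n2 _) (n2 v) => x1 x2 x3 x4 x5; lra.
Qed.

End ComplexDifferentiability.

(** * Symmetry of second derivatives *)

Section Clairaut.
Variable R : realType.
Local Notation C := (cplx R).
Implicit Types (f g : C2 R -> C) (v w z h : C2 R) (O : set (C2 R)).

(** The second difference on the left is symmetric in [v] and [w], so the estimate for both orders
    yields Clairaut's theorem. Two applications of [cmvt] turn ep/4 into ep. *)
Lemma second_difference O f v w z : open O -> O z -> class_Ck 2 O f ->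
  forall ep : R, 0 < ep -> exists2 d : R, 0 < d & forall s : R, 0 < s < d ->
    nc (f (z + s%:C *: v + s%:C *: w) - f (z + s%:C *: v) - f (z + s%:C *: w) + f z
      - (s * s)%:C * real_derive w (real_derive v f) z) <= ep * (s * s).
Proof.
move=> oO Oz [cf Hf] ep ep0.
have [dv [cdv Hdv]] := Hf v; have [dwv [cdwv _]] := Hdv w.
set D := real_derive w _ z.
have eq0 : 0 < ep / 4 by rewrite divr_gt0.
have [d d0 dP] := (continuous_n2P _ z).1 (cdwv z Oz) _ eq0.
have /nbhs_n2P[d' d'0 dP'] := open_nbhs_nbhs (conj oO Oz).
have n0 : 0 < n2 v + n2 w + 1 by rewrite ltr_wpDl// addr_ge0 ?n2_ge0.
exists (Num.min d d' / (n2 v + n2 w + 1)) => [|s /andP[s0]].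
  by rewrite divr_gt0// lt_min d0.
rewrite ltr_pdivlMr// lt_min => /andP[sd sd'].
have In (a b : R) : 0 <= a <= s -> 0 <= b <= s ->
    n2 (z + a%:C *: v + b%:C *: w - z) <= s * (n2 v + n2 w + 1).
  move=> /andP[a0 a1] /andP[b0 b1]; rewrite addrAC (addrAC z) subrr add0r.
  apply: le_trans (n2D _ _) _; rewrite !n2Z !nc_real !ger0_norm//.
  have := ler_wpM2r (n2_ge0 v) a1; have := ler_wpM2r (n2_ge0 w) b1.
  by clear - s0; lra.
have s00 : 0 <= s <= s by rewrite lexx ltW.
have s01 : 0 <= (0 : R) <= s by rewrite lexx ltW.
have InO (a b : R) : 0 <= a <= s -> 0 <= b <= s -> O (z + a%:C *: v + b%:C *: w).
  by move=> a1 b1; apply: dP'; exact: le_lt_trans (In a b a1 b1) sd'.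
have InO0 (a : R) : 0 <= a <= s -> O (z + a%:C *: v).
  by move=> a1; have := InO a 0 a1 s01; rewrite scale0r addr0.
have step (a : R) : 0 <= a <= s ->
    nc (real_derive v f (z + a%:C *: v + s%:C *: w) - real_derive v f (z + a%:C *: v) - s%:C * D)
    <= 2 * (ep / 4) * s.
  move=> a1.
  have := @cmvt R (fun b => real_derive v f (z + a%:C *: v + b%:C *: w) - b%:C * D)
    (fun b => real_derive w (real_derive v f) (z + a%:C *: v + b%:C *: w) - D) 0 s (ep / 4) (ltW s0) _ _.
  rewrite scale0r addr0 mul0r !subr0 => B; rewrite addrAC; apply: B => b b1.
    apply: cderB; first exact: (rder_line (real_deriveP (dwv _ (InO a b a1 b1)))).
    by have := cderM (cder_id b) (cder_cst D b); rewrite mulr0 addr0 mul1r.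
  apply/ltW/dP; exact: le_lt_trans (In a b a1 b1) sd.
have := @cmvt R (fun a => f (z + a%:C *: v + s%:C *: w) - f (z + a%:C *: v) - a%:C * (s%:C * D))
  (fun a => real_derive v f (z + a%:C *: v + s%:C *: w) - real_derive v f (z + a%:C *: v) - s%:C * D)
  0 s (2 * (ep / 4) * s) (ltW s0) _ step.
rewrite scale0r addr0 mul0r !subr0 => B.
have -> : ep * (s * s) = 2 * (2 * (ep / 4) * s) * s by field.
rewrite (_ : _ - _ - _ + _ - _ = f (z + s%:C *: v + s%:C *: w) - f (z + s%:C *: v) -
   s%:C * (s%:C * D) - (f (z + s%:C *: w) - f z)); last by rewrite rcM; ring.
apply: B => a a1; apply: cderB; last first.
  by have := cderM (cder_id a) (cder_cst (s%:C * D) a); rewrite mulr0 addr0 mul1r.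
apply: cderB; last exact: (rder_line (real_deriveP (dv _ (InO0 a a1)))).
have := rder_line (z := z + s%:C *: w) (s := a) (f := f) (v := v) (l := real_derive v f (z + a%:C *: v + s%:C *: w)).
rewrite (addrAC z) => /(_ (real_deriveP (dv _ (InO a s a1 s00)))).
by apply: cder_eq => b; rewrite addrAC.
Qed.

Lemma real_derive_comm O f v w z : open O -> O z -> class_Ck 2 O f ->
  real_derive w (real_derive v f) z = real_derive v (real_derive w f) z.
Proof.
move=> oO Oz Cf; apply/eqP; rewrite -subr_eq0 -nc_eq0 eq_le nc_ge0 andbT.
apply/ler_addgt0Pr => e e0; rewrite add0r.
have e2 : 0 < e / 2 by rewrite divr_gt0.
have [d d0 dP] := second_difference v w oO Oz Cf e2.
have [d' d'0 dP'] := second_difference w v oO Oz Cf e2.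
have m0 : 0 < Num.min d d' by rewrite lt_min d0.
pose s := Num.min d d' / 2.
have s0 : 0 < s by rewrite divr_gt0.
have sm : s < Num.min d d' by rewrite /s; clear - m0; lra.
move: sm; rewrite lt_min => /andP[sd sd'].
have := dP s; rewrite s0 sd => /(_ isT); have := dP' s; rewrite s0 sd' => /(_ isT).
rewrite (addrAC z (s%:C *: w)).
set a := f (z + _ + _); set b := f (z + _ *: v); set c := f (z + _ *: w).
set D := real_derive w _ z; set D' := real_derive v _ z => H1 H2.
have ss : 0 < s * s by rewrite mulr_gt0.
have ncs : nc (s * s)%:C = s * s by rewrite nc_real gtr0_norm.
rewrite -(ler_pM2l ss) -{1}ncs -ncM.
have -> : (s * s)%:C * (D - D') = (a - c - b + f z - (s * s)%:C * D') - (a - b - c + f z - (s * s)%:C * D).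
  by ring.
apply: le_trans (ncD _ _) _; rewrite ncN.
have -> : s * s * e = e / 2 * (s * s) + e / 2 * (s * s) by field.
exact: lerD H1 H2.
Qed.

End Clairaut.

(** * Local inversion *)

(** The intervals of radius 2e/2^n around x_n are nested; their common point is the limit, with an
    explicit rate. *)
Lemma geometric_limit (R : realType) (x : nat -> R) (e : R) : 0 < e ->
  (forall n, `|x n.+1 - x n| <= e / 2 ^+ n) ->
  exists l, forall n, `|l - x n| <= 2 * e / 2 ^+ n.
Proof.
move=> e0 xe; have q0 n : 0 < e / 2 ^+ n by rewrite divr_gt0// exprn_gt0.
have qS n : e / 2 ^+ n.+1 = e / 2 ^+ n / 2 by rewrite exprSr invfM mulrA.
have [||l lP] := @nested_intervals R (fun n => x n - 2 * (e / 2 ^+ n)) (fun n => 4 * (e / 2 ^+ n)).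
- move=> n k; elim: k => [|k [IH1 IH2]]; first by rewrite addn0.
  have := xe (n + k)%N; rewrite ler_norml => /andP[h1 h2].
  by move: (q0 (n + k)%N); rewrite addnS qS; split; lra.
- by move=> n; rewrite mulr_gt0.
exists l => n; have /andP[h1 h2] := lP n.
by rewrite -mulrA ler_norml; apply/andP; split; lra.
Qed.

Section NewtonInverse.
Variable R : realType.
Local Notation C := (cplx R).
Local Notation Re := (@complex.Re R).
Local Notation Im := (@complex.Im R).
Implicit Types (f g : C2 R -> C) (v w z h : C2 R) (O : set (C2 R)).

Lemma n2N v : n2 (- v) = n2 v.
Proof. by rewrite /n2 fstN sndN !ncN. Qed.

Lemma n2_eq0 v : n2 v = 0 -> v = 0.
Proof.
move=> v0; have h1 := nc_ge0 v.1; have h2 := nc_ge0 v.2.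
have E : n2 v = nc v.1 + nc v.2 by [].
apply: c2P.
  by apply/eqP; rewrite -nc_eq0; apply/eqP; lra.
by apply/eqP; rewrite -nc_eq0; apply/eqP; lra.
Qed.

Lemma n2_le4 v : n2 v <= `|Re v.1| + `|Im v.1| + (`|Re v.2| + `|Im v.2|).
Proof. by apply: lerD; exact: nc_le_ReIm. Qed.

Section Newton.
Variables (Psi M : C2 R -> C2 R) (z0 : C2 R) (k r0 : R).
Hypotheses (k0 : 0 < k) (MB : forall v w, M (v - w) = M v - M w)
  (Mk : forall v, n2 (M v) <= k * n2 v) (M0 : forall v, M v = 0 -> v = 0).
Hypothesis contr : forall w w', n2 (w - z0) < r0 -> n2 (w' - z0) < r0 ->
  n2 (M (Psi w - Psi w') - (w - w')) <= 2^-1 * n2 (w - w').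

(** [M] is an approximate inverse of the differential of [Psi]: M Psi differs from the identity by a
    map with Lipschitz constant 1/2. Hence [Psi] cannot shrink distances by more than a fixed
    factor. *)
Lemma newton_expand w w' : n2 (w - z0) < r0 -> n2 (w' - z0) < r0 ->
  n2 (w - w') <= 2 * k * n2 (Psi w - Psi w').
Proof.
move=> wr wr'; have h1 := contr wr wr'; have h2 := Mk (Psi w - Psi w').
have := n2D (M (Psi w - Psi w')) (- (M (Psi w - Psi w') - (w - w'))).
rewrite subKr n2N; move: h1 h2.
move: (n2 (_ - (w - w'))) (n2 (M _)) (n2 (w - w')) (n2 (Psi w - Psi w')) => a b c d.
by move=> h1 h2 h3; rewrite -mulrA; move: h1 h2 h3; move: (k * d) => x; lra.
Qed.

(** Iteration w -> w + M(q - Psi(w)) from [z0]. By [contr] the new residual M(q - Psi(w)) is at most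
    half of the old one, so the steps decrease geometrically. *)
Lemma newton_onto r : 0 < r -> r <= r0 -> forall q, n2 (q - Psi z0) < r / (16 * k) ->
  exists2 w, n2 (w - z0) < r & Psi w = q.
Proof.
move=> rp rr0 q qr.
pose W := fix W n := if n is m.+1 then W m + M (q - Psi (W m)) else z0.
(* The assumption on q makes the first residual at most e. The iterates then stay within 2e of [z0],
   and the limit, with error 2e in each of the four real coordinates, within 8e = r/2. *)
pose e := r / 16; have e0 : 0 < e by rewrite divr_gt0.
have p0 n : 0 < e / 2 ^+ n by rewrite divr_gt0// exprn_gt0.
have pS n : e / 2 ^+ n.+1 = e / 2 ^+ n / 2 by rewrite exprSr invfM mulrA.
have main n : n2 (M (q - Psi (W n))) <= e / 2 ^+ n /\
    n2 (W n - z0) <= 2 * e - 2 * (e / 2 ^+ n).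
  elim: n => [|n [IH1 IH2]].
    rewrite /= expr0 divr1 !subrr n2_0; split; last by [].
    apply: le_trans (Mk _) _; move: qr; rewrite invfM mulrA ltr_pdivlMr// => qr.
    by rewrite mulrC ltW.
  have WS : W n.+1 = W n + M (q - Psi (W n)) by [].
  have hW : n2 (W n.+1 - z0) <= 2 * e - 2 * (e / 2 ^+ n.+1).
    rewrite WS addrAC; apply: le_trans (n2D _ _) _; rewrite pS.
    move: IH1 IH2; move: (n2 _) (n2 _) => a b; lra.
  split; last exact: hW.
  have er : 2 * e < r0 by rewrite /e; move: rr0 rp; lra.
  have b1 : n2 (W n - z0) < r0.
    by apply: le_lt_trans IH2 _; have := p0 n; move: er; lra.
  have b2 : n2 (W n.+1 - z0) < r0.
    by apply: le_lt_trans hW _; have := p0 n.+1; move: er; lra.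
  have := contr b2 b1.
  have -> : W n.+1 - W n = M (q - Psi (W n)) by rewrite WS addrC addKr.
  have -> : M (q - Psi (W n.+1)) = - (M (Psi (W n.+1) - Psi (W n)) - M (q - Psi (W n))).
    by rewrite opprB -MB opprB addrA subrK.
  rewrite n2N pS => H.
  by apply: le_trans H _; rewrite mulrC ler_pM2r// invr_gt0.
have coord (c : C2 R -> R) : (forall v w, c (v + w) = c v + c w) -> (forall v, `|c v| <= n2 v) ->
    exists l, forall n, `|l - c (W n)| <= 2 * e / 2 ^+ n.
  move=> cD cn; apply: geometric_limit => // n.
  have -> : W n.+1 = W n + M (q - Psi (W n)) by [].
  rewrite cD addrAC subrr add0r; apply: le_trans (cn _) _; exact: (main n).1.
have [n21 n22] : (forall v, nc v.1 <= n2 v) /\ (forall v, nc v.2 <= n2 v).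
  by split=> v; rewrite /n2 ?lerDl ?lerDr nc_ge0.
have [a aP] := coord (fun v => Re v.1) (fun v w => cReD v.1 w.1) (fun v => le_trans (le_Re_nc v.1) (n21 v)).
have [b bP] := coord (fun v => Im v.1) (fun v w => cImD v.1 w.1) (fun v => le_trans (le_Im_nc v.1) (n21 v)).
have [c cP] := coord (fun v => Re v.2) (fun v w => cReD v.2 w.2) (fun v => le_trans (le_Re_nc v.2) (n22 v)).
have [d dP] := coord (fun v => Im v.2) (fun v w => cImD v.2 w.2) (fun v => le_trans (le_Im_nc v.2) (n22 v)).
pose w : C2 R := (a +i* b, c +i* d).
have wW n : n2 (w - W n) <= 8 * (e / 2 ^+ n).
  apply: le_trans (n2_le4 _) _; rewrite fstD sndD fstN sndN !cReD !cImD !cReN !cImN.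
  rewrite [Re w.1]/= [Im w.1]/= [Re w.2]/= [Im w.2]/=.
  move: (aP n) (bP n) (cP n) (dP n); rewrite -!mulrA.
  move: (`|_|) (`|_|) (`|_|) (`|_|) => x1 x2 x3 x4; lra.
have w0 : n2 (w - z0) < r.
  have := wW 0%N; rewrite expr0 divr1 /= => /le_lt_trans; apply.
  by rewrite /e; move: rp; lra.
exists w => //.
have wr0 : n2 (w - z0) < r0 by apply: lt_le_trans w0 rr0.
suff Q0 : n2 (M (q - Psi w)) <= 0.
  have /M0/eqP : M (q - Psi w) = 0.
    by apply: n2_eq0; apply/eqP; rewrite eq_le Q0 n2_ge0.
  by rewrite subr_eq0 => /eqP.
apply/ler_addgt0Pr => ep ep0; rewrite add0r.
(* The residual at the limit splits into the residual e/2^n at step n, half of the distance 8e/2^n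
   and this distance itself: 13, rounded up to 20. *)
have bound n : n2 (M (q - Psi w)) <= 20 * (e / 2 ^+ n).
  have er : 2 * e < r0 by rewrite /e; move: rr0 rp; lra.
  have b1 : n2 (W n - z0) < r0.
    by apply: le_lt_trans (main n).2 _; have := p0 n; move: er; lra.
  have E : M (q - Psi w) = M (q - Psi (W n)) + (M (Psi (W n) - Psi w) - (W n - w)) + (W n - w).
    rewrite -addrA subrK; have := MB (q - Psi (W n)) (Psi w - Psi (W n)).
    rewrite opprB addrA subrK => ->; congr (_ + _).
    have := MB 0 (Psi w - Psi (W n)); rewrite sub0r opprB => ->.
    suff -> : M 0 = 0 by rewrite sub0r.
    by have := MB 0 0; rewrite !subr0 subrr.
  rewrite E; apply: le_trans (n2D _ _) _; apply: le_trans (lerD (n2D _ _) (lexx _)) _.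
  have h1 := contr b1 wr0; have h2 := wW n; rewrite (n2B w) in h2; have h3 := (main n).1.
  move: h1 h2 h3; move: (n2 _) (n2 _) (n2 _) => x1 x2 x3; have := p0 n; lra.
have e20 : 0 < 20 * e by rewrite mulr_gt0.
have := @cvg_geometric _ (20 * e) (2^-1 : R) _.
rewrite ger0_norm ?invr_ge0// invf_lt1 ?ltr1n// => /(_ isT).
move=> /(@cvgrPdist_lt R R nat _ _) /(_ ep ep0)[n _ /(_ n (leqnn _))].
rewrite sub0r normrN /geometric/= exprVn => H.
apply: le_trans (bound n) _; rewrite mulrA; apply: ltW.
by apply: le_lt_trans H; exact: ler_norm.
Qed.

End Newton.
End NewtonInverse.

(** * Local inversion of maps with triangular differential *)

Section TriangularMaps.
Variable R : realType.
Local Notation C := (cplx R).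
Local Notation Re := (@complex.Re R).
Local Notation Im := (@complex.Im R).
Implicit Types (f g : C2 R -> C) (v w z h : C2 R) (O : set (C2 R)).

Lemma n2_pairD (p q p' q' : C) : ((p, q) : C2 R) + (p', q') = (p + p', q + q').
Proof. by []. Qed.

Section Inverse.
Variables (u f : C2 R -> C) (O : set (C2 R)) (z0 : C2 R) (a b : C).
Hypotheses (oO : open O) (Oz : O z0) (Cu : class_Ck 1 O u) (Cf : class_Ck 1 O f).
Hypotheses (a0 : a != 0) (b0 : b != 0).
Hypotheses (Lu : forall v, rlin u z0 v = a * v.1)
  (Lf : forall v, rlin f z0 v = rlin f z0 (v.1, 0) + b * v.2).

Definition tri_map (w : C2 R) : C2 R := (u w, f w).

(** Inverse of the differential of [tri_map] at [z0]. This differential is block triangular, with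
    complex linear diagonal blocks a and b; the remaining block is the real linear map
    [rlin f z0 (_, 0)]. *)
Definition tri_inv (q : C2 R) : C2 R :=
  (q.1 / a, (q.2 - rlin f z0 (q.1 / a, 0)) / b).

Lemma tri_invE1 q : (tri_inv q).1 = q.1 / a. Proof. by []. Qed.
Lemma tri_invE2 q : (tri_inv q).2 = (q.2 - rlin f z0 (q.1 / a, 0)) / b.
Proof. by []. Qed.

Lemma tri_invB v w : tri_inv (v - w) = tri_inv v - tri_inv w.
Proof.
have E : rlin f z0 ((v - w).1 / a, 0) = rlin f z0 (v.1 / a, 0) - rlin f z0 (w.1 / a, 0).
  rewrite -rlinN -rlinD; congr (rlin f z0 _); apply: c2P.
    by rewrite fstD fstN fstD fstN mulrBl.
  by rewrite sndD sndN subr0.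
apply: c2P; first by rewrite fstD fstN !tri_invE1 fstD fstN mulrBl.
rewrite sndD sndN !tri_invE2 E sndD sndN -mulrBl; congr (_ / b).
by rewrite opprB opprB addrACA [RHS]addrACA; congr (_ + _); rewrite addrC.
Qed.

Lemma tri_invK v : tri_inv (rlin u z0 v, rlin f z0 v) = v.
Proof.
apply: c2P; rewrite /tri_inv [LHS]/=; first by rewrite Lu mulrC mulKf.
by rewrite Lu (mulrC a) mulfK// (Lf v) (addrC (rlin _ _ _)) addrK mulrC mulKf.
Qed.

Lemma tri_inv_eq0 v : tri_inv v = 0 -> v = 0.
Proof.
move=> E0; have h1 : v.1 / a = 0 by rewrite -tri_invE1 E0.
have L0 : rlin f z0 (0, 0) = 0.
  have := rlinD f z0 (0, 0) (0, 0); rewrite n2_pairD addr0.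
  by move/(congr1 (fun t => t - rlin f z0 (0, 0))); rewrite subrr addrK.
have h2 : (v.2 - rlin f z0 (v.1 / a, 0)) / b = 0 by rewrite -tri_invE2 E0.
move: h2; rewrite h1 L0 subr0 => h2.
by apply: c2P; [rewrite -(divfK a0 v.1) h1 mul0r|rewrite -(divfK b0 v.2) h2 mul0r].
Qed.

Lemma tri_inv_le : exists2 k : R, 0 < k & forall v, n2 (tri_inv v) <= k * n2 v.
Proof.
have [K K0 KP] := nc_rlin f z0.
have na : 0 < nc a by rewrite nc_gt0.
have nb : 0 < nc b by rewrite nc_gt0.
exists ((nc a)^-1 + (1 + K / nc a) / nc b).
  by rewrite addr_gt0 ?invr_gt0// divr_gt0// addr_gt0// divr_gt0.
move=> v; rewrite [n2 _]/(nc (v.1 / a) + nc ((v.2 - rlin f z0 (v.1 / a, 0)) / b)).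
have n1 : nc v.1 <= n2 v by rewrite lerDl nc_ge0.
have nn2 : nc v.2 <= n2 v by rewrite lerDr nc_ge0.
rewrite [leRHS]mulrDl; apply: lerD.
  by rewrite ncM ncV mulrC ler_wpM2l// invr_ge0 ltW.
rewrite ncM ncV mulrAC ler_pM2r ?invr_gt0//.
apply: le_trans (ncD _ _) _; rewrite ncN [leRHS]mulrDl mul1r; apply: lerD => //.
apply: le_trans (KP _) _.
have -> : n2 (v.1 / a, 0) = nc v.1 / nc a by rewrite -ncV -ncM -[RHS]addr0 -(nc0 R).
rewrite -mulrA (mulrC (nc v.1)) mulrA mulrA ler_wpM2l//.
by rewrite divr_ge0// ltW.
Qed.

Lemma tri_strict ep : 0 < ep -> exists2 d : R, 0 < d & forall w w',
  n2 (w - z0) < d -> n2 (w' - z0) < d ->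
  n2 (tri_inv (tri_map w - tri_map w') - (w - w')) <= ep * n2 (w - w').
Proof.
move=> ep0; have [k k0 kP] := tri_inv_le.
have e0 : 0 < ep / (2 * k) by rewrite divr_gt0// mulr_gt0.
have [d1 d10 H1] := strict_diff oO Oz Cu e0.
have [d2 d20 H2] := strict_diff oO Oz Cf e0.
exists (Num.min d1 d2) => [|w w']; first by rewrite lt_min d10.
rewrite !lt_min => /andP[w1 w2] /andP[w'1 w'2].
rewrite -{1}(tri_invK (w - w')) -tri_invB; apply: le_trans (kP _) _.
have -> : ep * n2 (w - w') = k * (ep / (2 * k) * n2 (w - w') + ep / (2 * k) * n2 (w - w')).
  by field; rewrite gt_eqF.
rewrite ler_pM2l//; apply: lerD; [exact: H1|exact: H2].
Qed.

(** An inverse function theorem in two halves: injectivity with a Lipschitz bound, and openness at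
    [z0]. No inverse function has to be named. *)
Lemma tri_local_inverse : exists r k : R, [/\ 0 < r, 0 < k,
  forall w, n2 (w - z0) < r -> O w,
  forall w w', n2 (w - z0) < r -> n2 (w' - z0) < r ->
    n2 (w - w') <= k * n2 (tri_map w - tri_map w') &
  forall r', 0 < r' -> exists2 p : R, 0 < p & forall q, n2 (q - tri_map z0) < p ->
    exists2 w, n2 (w - z0) < r' & tri_map w = q].
Proof.
have [k k0 kP] := tri_inv_le.
have e0 : 0 < 2^-1 :> R by rewrite invr_gt0.
have [d d0 dP] := tri_strict e0.
have /nbhs_n2P[d' d'0 dP'] := open_nbhs_nbhs (conj oO Oz).
exists (Num.min d d'), (2 * k); split.
- by rewrite lt_min d0.
- by rewrite mulr_gt0.
- by move=> w; rewrite lt_min => /andP[_ /dP'].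
- move=> w w'; rewrite !lt_min => /andP[w1 _] /andP[w2 _].
  exact: (newton_expand kP dP).
move=> r' r'0; pose r := Num.min r' d.
have r0 : 0 < r by rewrite lt_min r'0.
have rd : r <= d by rewrite ge_min lexx orbT.
exists (r / (16 * k)) => [|q qr]; first by rewrite divr_gt0// mulr_gt0.
have [w wr wq] := newton_onto k0 tri_invB kP tri_inv_eq0 dP r0 rd qr.
by exists w => //; apply: lt_le_trans wr _; rewrite ge_min lexx.
Qed.

(** Chain rule for g composed with the local inverse of [tri_map], stated for any [kap] with the
    right values on the image. This is how functions on X are differentiated through a cylinder. *)
Lemma tri_rder (g kap : C2 R -> C) v : class_Ck 1 O g ->
  (forall w, O w -> kap (tri_map w) = g w) ->
  rder v kap (tri_map z0) (rlin g z0 (tri_inv v)).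
Proof.
move=> Cg kg e e0.
have [r [k [r0 k0 rO exp ont]]] := tri_local_inverse.
have [K K0 KP] := nc_rlin g z0.
have n0 : 0 < n2 v + 1 by rewrite ltr_wpDl// n2_ge0.
(* The preimage moves by at most k |h| ([n2 v] + 1); the linearisation error of g counts once, and
   that of the inverse is multiplied by the norm bound K. *)
pose ep := e / ((1 + K) * (k * (n2 v + 1))).
have ep0 : 0 < ep by rewrite divr_gt0// !mulr_gt0// addr_gt0.
have [d1 d10 H1] := strict_diff oO Oz Cg ep0.
have [d2 d20 H2] := tri_strict ep0.
pose r' := Num.min r (Num.min d1 d2).
have r'0 : 0 < r' by rewrite !lt_min r0 d10.
have [p p0 pP] := ont r' r'0.
exists (p / (n2 v + 1)) => [|h]; first by rewrite divr_gt0.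
rewrite ltr_pdivlMr// => hp.
have hle : `|h| * n2 v <= `|h| * (n2 v + 1) by rewrite ler_wpM2l// lerDl.
have qp : n2 (tri_map z0 + h%:C *: v - tri_map z0) < p.
  by rewrite addrAC subrr add0r n2Z nc_real; exact: le_lt_trans hle hp.
have [w wr wq] := pP _ qp.
rewrite add0r scale0r addr0 -wq.
move: wr; rewrite !lt_min => /and3P[wr w1 w2].
have z0r (x : R) : 0 < x -> n2 (z0 - z0) < x by rewrite subrr n2_0.
rewrite !kg//; last exact: rO.
have wz := exp w z0 wr (z0r r r0).
rewrite wq addrAC subrr add0r n2Z nc_real in wz.
have h1 := H1 w z0 w1 (z0r _ d10); have h2 := H2 w z0 w2 (z0r _ d20).
rewrite wq addrAC subrr add0r in h2.
have MZ : tri_inv (h%:C *: v) = h%:C *: tri_inv v.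
  have E : rlin f z0 (h%:C * v.1 / a, 0) = h%:C * rlin f z0 (v.1 / a, 0).
    by rewrite -rlinZ; congr (rlin f z0 _); apply: c2P; rewrite ?fstZ ?sndZ ?mulr0 ?mulrA.
  apply: c2P; first by rewrite fstZ !tri_invE1 fstZ mulrA.
  by rewrite sndZ !tri_invE2 fstZ sndZ E -mulrBr mulrA.
rewrite MZ in h2.
have -> : g w - g z0 - h%:C * rlin g z0 (tri_inv v) =
  (g w - g z0 - rlin g z0 (w - z0)) + - rlin g z0 (h%:C *: tri_inv v - (w - z0)).
  by rewrite -rlinZ (rlinD _ _ (_ *: _) (- (w - z0))) (rlinN _ _ (w - z0)); ring.
apply: le_trans (ncD _ _) _; rewrite ncN.
have h3 := KP (h%:C *: tri_inv v - (w - z0)).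
have -> : e * `|h| = (1 + K) * ep * (k * (`|h| * (n2 v + 1))).
  by rewrite /ep; field; rewrite !gt_eqF// addr_gt0.
have wz' : n2 (w - z0) <= k * (`|h| * (n2 v + 1)).
  by apply: le_trans wz _; rewrite ler_pM2l.
have h4 := ler_wpM2l (ltW K0) h2.
have h5 : (1 + K) * ep * n2 (w - z0) <= (1 + K) * ep * (k * (`|h| * (n2 v + 1))).
  by rewrite ler_wpM2l// mulr_ge0// ltW// addr_gt0.
apply: le_trans h5; rewrite mulrDl mul1r mulrDl; apply: lerD => //.
by apply: le_trans h3 _; rewrite -mulrA.
Qed.

End Inverse.

(** The real condition D_4 = i D_3 is the Cauchy-Riemann equation in y; here it is turned into
    complex differentiability of the slice. *)
Lemma slice_y O f z : open O -> O z -> class_Ck 1 O f ->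
  real_derive (e4 R) f z = 'i * real_derive (e3 R) f z ->
  is_derive z.2 1 (fun y : C => f (z.1, y)) (real_derive (e3 R) f z).
Proof.
move=> oO Oz Cf D4; apply/is_deriveCP => e e0.
have [d d0 dP] := strict_diff oO Oz Cf e0; exists d => // h hd.
have E : (z.1, z.2 + h) - z = (0, h).
  have -> : (z.1, z.2 + h) - z = (z.1 - z.1, z.2 + h - z.2) by [].
  by congr pair; [rewrite subrr|rewrite addrAC subrr add0r].
have nE : n2 (0, h) = nc h by rewrite -[RHS]add0r -(nc0 R).
have := dP (z.1, z.2 + h) z; rewrite E nE subrr n2_0 => /(_ hd d0).
have -> : rlin f z (0, h) = h * real_derive (e3 R) f z.
  have -> : rlin f z (0, h) = 0 * real_derive (e1 R) f z + 0 * real_derive (e2 R) f z +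
      (Re h)%:C * real_derive (e3 R) f z + (Im h)%:C * real_derive (e4 R) f z by [].
  rewrite D4 [in RHS](ReIm h); move: (real_derive _ _ _) (real_derive _ _ _) (real_derive _ _ _) => A B D.
  by ring.
by rewrite -{1}(surjective_pairing z).
Qed.

Lemma slice_y_rder f z l : is_derive z.2 1 (fun y : C => f (z.1, y)) l ->
  rder (e3 R) f z l /\ rder (e4 R) f z ('i * l).
Proof.
move=> fl; have H (c : C) : rder (0, c) f z (c * l).
  have := @cder_comp_holo R (fun y => f (z.1, y)) (fun t : R => z.2 + t%:C * c) 0 l c.
  rewrite mul0r addr0 (mulrC c) => /(_ fl (cder_line z.2 c 0)).
  apply: cder_eq => t; congr f; apply: c2P; rewrite ?fstD ?sndD ?fstZ ?sndZ //.
  by rewrite mulr0 addr0.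
by split; [have := H 1; rewrite mul1r|exact: H].
Qed.

Lemma slice_x_rder f z l : is_derive z.1 1 (fun x : C => f (x, z.2)) l ->
  rder (e1 R) f z l /\ rder (e2 R) f z ('i * l).
Proof.
move=> fl; have H (c : C) : rder (c, 0) f z (c * l).
  have := @cder_comp_holo R (fun x => f (x, z.2)) (fun t : R => z.1 + t%:C * c) 0 l c.
  rewrite mul0r addr0 (mulrC c) => /(_ fl (cder_line z.1 c 0)).
  apply: cder_eq => t; congr f; apply: c2P; rewrite ?fstD ?sndD ?fstZ ?sndZ //.
  by rewrite mulr0 addr0.
by split; [have := H 1; rewrite mul1r|exact: H].
Qed.

Lemma real_derive_differentiable O f z : open O -> O z -> class_Ck 1 O f ->
  real_derive (e2 R) f z = 'i * real_derive (e1 R) f z ->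
  real_derive (e4 R) f z = 'i * real_derive (e3 R) f z ->
  differentiable f z /\ forall v, 'D_v f z = real_derive v f z.
Proof.
move=> oO Oz Cf D2 D4.
have L v : rlin f z v = v.1 * real_derive (e1 R) f z + v.2 * real_derive (e3 R) f z.
  by rewrite /rlin D2 D4 [in RHS](ReIm v.1) [in RHS](ReIm v.2); ring.
have [|df dE] := @linear_differentiable_n2 R f z (real_derive (e1 R) f z) (real_derive (e3 R) f z).
  move=> e e0; have [d d0 dP] := strict_diff oO Oz Cf e0; exists d => // h hd.
  rewrite -L; have E : z + h - z = h by rewrite addrAC subrr add0r.
  by have := dP (z + h) z; rewrite E subrr n2_0; apply.
by split=> // v; rewrite dE -L (real_derive_rlin v oO Oz Cf).
Qed.

End TriangularMaps.

(** * Holomorphic functions of two variables *)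

Section TwoVariables.
Variable R : realType.
Local Notation C := (cplx R).
Implicit Types (z : C2 R).

Lemma continuous_pair_C2 (T : topologicalType) (f g : T -> C) (t : T) :
  {for t, continuous f} -> {for t, continuous g} ->
  {for t, continuous (fun s => (f s, g s) : C2 R)}.
Proof.
move=> /(@cvg_ncP R T (nbhs t) _ f (f t)) cf /(@cvg_ncP R T (nbhs t) _ g (g t)) cg A.
move=> /nbhs_nc2P[d d0 dP].
change (nbhs t [set s | A (f s, g s)]).
by near=> s; apply: dP; near: s; [exact: cf|exact: cg].
Unshelve. all: by end_near.
Qed.

(** Separate holomorphy with continuity suffices: the y-derivative is a circle integral of g in y,
    which is differentiated in x under the integral sign. The joint continuity this requires of the
    x-derivative follows by writing the latter as a circle integral as well. *)
Lemma derive_slice_derivable (g : C2 R -> C) z0 (r : R) : 0 < r ->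
  (forall z, nc (z.1 - z0.1) < r -> nc (z.2 - z0.2) < r ->
    [/\ {for z, continuous g}, derivable (fun x : C => g (x, z.2)) z.1 1 &
        derivable (fun y : C => g (z.1, y)) z.2 1]) ->
  derivable (fun x : C => 'D_1 (fun y : C => g (x, y)) z0.2) z0.1 1.
Proof.
case: z0 => x0 y0 /= r0 H.
(* The radii that [derive_circle] uses on disks of radius r in y and r/2 in x. *)
pose p := r / 16; pose p' := r / 32.
pose c0 : C := (p%:C * (2 * pi)%:C)^-1; pose c1 : C := (p'%:C * (2 * pi)%:C)^-1.
have p0 : 0 < p by rewrite divr_gt0.
have p'0 : 0 < p' by rewrite divr_gt0.
have circ (c : C) (q : R) (t : R) : 0 < q -> nc (c + q%:C * eit t - c) = q.
  by move=> q0; rewrite addrAC subrr add0r ncM nc_eit mulr1 nc_real gtr0_norm.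
have pr : p < r by rewrite /p; lra.
have yin t : nc (y0 + p%:C * eit t - y0) < r by rewrite circ.
have xin x t : nc (x - x0) < r / 2 -> nc (x + p'%:C * eit t - x0) < r.
  move=> xr; have := ncD (x + p'%:C * eit t - x) (x - x0).
  by rewrite addrA subrK circ// /p'; lra.
have ccirc (c : C) (q : R) : continuous (fun t => c + q%:C * eit t).
  apply: continuousCD; first exact: continuousC_cst.
  by apply: continuousCM; [exact: continuousC_cst|exact: continuous_eit].
have DE x : nc (x - x0) < r -> 'D_1 (fun y : C => g (x, y)) y0 =
    c0 * cint (fun t => g (x, y0 + p%:C * eit t) * emit t) 0 (2 * pi).
  move=> xr; have [] // := @derive_circle R (fun y : C => g (x, y)) y0 r r0.
  by move=> y yr; have [_ _ h] := H (x, y) xr yr; exact h.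
have r2 : 0 < r / 2 by rewrite divr_gt0.
pose G (x : C) (t : R) := g (x, y0 + p%:C * eit t) * emit t.
pose G' (x : C) (t : R) := 'D_1 (fun x : C => g (x, y0 + p%:C * eit t)) x * emit t.
have cG x : nc (x - x0) < r -> continuous (G x).
  move=> xr; apply: continuousCM; last exact: continuous_emit.
  move=> t; apply: (@continuous_comp R (C2 R) C (fun t => (x, y0 + p%:C * eit t)) g).
    by apply: continuous_pair_C2; [exact: cvg_cst|exact: ccirc].
  by have [h _ _] := H (x, y0 + p%:C * eit t) xr (yin t); exact h.
pose Q (w : C2 R) := c1 * cint (fun s => g (w.1 + p'%:C * eit s, w.2) * emit s) 0 (2 * pi).
have QE w : nc (w.1 - x0) < r / 2 -> nc (w.2 - y0) < r ->
    'D_1 (fun x : C => g (x, w.2)) w.1 = Q w.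
  move=> w1 w2.
  have dg x : nc (x - w.1) < r / 2 -> derivable (fun x : C => g (x, w.2)) x 1.
    move=> xw; have xr : nc (x - x0) < r.
      by have := ncD (x - w.1) (w.1 - x0); rewrite addrA subrK; lra.
    by have [_ h _] := H (x, w.2) xr w2; exact h.
  have := @derive_circle R (fun x : C => g (x, w.2)) w.1 (r / 2) r2 dg.
  have -> : r / 2 / 16 = p' by rewrite /p'; field.
  by move=> h; exact (derive_val (is_derive := h)).
have cQ w : nc (w.1 - x0) < r / 2 -> nc (w.2 - y0) < r -> {for w, continuous Q}.
  move=> w1 w2; apply: (@cvgM C (C2 R) (nbhs w)); first exact: cvg_cst.
  have near : \forall v \near w, nc (v.1 - x0) < r / 2 /\ nc (v.2 - y0) < r.
    apply/nbhs_nc2P; exists (Num.min (r / 2 - nc (w.1 - x0)) (r - nc (w.2 - y0))).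
      by rewrite lt_min !subr_gt0 w1.
    move=> v; rewrite !lt_min => /andP[v1 _] /andP[_ v2].
    have := ncD (v.1 - w.1) (w.1 - x0); have := ncD (v.2 - w.2) (w.2 - y0).
    by rewrite !addrA !subrK; lra.
  apply: (@continuous_cint R (C2 R) (fun w s => g (w.1 + p'%:C * eit s, w.2) * emit s) w).
  - exact: pi2_ge0.
  - apply: filterS near => v [v1 v2]; apply: continuousCM; last exact: continuous_emit.
    move=> t; apply: (@continuous_comp R (C2 R) C (fun t => (v.1 + p'%:C * eit t, v.2)) g).
      by apply: continuous_pair_C2; [exact: ccirc|exact: cvg_cst].
    by have [h _ _] := H (v.1 + p'%:C * eit t, v.2) (xin v.1 t v1) v2; exact h.
  - move=> t; apply: (@cvgM C (C2 R * R)%type (nbhs (w, t))); last first.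
      apply: (@continuous_comp (C2 R * R)%type R C snd (@emit R)); first exact: cvg_snd.
      exact: continuous_emit.
    apply: (@continuous_comp (C2 R * R)%type (C2 R) C
      (fun q => (q.1.1 + p'%:C * eit q.2, q.1.2)) g); last first.
      by have [h _ _] := H (w.1 + p'%:C * eit t, w.2) (xin w.1 t w1) w2; exact h.
    apply: continuous_pair_C2.
      apply: (@cvgD C C (C2 R * R)%type (nbhs (w, t))).
        by apply: (@continuous_comp (C2 R * R)%type (C2 R) C fst fst); exact: cvg_fst.
      apply: (@cvgM C (C2 R * R)%type (nbhs (w, t))); first exact: cvg_cst.
      apply: (@continuous_comp (C2 R * R)%type R C snd (@eit R)); first exact: cvg_snd.
      exact: continuous_eit.
    apply: (@continuous_comp (C2 R * R)%type (C2 R) C fst snd); first exact: cvg_fst.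
    exact: cvg_snd.
have dG : is_derive x0 1 (fun x => cint (G x) 0 (2 * pi)) (cint (G' x0) 0 (2 * pi)).
  apply: (@is_derive_cint R G G' x0 (r / 2) 0 (2 * pi) r2 (@pi2_ge0 R)).
  - move=> x t xr _; have xr' : nc (x - x0) < r by lra.
    have [_ dg _] := H (x, y0 + p%:C * eit t) xr' (yin t).
    have := is_deriveM (derivableP dg) (is_derive_cst (emit t) x 1).
    by move=> h; apply: (is_derive_eq h); rewrite /GRing.scale/= mulr0 add0r mulrC.
  - by move=> x xr; apply: cG; lra.
  - move=> t; apply/(@cvg_ncP R (C * R)%type (nbhs (x0, t)) _ _ _) => e e0.
    have wx : nc (x0 - x0) < r / 2 by rewrite subrr nc0.
    have cq : {for (x0, t), continuous (fun q : C * R => Q (q.1, y0 + p%:C * eit q.2) * emit q.2)}.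
      apply: (@cvgM C (C * R)%type (nbhs (x0, t))); last first.
        apply: (@continuous_comp (C * R)%type R C snd (@emit R)); first exact: cvg_snd.
        exact: continuous_emit.
      apply: (@continuous_comp (C * R)%type (C2 R) C (fun q => (q.1, y0 + p%:C * eit q.2)) Q).
        apply: continuous_pair_C2; first exact: cvg_fst.
        apply: (@continuous_comp (C * R)%type R C snd (fun t => y0 + p%:C * eit t)); first exact: cvg_snd.
        exact: ccirc.
      exact (cQ (x0, y0 + p%:C * eit t) wx (yin t)).
    have cq' := (@cvg_ncP R (C * R)%type (nbhs (x0, t)) (nbhs_filter _) _ _).1 cq e e0.
    have nr : \forall q \near (x0, t), nc ((q : C * R).1 - x0) < r / 2.
      have n0 : nbhs x0 [set x : C | nc (x - x0) < r / 2].
        by apply/nbhs_ncP; exists (r / 2).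
      exact: (@cvg_fst C R (nbhs x0) (nbhs t) _ _ n0).
    apply: filterS (filterI nr cq') => -[x s] [/= xr].
    by rewrite /G' (QE (x, _) xr (yin s)) (QE (x0, _) wx (yin t)).
have dG0 := is_deriveZ c0 dG.
apply: (near_eq_derivable (f := fun x => c0 * cint (G x) 0 (2 * pi))).
  by apply/nbhs_ncP; exists r => // x xr; rewrite DE.
exact: (ex_derive (is_derive := dG0)).
Qed.

Lemma diff_slices (f : C2 R -> C2 R) z : differentiable f z ->
  [/\ is_derive z.1 1 (fun x : C => (f (x, z.2)).1) ('D_(1, 0) f z).1,
      is_derive z.1 1 (fun x : C => (f (x, z.2)).2) ('D_(1, 0) f z).2,
      is_derive z.2 1 (fun y : C => (f (z.1, y)).1) ('D_(0, 1) f z).1 &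
      is_derive z.2 1 (fun y : C => (f (z.1, y)).2) ('D_(0, 1) f z).2].
Proof.
move=> df; have D := differentiable_n2 df.
have nx (h : C) : n2 (h, 0) = nc h by rewrite -[RHS]addr0 -(nc0 R).
have ny (h : C) : n2 (0, h) = nc h by rewrite -[RHS]add0r -(nc0 R).
have Lx (h : C) : 'd f z (h, 0) = h *: 'D_(1, 0) f z.
  rewrite (deriveE _ df); move: ('d f z) => L; rewrite -linearZ; congr (L _).
  by apply: c2P; rewrite ?fstZ ?sndZ /= ?mulr1 ?mulr0.
have Ly (h : C) : 'd f z (0, h) = h *: 'D_(0, 1) f z.
  rewrite (deriveE _ df); move: ('d f z) => L; rewrite -linearZ; congr (L _).
  by apply: c2P; rewrite ?fstZ ?sndZ /= ?mulr1 ?mulr0.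
have zx (h : C) : z + (h, 0) = (z.1 + h, z.2).
  by apply: c2P; rewrite ?fstD ?sndD //= addr0.
have zy (h : C) : z + (0, h) = (z.1, z.2 + h).
  by apply: c2P; rewrite ?fstD ?sndD //= addr0.
have le1 (v : C2 R) : nc v.1 <= n2 v by rewrite lerDl nc_ge0.
have le2 (v : C2 R) : nc v.2 <= n2 v by rewrite lerDr nc_ge0.
split; apply/is_deriveCP => e /D[d d0 dP]; exists d => // h hd.
- have := dP (h, 0); rewrite nx zx Lx => /(_ hd); apply: le_trans.
  apply: le_trans (le1 _); rewrite fstD fstN fstD fstN fstZ.
  by rewrite -surjective_pairing.
- have := dP (h, 0); rewrite nx zx Lx => /(_ hd); apply: le_trans.
  apply: le_trans (le2 _); rewrite sndD sndN sndD sndN sndZ.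
  by rewrite -surjective_pairing.
- have := dP (0, h); rewrite ny zy Ly => /(_ hd); apply: le_trans.
  apply: le_trans (le1 _); rewrite fstD fstN fstD fstN fstZ.
  by rewrite -surjective_pairing.
- have := dP (0, h); rewrite ny zy Ly => /(_ hd); apply: le_trans.
  apply: le_trans (le2 _); rewrite sndD sndN sndD sndN sndZ.
  by rewrite -surjective_pairing.
Qed.

End TwoVariables.

(** * Foliated charts and leaves *)

Section Charts.
Variables (R : realType) (X : topologicalType) (F : foliatedSurface R X).
Local Notation C := (cplx R).
Local Notation ph := (@phi R X F).
Local Notation ps := (@psi R X F).
Local Notation dm := (@dom R X F).
Implicit Types (a b c : chart F) (p q : X) (z v w : C2 R).

Lemma is_derive_pair (f g : C -> C) (t l m : C) : is_derive t 1 f l ->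
  is_derive t 1 g m -> is_derive t 1 (fun s => (f s, g s) : C2 R) (l, m).
Proof.
move=> df dg.
suff : (fun h => h^-1 *: (((f (h *: 1 + t), g (h *: 1 + t)) : C2 R) - (f t, g t)))
    @ (0 : C)^' --> ((l, m) : C2 R).
  by move=> H; split; [apply/cvg_ex; exists (l, m)|apply/cvg_lim].
have hf : (fun h => h^-1 *: (f (h *: 1 + t) - f t)) @ (0 : C)^' --> l.
  by have <- := derive_val (is_derive := df); have := ex_derive (is_derive := df).
have hg : (fun h => h^-1 *: (g (h *: 1 + t) - g t)) @ (0 : C)^' --> m.
  by have <- := derive_val (is_derive := dg); have := ex_derive (is_derive := dg).
exact: (cvg_pair hf hg).
Qed.

Lemma is_derive_pairP (V : normedModType C) (f : V -> C2 R) (t v : V) : derivable f t v ->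
  is_derive t v (fun s => (f s).1) ('D_v f t).1 /\
  is_derive t v (fun s => (f s).2) ('D_v f t).2.
Proof.
move=> df; have H : (fun h => h^-1 *: (f (h *: v + t) - f t)) @ (0 : C)^' --> 'D_v f t.
  exact: df.
split.
- have H1 : (fun h => h^-1 *: ((f (h *: v + t)).1 - (f t).1)) @ (0 : C)^' --> ('D_v f t).1.
    exact: (cvg_comp _ _ H (@cvg_fst C C (nbhs ('D_v f t).1) (nbhs ('D_v f t).2) _)).
  by split; [apply/cvg_ex; exists ('D_v f t).1|apply/cvg_lim].
- have H1 : (fun h => h^-1 *: ((f (h *: v + t)).2 - (f t).2)) @ (0 : C)^' --> ('D_v f t).2.
    exact: (cvg_comp _ _ H (@cvg_snd C C (nbhs ('D_v f t).1) (nbhs ('D_v f t).2) _)).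
  by split; [apply/cvg_ex; exists ('D_v f t).2|apply/cvg_lim].
Qed.

Lemma is_derive_near (f g : C -> C) (t l : C) : (\forall s \near t, f s = g s) ->
  is_derive t 1 f l -> is_derive t 1 g l.
Proof.
move=> fg df; apply/is_deriveCP => e e0.
have ft := nbhs_singleton fg.
have /nbhs_ncP[d d0 dP] := fg.
have [d' d'0 dP'] := (is_deriveCP f t l).1 df e e0.
exists (Num.min d d') => [|h]; first by rewrite lt_min d0.
rewrite lt_min => /andP[h1 h2]; rewrite -ft -dP; first exact: dP'.
by rewrite addrAC subrr add0r.
Qed.

Lemma psi_dom a z : (ph a @` dm a) z -> dm a (ps a z) /\ ph a (ps a z) = z.
Proof. by move=> [p ap <-]; rewrite phiK. Qed.

Lemma phi_cod a p : dm a p -> (ph a @` dm a) (ph a p).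
Proof. by move=> ap; exists p. Qed.

Lemma phi_inj a p q : dm a p -> dm a q -> ph a p = ph a q -> p = q.
Proof. by move=> ap aq /(congr1 (ps a)); rewrite !phiK. Qed.

Lemma overlap_near a b p : dm a p -> dm b p ->
  \forall z \near ph a p, (ph a @` (dm a `&` dm b)) z.
Proof.
move=> ap bp.
have ca : nbhs (ph a p) (ph a @` dm a).
  by apply: open_nbhs_nbhs; split; [exact: cod_open|exact: phi_cod].
have cb : nbhs (ph a p) (ps a @^-1` dm b).
  apply: (psi_continuous (phi_cod ap)); rewrite phiK//.
  by apply: open_nbhs_nbhs; split; [exact: dom_open|].
apply: filterS (filterI ca cb) => z [az bz]; have [h1 h2] := psi_dom az.
by exists (ps a z).
Qed.

Lemma overlap_phi a b p : dm a p -> dm b p -> (ph a @` (dm a `&` dm b)) (ph a p).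
Proof. by move=> ap bp; exists p. Qed.

Definition dtr a b p v : C2 R := 'D_v (transition a b) (ph a p).

Lemma transition_diff a b p : dm a p -> dm b p ->
  differentiable (transition a b) (ph a p).
Proof. by move=> ap bp; apply: transition_holomorphic; exact: overlap_phi. Qed.

Lemma dtrE a b p v : dm a p -> dm b p ->
  dtr a b p v = 'd (transition a b) (ph a p) v.
Proof. by move=> ap bp; rewrite /dtr deriveE//; exact: transition_diff. Qed.

Lemma dtr_near a b p (v : C2 R) (f : C2 R -> C2 R) : dm a p -> dm b p ->
  (\forall z \near ph a p, f z = transition a b z) -> 'D_v f (ph a p) = dtr a b p v.
Proof.
move=> ap bp H; rewrite /dtr.
by apply: near_eq_derive => //.
Qed.

Lemma transition_phi a b p : dm a p -> transition a b (ph a p) = ph b p.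
Proof. by move=> ap; rewrite /transition /= phiK. Qed.

Lemma dtr_id a p v : dm a p -> dtr a a p v = v.
Proof.
move=> ap; rewrite -(@dtr_near a a p v id ap ap) ?derive_id//.
apply: filterS (overlap_near ap ap) => z [q [aq _] <-].
by rewrite transition_phi.
Qed.

Lemma derive_compC2 (f g : C2 R -> C2 R) (z q v : C2 R) : f z = q ->
  differentiable f z -> differentiable g q -> 'D_v (g \o f) z = 'D_('D_v f z) g q.
Proof.
move=> <- df dg; have D := differentiable_comp df dg.
apply: (eq_trans (deriveE v D)); rewrite (deriveE v df).
apply: (eq_trans _ (esym (deriveE _ dg))).
exact (congr1 (fun L => L v) (diff_comp df dg)).
Qed.

Lemma dtr_comp a b c p v : dm a p -> dm b p -> dm c p ->
  dtr b c p (dtr a b p v) = dtr a c p v.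
Proof.
move=> ap bp cp.
have N : \forall z \near ph a p, (transition b c \o transition a b) z = transition a c z.
  apply: filterS (filterI (overlap_near ap bp) (overlap_near ap cp)).
  by move=> z [[q [aq bq] <-] _]; rewrite /= !transition_phi.
have E := @dtr_near a c p v _ ap cp N.
apply: (eq_trans _ E); apply: esym.
exact (derive_compC2 v (transition_phi b ap) (transition_diff ap bp) (transition_diff bp cp)).
Qed.

Lemma dtrD a b p v w (k : C) : dm a p -> dm b p ->
  dtr a b p (k *: v + w) = k *: dtr a b p v + dtr a b p w.
Proof.
by move=> ap bp; rewrite !dtrE//; move: ('d _ _) => L; rewrite linearP.
Qed.

(** Diagonal entries of the triangular derivative of a transition map: [tr1] is the cocycle of TN
    and [tr2] that of TF, so conj([tr1]) [tr2] governs E. *)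
Definition tr1 a b p : C := (dtr a b p (1, 0)).1.
Definition tr2 a b p : C := (dtr a b p (0, 1)).2.

Lemma dtr_y a b p (k : C) : dm a p -> dm b p ->
  dtr a b p (0, k) = (0, k * tr2 a b p).
Proof.
move=> ap bp; rewrite !dtrE//.
have E : ((0, k) : C2 R) = k *: (0, 1).
  by apply: c2P; rewrite ?fstZ ?sndZ /= ?mulr0 ?mulr1.
have := transition_foliated (overlap_phi ap bp).
rewrite -/(transition a b) -/(dtr a b p (0, 1)) /tr2 dtrE//.
move: ('d _ _) => L L1; rewrite E linearZ; apply: c2P; rewrite ?fstZ ?sndZ //.
by rewrite L1 mulr0.
Qed.

Opaque dtr.

Lemma dtr_x1 a b p v : dm a p -> dm b p -> (dtr a b p v).1 = v.1 * tr1 a b p.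
Proof.
move=> ap bp.
have E : v.1 *: ((1, 0) : C2 R) + (0, v.2) = v.
  by apply: c2P; rewrite ?fstD ?sndD ?fstZ ?sndZ /= ?mulr1 ?mulr0 ?addr0 ?add0r.
have D := dtrD (1, 0) (0, v.2) v.1 ap bp.
have Y := dtr_y v.2 ap bp.
rewrite -[X in dtr a b p X]E D Y /tr1; move: (dtr a b p (1, 0)) => w.
by rewrite fstD (fstZ v.1 w) addr0.
Qed.

Lemma tr2_neq0 a b p : dm a p -> dm b p -> tr2 a b p != 0.
Proof.
move=> ap bp; apply/eqP => E; have := @dtr_comp a b a p (0, 1) ap bp ap.
rewrite dtr_id// dtr_y// E mul1r dtr_y// mul0r => /(congr1 snd) /= /esym/eqP.
by rewrite oner_eq0.
Qed.

Lemma tr1_neq0 a b p : dm a p -> dm b p -> tr1 a b p != 0.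
Proof.
move=> ap bp; apply/eqP => E; have := @dtr_comp a b a p (1, 0) ap bp ap.
rewrite dtr_id// => /(congr1 fst); rewrite dtr_x1// dtr_x1// E mulr0 mul0r /=.
by move=> /esym/eqP; rewrite oner_eq0.
Qed.

Definition tangent_of a p v : chart F -> C2 R := fun b => dtr a b p v.

Lemma tangent_ofP a p v : dm a p -> tangent p (tangent_of a p v).
Proof. by move=> ap b c bp cp; rewrite -[RHS]/(dtr b c p _) dtr_comp. Qed.

Lemma tangentF_of a p (k : C) : dm a p -> tangentF p (tangent_of a p (0, k)).
Proof.
by move=> ap; split=> [|b bp]; [exact: tangent_ofP|rewrite /tangent_of dtr_y].
Qed.

(** A plaque of one chart stays in a plaque of the other: along it the first coordinate of the
    transition has zero derivative. *)
Lemma plaque_near a b p : dm a p -> dm b p ->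
  \forall y \near (ph a p).2, dm a (ps a ((ph a p).1, y)) /\
    dm b (ps a ((ph a p).1, y)) /\ (ph b (ps a ((ph a p).1, y))).1 = (ph b p).1 /\
    ph a (ps a ((ph a p).1, y)) = ((ph a p).1, y).
Proof.
move=> ap bp; have /nbhs_nc2P[d d0 dP] := overlap_near ap bp.
apply/nbhs_ncP; exists d => // y yd.
have in_ov y' : nc (y' - (ph a p).2) < d -> (ph a @` (dm a `&` dm b)) ((ph a p).1, y').
  by move=> y'd; apply: dP => //=; rewrite subrr nc0.
have [q [aq bq] qE] := in_ov y yd.
rewrite -qE phiK//; split=> //; split=> //; split=> //.
have := @zero_derive_eq R (fun y => (transition a b ((ph a p).1, y)).1) (ph a p).2 (y - (ph a p).2).
rewrite subrKC -surjective_pairing -qE !transition_phi//; apply=> s s01.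
have sd : nc ((ph a p).2 + s%:C * (y - (ph a p).2) - (ph a p).2) < d.
  rewrite addrAC subrr add0r ncM nc_real ger0_norm; last by case/andP: s01.
  apply: le_lt_trans yd; apply: ler_piMl; first exact: nc_ge0.
  by case/andP: s01.
have ov := in_ov _ sd.
have [_ _ D _] := diff_slices (transition_holomorphic ov).
by have := D; rewrite transition_foliated.
Qed.

End Charts.

(** * The leaf topology in charts *)

Section Leaves.
Variables (R : realType) (X : topologicalType) (F : foliatedSurface R X).
Local Notation C := (cplx R).
Local Notation ph := (@phi R X F).
Local Notation ps := (@psi R X F).
Local Notation dm := (@dom R X F).
Implicit Types (a b c : chart F) (p q : X) (z v w : C2 R).

Lemma leafwise_openE (S : set X) : @open (leafwise F) S = leaf_open F S.
Proof. by []. Qed.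

Lemma open_leaf_open (S : set X) : open S -> @open (leafwise F) S.
Proof.
move=> oS; change (leaf_open F S) => p a Sp ap.
have : nbhs (ph a p) (ps a @^-1` S).
  by apply: (psi_continuous (phi_cod ap)); rewrite phiK//; exact: open_nbhs_nbhs.
move=> /nbhs_nc2P[d d0 dP]; apply/nbhs_ncP; exists d => // y yd.
by apply: dP => //=; rewrite subrr nc0.
Qed.

Lemma open_chart a (W : set (C2 R)) : open W -> open (dm a `&` ph a @^-1` W).
Proof.
move=> oW; rewrite openE => p [ap Wp]; rewrite /interior.
apply: filterI; first exact: open_nbhs_nbhs (conj (dom_open a) ap).
by apply: (phi_continuous ap); exact: open_nbhs_nbhs.
Qed.

Lemma open_snd (O : set C) : open O -> open [set z : C2 R | O z.2].
Proof. by move=> oO; apply: open_comp => // z _; exact: cvg_snd. Qed.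

Lemma open_fst (O : set C) : open O -> open [set z : C2 R | O z.1].
Proof. by move=> oO; apply: open_comp => // z _; exact: cvg_fst. Qed.

Lemma plaque_leaf_open a (xi : C) (O : set C) : open O ->
  @open (leafwise F) [set q | [/\ dm a q, (ph a q).1 = xi & O (ph a q).2]].
Proof.
move=> oO; rewrite leafwise_openE => p b [ap <- Op] bp.
have h1 := plaque_near bp ap.
have h2 : leaf_open F _ := open_leaf_open (open_chart a (open_snd oO)).
have {}h2 := h2 p b (conj ap Op) bp.
apply: filterS (filterI h1 h2) => y [[_ [aq [q1 _]]] [_ Oq]].
by split.
Qed.

Lemma leafwise_chart (f : C -> X) (y0 : C) a :
  {for y0, continuous (f : C -> leafwise F)} -> dm a (f y0) ->
  exists2 d : R, 0 < d & forall y, nc (y - y0) < d ->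
    dm a (f y) /\ (ph a (f y)).1 = (ph a (f y0)).1.
Proof.
move=> cf ay; have o := @plaque_leaf_open a (ph a (f y0)).1 setT openT.
have : nbhs y0 (f @^-1` [set q | [/\ dm a q, (ph a q).1 = (ph a (f y0)).1 & setT (ph a q).2]]).
  by apply: cf; apply: open_nbhs_nbhs; split.
by move=> /nbhs_ncP[d d0 dP]; exists d => // y /dP[].
Qed.

(** Read in a chart, a covering of a leaf is locally injective with inverse [G], the inverse on the
    sheet of y0. The continuity of [G] expresses that the covering is open on the sheet for the leaf
    topology. With [derive_injective_neq0], the leafwise derivative cannot vanish. *)
Lemma covering_chart_inverse (f : C -> X) (L : set X) (y0 : C) a :
  universal_covering F f L -> dm a (f y0) ->
  exists G : C -> C, exists2 d : R, 0 < d & forall y, nc (y - y0) < d ->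
    [/\ dm a (f y) /\ (ph a (f y)).1 = (ph a (f y0)).1, G (ph a (f y)).2 = y,
        {for (ph a (f y)).2, continuous G} &
        \forall h \near (ph a (f y)).2, (ph a (f (G h))).2 = h].
Proof.
move=> [[cf rf cov] hf] ay0.
have Lf y : L (f y) by rewrite -rf; exists y.
have [P [oP Py PL [I [W [oW tW fW WP]]]]] := cov _ (Lf y0).
have : (f @^-1` P) y0 by [].
rewrite fW => -[i _ Wy0].
have [[Wf Winj Wsurj] fo] := WP i.
have [d d0 dP] := leafwise_chart (cf y0) ay0.
have /nbhs_ncP[d' d'0 dP'] : nbhs y0 (W i) by exact: open_nbhs_nbhs.
set xi := (ph a (f y0)).1 in dP *.
pose G h : C := get [set w | W i w /\ f w = ps a (xi, h)].
have Ew y : nc (y - y0) < d -> f y = ps a (xi, (ph a (f y)).2).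
  by move=> /dP[ay <-]; rewrite -surjective_pairing phiK.
have GP h : P (ps a (xi, h)) -> W i (G h) /\ f (G h) = ps a (xi, h).
  move=> /Wsurj[w Ww fw].
  have : [set w | W i w /\ f w = ps a (xi, h)] w by [].
  exact: getI.
have Gf y : nc (y - y0) < d -> W i y -> G (ph a (f y)).2 = y.
  move=> yd Wy; have [] := GP (ph a (f y)).2.
    by rewrite -Ew//; exact: Wf.
  by rewrite -Ew// => WG fG; apply: Winj => //; rewrite inE.
exists G, (Num.min d d'); first by rewrite lt_min d0.
move=> y; rewrite lt_min => /andP[yd /dP' Wy].
have [ay y1] := dP _ yd.
have nearP (O : set C) : open O -> O `<=` W i -> O y ->
    \forall h \near (ph a (f y)).2, (f @` O) (ps a (xi, h)).
  by move=> oO OW Oy; have := (fo O oO OW : leaf_open F _) (f y) a (ex_intro2 _ _ y Oy erefl) ay; rewrite y1.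
split=> //; first exact: Gf.
- move=> A; rewrite Gf// => yA.
  have : exists2 B, open_nbhs y B & B `<=` A by rewrite nbhsE in yA.
  move=> [B [oB By] BA].
  have N := nearP _ (openI oB (oW i)) (@subIsetr C B (W i)) (conj By Wy).
  apply: filterS N => h [w [Bw Ww] fw]; apply: BA.
  have [|WG fG] := GP h; first by rewrite -fw; exact: Wf.
  by have <- : w = G h by apply: Winj; rewrite ?inE// fw fG.
- have h1 := nearP (W i) (oW i) (@subset_refl _ _) Wy.
  have h2 := plaque_near ay ay.
  apply: filterS (filterI h1 h2) => h [[w Ww fw] [aq [_ [_ E]]]].
  have [|WG fG] := GP h; first by rewrite -fw; exact: Wf.
  by rewrite fG -y1 E.
Qed.

End Leaves.

Section LeafCoverings.
Variables (R : realType) (X : topologicalType) (F : foliatedSurface R X).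
Local Notation C := (cplx R).
Local Notation ph := (@phi R X F).
Local Notation dm := (@dom R X F).
Implicit Types (a b c : chart F) (p q : X) (z v w : C2 R).

Lemma leaf_refl p : leaf F p p.
Proof. exact: (@connected_component_refl (leafwise F) setT p). Qed.

Lemma leaf_eq p q : leaf F p q -> leaf F q = leaf F p.
Proof. by move=> h; apply/esym; exact: (@same_connected_component (leafwise F) setT p q). Qed.

Lemma covering_leaf_eq (f g : C -> X) p q y y' : universal_covering F f (leaf F p) ->
  universal_covering F g (leaf F q) -> f y = g y' -> leaf F p = leaf F q.
Proof.
move=> [[_ rf _] _] [[_ rg _] _] E.
have fp : leaf F p (f y) by rewrite -rf; exists y.
have gq : leaf F q (g y') by rewrite -rg; exists y'.
by rewrite -(leaf_eq fp) -(leaf_eq gq) E.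
Qed.

Lemma covering_derivable (f : C -> X) (L : set X) (y0 : C) a :
  universal_covering F f L -> dm a (f y0) ->
  derivable (fun y => (ph a (f y)).2) y0 1 /\ 'D_1 (fun y => (ph a (f y)).2) y0 != 0.
Proof.
move=> uf ay; have [_ df] := uf; split; first exact: df.
have [G [d d0 GP]] := covering_chart_inverse uf ay.
apply: (@derive_injective_neq0 R _ G y0 d d0) => y /GP[[ay' _] G1 G2 G3].
- exact: df.
- exact: G1.
- exact: G2.
- exact: G3.
Qed.

(** Lifting provides a homeomorphism h between the two coverings. Locally h is a chart inverse of
    [f1] after [f2], hence holomorphic, and an automorphism of the plane is affine. *)
Lemma covering_affine (f1 f2 : C -> X) (L : set X) (y1 y2 : C) :
  universal_covering F f1 L -> universal_covering F f2 L -> f1 y1 = f2 y2 ->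
  exists k m : C, [/\ k != 0, forall y, f2 y = f1 (k * y + m) & k * y2 + m = y1].
Proof.
move=> u1 u2 E; have [c1 d1] := u1; have [c2 d2] := u2.
have [h [k [[ch ck] hK kH fh hy]]] := covering_homeomorphism c1 c2 E.
have dh y : derivable h y 1.
  have [a ay] := dom_cover F (f2 y).
  have ay1 : dm a (f1 (h y)) by rewrite (fh y).
  have [G [d d0 GP]] := covering_chart_inverse u1 ay1.
  have [e1 n1] := covering_derivable u1 ay1.
  have dy : nc (h y - h y) < d by rewrite subrr nc0.
  have [_ G1 G2 G3] := GP _ dy.
  have dG := is_derive_inverseC (derivableP e1) n1 G1 G2 G3.
  have E1 : (ph a (f1 (h y))).2 = (ph a (f2 y)).2 by rewrite fh.
  have D2 := derivableP (d2 y a ay).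
  have dG' : is_derive (ph a (f2 y)).2 1 G ('D_1 (fun y => (ph a (f1 y)).2) (h y))^-1.
    by rewrite -E1; exact: dG.
  have D := is_derive_compC dG' D2.
  apply: ex_derive; apply: (is_derive_near _ D).
  have /continuous_ncP /(_ d d0) [e e0 eP] := ch y.
  by apply/nbhs_ncP; exists e => // s /eP /GP[_ Gs _ _]; rewrite /= -fh.
have [m m0 hE] := automorphism_affine hK kH dh ck.
by exists m, (h 0); split=> [//|y|]; rewrite -hE// fh.
Qed.

Lemma covering_comp (T : topologicalType) (f : C -> T) (L : set T) (h k : C -> C) :
  covering_map f L -> continuous h -> continuous k -> cancel h k -> cancel k h ->
  covering_map (f \o h) L.
Proof.
move=> [cf rf cov] ch ck hK kH; split.
- by move=> y; apply: continuous_comp; [exact: ch|exact: cf].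
- rewrite -rf; apply/seteqP; split=> q [y _ <-]; first by exists (h y).
  by exists (k y) => //=; rewrite kH.
move=> q Lq; have [P [oP Pq PL [I [W [oW tW fW WP]]]]] := cov q Lq.
exists P; split=> //; exists I, (fun i => h @^-1` W i); split.
- by move=> i; apply: open_comp => // y _; exact: ch.
- move=> i j _ _ [y [Wi Wj]]; apply: tW => //; by exists (h y).
- apply/seteqP; split=> y.
    move=> Py; have : (f @^-1` P) (h y) by [].
    by rewrite fW => -[i _ Wi]; exists i.
  by move=> [i _ Wi]; have : (f @^-1` P) (h y) by rewrite fW; exists i.
move=> i; have [[W1 W2 W3] Wo] := WP i; split.
  split.
  - by move=> y Wy; exact: W1.
  - move=> y y'; rewrite !inE => Wy Wy' E.
    by apply: (can_inj hK); apply: W2; rewrite ?inE.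
  - by move=> p /W3[w Ww <-]; exists (k w); rewrite /= kH.
move=> B oB BW; have -> : (f \o h) @` B = f @` (k @^-1` B).
  apply/seteqP; split=> p [y By <-]; first by exists (h y); rewrite //= hK.
  by exists (k y); rewrite //= kH.
apply: Wo; first by apply: open_comp => // y _; exact: ck.
by move=> y /BW; rewrite /= kH.
Qed.

Lemma universal_covering_affine (f : C -> X) (L : set X) (k m : C) : k != 0 ->
  universal_covering F f L -> universal_covering F (fun y => f (m + y * k)) L.
Proof.
move=> k0 [cf df].
have dk (y : C) : is_derive y 1 (fun y : C => m + y * k) k.
  apply/is_deriveCP => e e0; exists 1 => // h _.
  have -> : m + (y + h) * k - (m + y * k) - h * k = 0 by ring.
  by rewrite nc0 mulr_ge0 ?nc_ge0// ltW.
split.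
  apply: (@covering_comp (leafwise F) f L (fun y => m + y * k) (fun y => (y - m) / k) cf).
  - by move=> y; exact: (continuous_derivable (ex_derive (is_derive := dk y))).
  - apply: continuousCM; last exact: continuousC_cst.
    by apply: continuousCB; [move=> y; exact: cvg_id|exact: continuousC_cst].
  - by move=> y; rewrite addrAC subrr add0r mulfK.
  - by move=> y; rewrite divfK// subrKC.
move=> y a ay; have D := @is_derive_compC R (fun y => (ph a (f y)).2) (fun y : C => m + y * k) y _ _
  (derivableP (df _ a ay)) (dk y).
exact: (ex_derive (is_derive := D)).
Qed.

End LeafCoverings.

(** * Construction of elements of class C *)

Lemma diskP (R : realType) (x : cplx R) : disk x <-> nc x < 1.
Proof. by rewrite /disk /= normE ltcR. Qed.

Section Transversal.
Variables (R : realType) (X : topologicalType) (F : foliatedSurface R X).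
Local Notation C := (cplx R).
Local Notation ph := (@phi R X F).
Local Notation ps := (@psi R X F).
Local Notation dm := (@dom R X F).
Variables (a : chart F) (z0 : C2 R) (r : R).
Hypotheses (r0 : 0 < r)
  (box : forall xi : C, nc (xi - z0.1) < r -> (ph a @` dm a) (xi, z0.2)).

Definition tline (x : C) : C := z0.1 + x * r%:C.
(** The transversal y = const of the chart [a], scaled to the unit disk. The trivialization [tfield]
    is d/dy of this chart, read in every other chart. *)
Definition tdisk (x : C) : X := ps a (tline x, z0.2).
Definition tfield (x : C) (b : chart F) : C2 R := dtr a b (tdisk x) (0, 1).

Lemma tline_derive (x : C) : is_derive x 1 tline r%:C.
Proof.
apply/is_deriveCP => e e0; exists 1 => // h _.
have -> : tline (x + h) - tline x - h * r%:C = 0 by rewrite /tline; ring.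
by rewrite nc0 mulr_ge0 ?nc_ge0// ltW.
Qed.

Lemma tline_continuous : continuous tline.
Proof. by move=> x; exact: (continuous_derivable (ex_derive (is_derive := tline_derive x))). Qed.

Lemma tdisk_in (x : C) : disk x -> dm a (tdisk x) /\ ph a (tdisk x) = (tline x, z0.2).
Proof.
move=> /diskP x1; have r1 := r0; apply: psi_dom; apply: box; rewrite /tline addrAC subrr add0r.
by rewrite ncM nc_real gtr0_norm// -ltr_pdivlMr// divff// gt_eqF.
Qed.

Lemma open_disk : open (@disk R).
Proof.
have -> : @disk R = [set x | nc x < 1] by apply/seteqP; split=> x /diskP.
rewrite openE => x x1; apply/nbhs_ncP; exists (1 - nc x); first by rewrite subr_gt0.
by move=> y yx; rewrite /=; have := ncD (y - x) x; rewrite subrK; lra.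
Qed.

Lemma disk_near (x : C) : disk x -> \forall s \near x, disk s.
Proof. by move=> dx; apply: open_nbhs_nbhs; split=> //; exact: open_disk. Qed.

Lemma tdisk_derive (x : C) b : disk x -> dm b (tdisk x) ->
  is_derive x 1 (ph b \o tdisk)
    ((dtr a b (tdisk x) (1, 0)).1 * r%:C, (dtr a b (tdisk x) (1, 0)).2 * r%:C).
Proof.
move=> dx bx; have [ax xE] := tdisk_in dx.
have := diff_slices (transition_diff ax bx); rewrite xE => -[D1 D2 _ _].
have T1 := @is_derive_compC R _ tline x _ _ D1 (tline_derive x).
have T2 := @is_derive_compC R _ tline x _ _ D2 (tline_derive x).
have := is_derive_pair T1 T2.
have -> : (fun s => ((((fun x => (transition a b (x, z0.2)).1) \o tline) s),
  (((fun x => (transition a b (x, z0.2)).2) \o tline) s)) : C2 R) = ph b \o tdisk.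
  by apply/funext => s; rewrite /= -surjective_pairing.
by rewrite /dtr xE.
Qed.

Lemma tdisk_transverse : transverse_disk F tdisk.
Proof.
split.
- move=> x dx; apply: (@continuous_comp C (C2 R) X (fun x => (tline x, z0.2)) (ps a)).
    exact: (continuous_pair_C2 (@tline_continuous x) (@continuousC_cst R C z0.2 x)).
  by have [ax xE] := tdisk_in dx; apply: psi_continuous; rewrite -xE; exact: phi_cod.
- move=> x b dx bx; have D := tdisk_derive dx bx; have [ax _] := tdisk_in dx.
  split; first exact: (ex_derive (is_derive := D)).
  rewrite (derive_val (is_derive := D)) /= mulf_neq0//.
    exact: (tr1_neq0 ax bx).
  by rewrite -nc_eq0 nc_real gtr0_norm// gt_eqF.
- move=> x x'; rewrite !inE => dx dx' E.
  have [_ e1] := tdisk_in dx; have [_ e2] := tdisk_in dx'.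
  move: e2; rewrite -E e1 /tline => -[] /addrI /mulIf; apply.
  by rewrite -nc_eq0 nc_real gtr0_norm// gt_eqF.
- move=> B oB BD.
  exists (dm a `&` ph a @^-1` [set z | B ((z.1 - z0.1) / r%:C)]).
    apply: open_chart; apply: (@open_comp (C2 R) C (fun z => (z.1 - z0.1) / r%:C)) => // z _.
    apply: (@cvgM C (C2 R) (nbhs z)); last exact: cvg_cst.
    by apply: (@cvgB C C (C2 R) (nbhs z)); [exact: cvg_fst|exact: cvg_cst].
  have rK x : (tline x - z0.1) / r%:C = x.
    rewrite /tline addrAC subrr add0r mulfK//.
    by rewrite -nc_eq0 nc_real gtr0_norm// gt_eqF.
  apply/seteqP; split=> q.
    move=> [x Bx <-]; have [ax xE] := tdisk_in (BD x Bx).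
    split; last by exists x => //; exact: BD.
    by split=> //=; rewrite xE /= rK.
  move=> [[aq /= Bq] [x dx xq]]; exists x => //; have [ax xE] := tdisk_in dx.
  by move: Bq; rewrite -xq xE /= rK.
Qed.

(** In another chart the field is the y-derivative of the transition map along the disk; its
    holomorphy in x is [derive_slice_derivable]. *)
Lemma tfield_trivialization : trivialization tdisk tfield.
Proof.
move=> x dx; have [ax xE] := tdisk_in dx; split; first exact: tangentF_of.
move=> b bx; rewrite /tfield; split.
  rewrite dtr_y// mul1r; apply/eqP => /(congr1 snd) /= E.
  by have := tr2_neq0 ax bx; rewrite E eqxx.
pose g z := (transition a b z).2.
pose G (xi : C) := 'D_1 (fun y : C => g (xi, y)) z0.2.
have /nbhs_nc2P[d d0 dP] := overlap_near ax bx.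
have H z : nc (z.1 - (tline x)) < d -> nc (z.2 - z0.2) < d ->
    [/\ {for z, continuous g}, derivable (fun x : C => g (x, z.2)) z.1 1 &
        derivable (fun y : C => g (z.1, y)) z.2 1].
  move=> z1 z2; have ov : (ph a @` (dm a `&` dm b)) z by apply: dP; rewrite xE.
  have D := transition_holomorphic ov; have [_ D2 _ D4] := diff_slices D.
  split; last 2 first.
  - exact: (ex_derive (is_derive := D2)).
  - exact: (ex_derive (is_derive := D4)).
  apply: (@continuous_comp (C2 R) (C2 R) C (transition a b) snd); last exact: cvg_snd.
  exact: (differentiable_continuous D).
have dG := @derive_slice_derivable R g (tline x, z0.2) d d0 H.
have DG := @is_derive_compC R G tline x _ _ (derivableP dG) (tline_derive x).
have D := is_derive_pair (is_derive_cst (0 : C) x 1) DG.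
apply: (near_eq_derivable (f := fun s => ((0, (G \o tline) s) : C2 R))); last first.
  exact: (ex_derive (is_derive := D)).
have N : \forall s \near x, dm b (tdisk s).
  have [c1 _ _ _] := tdisk_transverse.
  by apply: (c1 x dx); apply: open_nbhs_nbhs; split=> //; exact: dom_open.
apply: filterS (filterI N (disk_near dx)) => s [bs ds].
have [as_ sE] := tdisk_in ds.
rewrite dtr_y// mul1r; apply: c2P => //=.
have := diff_slices (transition_diff as_ bs); rewrite sE => -[_ _ _ D4].
by rewrite /G /tr2 /dtr sE; have := derive_val (is_derive := D4).
Qed.

Hypothesis leaves_parabolic : forall p : X, parabolic F (leaf F p).

(** Parabolicity gives some covering of the leaf. Precomposition with y -> y0 + y/D, where D is its
    derivative at a preimage y0 of the base point, normalises both point and velocity. *)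
Lemma tcover (x : C) : disk x -> exists f : C -> X,
  [/\ universal_covering F f (leaf F (tdisk x)), f 0 = tdisk x &
      is_derive (0 : C) 1 (fun y => (ph a (f y)).2) 1].
Proof.
move=> dx; have [ax xE] := tdisk_in dx.
have [f uf] := leaves_parabolic (tdisk x); have [[_ rf _] _] := uf.
have [y0 _ fy] : range f (tdisk x) by rewrite rf; exact: leaf_refl.
have ay : dm a (f y0) by rewrite fy.
have [df n0] := covering_derivable uf ay.
pose D : C := 'D_1 (fun y : C => (ph a (f y)).2) y0; have D0 : D != 0 := n0.
exists (fun y => f (y0 + y * D^-1)); split.
- by apply: universal_covering_affine uf; rewrite invr_eq0.
- by rewrite mul0r addr0.
have aff : is_derive (0 : C) 1 (fun y : C => y0 + y * D^-1) D^-1.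
  apply/is_deriveCP => e e0; exists 1 => // h _.
  have -> : y0 + (0 + h) * D^-1 - (y0 + 0 * D^-1) - h * D^-1 = 0 by ring.
  by rewrite nc0 mulr_ge0 ?nc_ge0// ltW.
have df' : is_derive (y0 + 0 * D^-1) 1 (fun y => (ph a (f y)).2) D.
  by rewrite mul0r addr0; exact: (derivableP df).
have := @is_derive_compC R (fun y => (ph a (f y)).2) (fun y : C => y0 + y * D^-1) 0 _ _ df' aff.
by rewrite divff.
Qed.

(** The coverings are chosen independently for each x. Their smooth dependence on x is not
    constructed here: it is the standing assumption on the class. *)
Lemma class_C_transversal : exists Phi, class_C F Phi /\ Phi (0, 0) = tdisk 0.
Proof.
have cov (x : C) : {f : C -> X | disk x -> [/\ universal_covering F f (leaf F (tdisk x)), f 0 = tdisk x &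
      is_derive (0 : C) 1 (fun y => (ph a (f y)).2) 1]}.
  (* Outside the disk an arbitrary constant map is taken. *)
  by apply: cid; have [/tcover[f]|] := pselect (disk x); [exists f|exists (fun=> tdisk x)].
pose Phi (z : C2 R) := sval (cov z.1) z.2.
have PhiP x (dx : disk x) := svalP (cov x) dx.
have d0 : @disk R 0 by apply/diskP; rewrite nc0.
exists Phi; split; last by have [_ h _] := PhiP 0 d0.
exists tdisk, tfield; split; [exact: tdisk_transverse|exact: tfield_trivialization|].
move=> x dx; have [uf f0 df] := PhiP x dx.
split; [exact: uf|exact: f0|move=> b bx].
have [ax xE] := tdisk_in dx.
have af : dm a (sval (cov x) 0) by rewrite f0.
have [[cf _ _] _] := uf.
have [d e0 dP] := leafwise_chart (cf 0) af.
pose g y := (ph a (sval (cov x) y)).2.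
have g0 : g 0 = z0.2 by rewrite /g f0 xE.
have := diff_slices (transition_diff ax bx); rewrite xE /= => -[_ _ D3 D4].
have D3' : is_derive (g 0) 1 (fun y => (transition a b (tline x, y)).1) (dtr a b (tdisk x) (0, 1)).1.
  by rewrite g0 /dtr xE.
have D4' : is_derive (g 0) 1 (fun y => (transition a b (tline x, y)).2) (dtr a b (tdisk x) (0, 1)).2.
  by rewrite g0 /dtr xE.
have E3 := @is_derive_compC R _ g 0 _ _ D3' df.
have E4 := @is_derive_compC R _ g 0 _ _ D4' df.
have E := is_derive_pair E3 E4.
have -> : tfield x b = ((dtr a b (tdisk x) (0, 1)).1 * 1, (dtr a b (tdisk x) (0, 1)).2 * 1).
  by rewrite !mulr1 -surjective_pairing.
apply: (eq_trans _ (derive_val (is_derive := E))).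
apply: near_eq_derive; apply/nbhs_ncP; exists d => // y yd.
rewrite -surjective_pairing /Phi /=.
have [ay y1] := dP y yd.
rewrite -[in LHS](phiK ay) -/(transition a b (ph a _)) /g.
by rewrite {1}[ph a _]surjective_pairing y1 f0 xE.
Qed.

End Transversal.

Lemma class_C_exists (R : realType) (X : topologicalType) (F : foliatedSurface R X) (q : X) :
  (forall p : X, parabolic F (leaf F p)) -> exists Phi, class_C F Phi /\ Phi (0, 0) = q.
Proof.
move=> lp; have [a aq] := dom_cover F q.
have /nbhs_nc2P[d d0 dP] := overlap_near aq aq.
have [|Phi [cP P0]] := @class_C_transversal R X F a (phi a q) d d0 _ lp.
  move=> xi xid; have [|p [ap _] <-] := dP (xi, (phi a q).2) xid; last by exists p.
  by rewrite subrr nc0.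
by exists Phi; split=> //; rewrite P0 /tdisk /tline mul0r addr0 -surjective_pairing phiK.
Qed.

(** * Cylinders of class C *)

Section RealDerivatives.
Variable R : realType.
Local Notation C := (cplx R).
Implicit Types (f : C2 R -> C) (z v : C2 R) (O : set (C2 R)).

(** The operator B = 2 d/dxbar; keeping the factor 2 avoids denominators. *)
Definition dxbar2 f z : C := real_derive (e1 R) f z + 'i * real_derive (e2 R) f z.

Lemma class_Ck1_rder O f z v : O z -> class_Ck 1 O f -> rder v f z (real_derive v f z).
Proof. by move=> Oz [_ H]; have [h _] := H v; exact: (real_deriveP (h z Oz)). Qed.

Lemma class_Ck_rderive k O f v : class_Ck k.+1 O f -> class_Ck k O (real_derive v f).
Proof. by move=> [_ H]; have [] := H v. Qed.

Lemma rderE v f z l : rder v f z l -> real_derive v f z = l.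
Proof. by move=> /rder_val[]. Qed.

Lemma rlin_kernel f z : real_derive (e4 R) f z = 'i * real_derive (e3 R) f z ->
  real_derive (e3 R) f z != 0 ->
  rlin f z (1, - real_derive (e1 R) f z / real_derive (e3 R) f z) = 0.
Proof.
rewrite /rlin => ->.
move: (real_derive (e1 R) f z) (real_derive (e2 R) f z) (real_derive (e3 R) f z).
move=> A E B B0; have H := ReIm (- A / B).
pose s : C := (complex.Re (- A / B))%:C; pose t : C := (complex.Im (- A / B))%:C.
have H' : (s + 'i * t) * B = - A by rewrite -H divfK.
change (1 * A + 0 * E + s * B + t * ('i * B) = 0 :> C).
move: H'; clearbody s t => H'.
have -> : 1 * A + 0 * E + s * B + t * ('i * B) = A + (s + 'i * t) * B by ring.
by rewrite H' subrr.
Qed.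

Lemma open_cylinder : open (@cylinder R).
Proof. exact: (open_fst (@open_disk R)). Qed.

End RealDerivatives.

Section Cylinder.
Variables (R : realType) (X : topologicalType) (F : foliatedSurface R X).
Local Notation C := (cplx R).
Local Notation ph := (@phi R X F).
Local Notation dm := (@dom R X F).
Variable Phi : C2 R -> X.
Hypotheses (cP : class_C F Phi) (sm : smooth_immersion F Phi).
Implicit Types (a b : chart F) (z v w : C2 R).

Definition cyl a : set (C2 R) := @cylinder R `&` Phi @^-1` dm a.
(** [cu] and [cf] are the functions u and f of the overview, in the chart [a]. *)
Definition cu a z : C := (ph a (Phi z)).1.
Definition cf a z : C := (ph a (Phi z)).2.

Lemma cylinder_continuous z : cylinder z -> {for z, continuous Phi}.
Proof. by case: sm => h _ _; exact: h. Qed.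

Lemma cyl_open a : open (cyl a).
Proof.
rewrite openE => z [cz az]; rewrite /interior; apply: filterI.
  by apply: open_nbhs_nbhs; split=> //; exact: open_cylinder.
by apply: (cylinder_continuous cz); apply: open_nbhs_nbhs; split=> //; exact: dom_open.
Qed.

Lemma cyl_near a z : cyl a z -> \forall w \near z, cyl a w.
Proof. by move=> az; apply: open_nbhs_nbhs; split=> //; exact: cyl_open. Qed.

Lemma cyl_chart z : cylinder z -> exists a, cyl a z.
Proof. by move=> cz; have [a az] := dom_cover F (Phi z); exists a. Qed.

Lemma cu_smooth k a : class_Ck k (cyl a) (cu a).
Proof. by case: sm => _ /(_ a)[h _] _; exact: h. Qed.

Lemma cf_smooth k a : class_Ck k (cyl a) (cf a).
Proof. by case: sm => _ /(_ a)[_ h] _; exact: h. Qed.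

Lemma cylinder_covering (x : C) : disk x ->
  exists p, universal_covering F (fun y => Phi (x, y)) (leaf F p).
Proof. by move=> dx; case: cP => p [t [_ _ /(_ x dx)[h _ _]]]; exists (p x). Qed.

Lemma cu_e34 a z : cyl a z ->
  rder (e3 R) (cu a) z 0 /\ rder (e4 R) (cu a) z 0.
Proof.
move=> [cz az]; have [p [[cf _ _] _]] := cylinder_covering cz.
have az' : dm a (Phi (z.1, z.2)) by rewrite -surjective_pairing.
have [d d0 dP] := leafwise_chart (cf z.2) az'.
suff h : is_derive (z.2 : C) 1 (fun y : C => cu a (z.1, y)) (0 : C).
  by have [h3] := slice_y_rder h; rewrite mulr0.
apply: (@is_derive_near R (fun=> cu a z)).
apply/nbhs_ncP; exists d => // y /dP[_]; rewrite /cu => ->.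
by rewrite -surjective_pairing.
Qed.

Lemma cf_slice a z : cyl a z ->
  is_derive z.2 1 (fun y => cf a (z.1, y)) (real_derive (e3 R) (cf a) z) /\
  real_derive (e3 R) (cf a) z != 0.
Proof.
move=> [cz az]; have [p up] := cylinder_covering cz.
have az' : dm a (Phi (z.1, z.2)) by rewrite -surjective_pairing.
have [df n0] := covering_derivable up az'.
have D := derivableP df; have [D3 _] := @slice_y_rder R (cf a) z _ D.
by rewrite (rderE D3); split; [exact: D|exact: n0].
Qed.

Lemma cf_e4 a z : cyl a z ->
  real_derive (e4 R) (cf a) z = 'i * real_derive (e3 R) (cf a) z.
Proof.
by move=> az; have [D _] := cf_slice az; have [_ D4] := @slice_y_rder R (cf a) z _ D; exact: rderE.
Qed.

Definition tr12 a b p : C := (dtr a b p (1, 0)).2.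

Lemma cyl_transition a b z v : cyl a z -> cyl b z ->
  real_derive v (cu b) z = real_derive v (cu a) z * tr1 a b (Phi z) /\
  real_derive v (cf b) z = real_derive v (cu a) z * tr12 a b (Phi z) +
    real_derive v (cf a) z * tr2 a b (Phi z).
Proof.
move=> az bz; have [_ ap] := az; have [_ bp] := bz.
have ru := class_Ck1_rder v az (cu_smooth 1 a).
have rf := class_Ck1_rder v az (cf_smooth 1 a).
set l := real_derive v (cu a) z in ru *; set m := real_derive v (cf a) z in rf *.
have E0 : z + (0%:C : C) *: v = z by rewrite scale0r addr0.
have D : differentiable (transition a b)
    (cu a (z + (0%:C : C) *: v), cf a (z + (0%:C : C) *: v)).
  by rewrite E0 -surjective_pairing; exact: transition_diff.
have [] := @cder_diff_comp R _ _ _ 0 (l, m) D ru rf.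
rewrite E0 -surjective_pairing -/(dtr a b (Phi z) (l, m)).
have -> : dtr a b (Phi z) (l, m) = (l * tr1 a b (Phi z), l * tr12 a b (Phi z) + m * tr2 a b (Phi z)).
  have E : l *: ((1, 0) : C2 R) + (0, m) = (l, m).
    by apply: c2P; rewrite ?fstD ?sndD ?fstZ ?sndZ /= ?mulr1 ?mulr0 ?addr0 ?add0r.
  have D' := dtrD (1, 0) (0, m) l ap bp; have Y := dtr_y m ap bp.
  rewrite -[X in dtr a b _ X]E D' Y /tr1 /tr12; move: (dtr a b (Phi z) (1, 0)) => w.
  by apply: c2P; rewrite ?fstD ?sndD ?(fstZ l w) ?(sndZ l w) /= ?addr0.
move=> h1 h2.
have N : \forall w \near z, transition a b (cu a w, cf a w) = ph b (Phi w).
  apply: filterS (cyl_near az) => w [_ aw].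
  by rewrite -surjective_pairing transition_phi.
have g1 : rder v (fun w => (transition a b (cu a w, cf a w)).1) z (l * tr1 a b (Phi z)) := h1.
have g2 : rder v (fun w => (transition a b (cu a w, cf a w)).2) z
  (l * tr12 a b (Phi z) + m * tr2 a b (Phi z)) := h2.
split; apply: rderE.
- by apply: (rder_near _ g1); apply: filterS N => w ->.
- by apply: (rder_near _ g2); apply: filterS N => w ->.
Qed.

Lemma cyl_box a z : cyl a z -> exists2 d : R, 0 < d & forall w : C2 R,
  nc (w.1 - z.1) < d -> nc (w.2 - z.2) < d -> cyl a w.
Proof. by move=> /cyl_near /nbhs_nc2P. Qed.

Lemma cu_const a z (d : R) (y : C) : (forall w : C2 R,
  nc (w.1 - z.1) < d -> nc (w.2 - z.2) < d -> cyl a w) ->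
  nc (y - z.2) < d -> forall x, nc (x - z.1) < d -> cu a (x, y) = cu a (x, z.2).
Proof.
move=> H yd x xd.
have := @zero_derive_eq R (fun y => cu a (x, y)) z.2 (y - z.2).
rewrite subrKC; apply=> s s01.
have sd : nc (z.2 + s%:C * (y - z.2) - z.2) < d.
  rewrite addrAC subrr add0r ncM nc_real ger0_norm; last by case/andP: s01.
  apply: le_lt_trans yd; apply: ler_piMl; first exact: nc_ge0.
  by case/andP: s01.
have cw := H (x, z.2 + s%:C * (y - z.2)) xd sd.
have [h3 h4] := cu_e34 cw.
have := @slice_y R (cyl a) (cu a) _ (@cyl_open a) cw (cu_smooth 1 a).
by rewrite (rderE h3) (rderE h4) mulr0; apply.
Qed.

Lemma dxbar2_cu_transition a b z : cyl a z -> cyl b z ->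
  dxbar2 (cu b) z = dxbar2 (cu a) z * tr1 a b (Phi z).
Proof.
move=> az bz; rewrite /dxbar2.
have [-> _] := cyl_transition (e1 R) az bz; have [-> _] := cyl_transition (e2 R) az bz.
by rewrite mulrA -mulrDl.
Qed.

(** On a small box u does not depend on y, so neither do its x-derivatives. *)
Lemma dxbar2_cu_local a z : cyl a z -> exists2 d : R, 0 < d & forall y,
  nc (y - z.2) < d -> cyl a (z.1, y) /\ dxbar2 (cu a) (z.1, y) = dxbar2 (cu a) z.
Proof.
move=> az; have [d d0 dP] := cyl_box az; exists d => // y yd.
have z1 : nc (z.1 - z.1) < d by rewrite subrr nc0.
have ay : cyl a (z.1, y) by exact: dP.
have D v : v.2 = 0 -> real_derive v (cu a) (z.1, y) = real_derive v (cu a) z.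
  move=> v2; have h := class_Ck1_rder v az (cu_smooth 1 a).
  apply: rderE.
  have h' : rder v (fun w => cu a (w.1, y)) (z.1, y) (real_derive v (cu a) z).
    have h2 : rder v (fun w => cu a (w.1, z.2)) z (real_derive v (cu a) z).
      apply: cder_eq h => s; congr cu; apply: c2P => //.
      by rewrite sndD sndZ v2 mulr0 addr0.
    have h3 : rder v (fun w => cu a (w.1, y)) z (real_derive v (cu a) z).
      apply: (rder_near _ h2); apply/nbhs_nc2P; exists d => // w w1 w2.
      by rewrite (cu_const dP yd w1).
    by apply: cder_eq h3 => s.
  apply: cder_eq h' => s; congr cu; apply: c2P => //.
  by rewrite sndD sndZ v2 mulr0 addr0.
by split=> //; rewrite /dxbar2 !D.
Qed.

(** At y = 0 u is a coordinate of the holomorphic disk. Vanishing propagates along the leaf, by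
    local constancy inside a chart and by multiplication with [tr1] when the chart changes. *)
Lemma dxbar2_cu a z : cyl a z -> dxbar2 (cu a) z = 0.
Proof.
move=> az; have [cz _] := az.
pose P y := forall b, cyl b (z.1, y) -> dxbar2 (cu b) (z.1, y) = 0.
suff : P z.2 by move=> /(_ a); rewrite -surjective_pairing; apply.
apply: (@locally_constant_prop R P _ 0).
  move=> y; have cy : cylinder (z.1, y) by [].
  have [b bz] := cyl_chart cy.
  have [d d0 dP] := dxbar2_cu_local bz; exists d => // y' /dP[/= bz' E]; split.
    move=> Py' c cz'; rewrite (dxbar2_cu_transition bz cz').
    by rewrite -E Py'// mul0r.
  move=> Py c cz'; rewrite (dxbar2_cu_transition bz' cz').
  by rewrite E Py// mul0r.
move=> b bz; have [p [t [[_ dp _ _] _ H]]] := cP.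
have [_ P0 _] := H z.1 cz.
have bp : dm b (p z.1) by rewrite -P0; case: bz.
have [D _] := dp z.1 b cz bp; have [D1 _] := is_derive_pairP D.
have E : is_derive z.1 1 (fun x : C => cu b (x, 0)) ('D_1 (ph b \o p) z.1).1.
  apply: (is_derive_near _ D1).
  by apply: filterS (disk_near cz) => x dx; have [_ Px _] := H x dx; rewrite /cu Px.
have [r1 r2] := @slice_x_rder R (cu b) (z.1, 0) _ E.
by rewrite /dxbar2 (rderE r1) (rderE r2) mulrA -expr2 sqrCi mulN1r subrr.
Qed.

Lemma cu_e2 a z : cyl a z ->
  real_derive (e2 R) (cu a) z = 'i * real_derive (e1 R) (cu a) z.
Proof.
move=> /dxbar2_cu /(congr1 (fun t => 'i * t)); rewrite /dxbar2 mulr0 mulrDr mulrA -expr2 sqrCi.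
by rewrite mulN1r => /eqP; rewrite subr_eq0 => /eqP.
Qed.

(** If u_1 were 0, the differential of Phi would kill (1, -f_1/f_3): the first coordinate because
    all derivatives of u vanish, the second by [rlin_kernel]. An immersion has no such vector. *)
Lemma cu_e1_neq0 a z : cyl a z -> real_derive (e1 R) (cu a) z != 0.
Proof.
move=> az; have [cz ap] := az; apply/eqP => u1.
have [_ f3] := cf_slice az.
have [_ _ imm] := sm.
pose c := - real_derive (e1 R) (cf a) z / real_derive (e3 R) (cf a) z.
have : (1, c) = 0 :> C2 R.
  apply: (imm z a _ cz ap).
  - rewrite (real_derive_rlin _ (@cyl_open a) az (cu_smooth 1 a)) /rlin /=.
    have [h3 h4] := cu_e34 az.
    by rewrite -/(cu a) (rderE h3) (rderE h4) cu_e2// u1 !mulr0 !addr0.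
  - rewrite (real_derive_rlin _ (@cyl_open a) az (cf_smooth 1 a)).
    exact: (rlin_kernel (cf_e4 az) f3).
by move=> /(congr1 fst) /= /eqP; rewrite oner_eq0.
Qed.

End Cylinder.

(** * The slope and the affine invariant *)

Section LeafHolomorphic.
Variable R : realType.
Local Notation C := (cplx R).
Local Notation D := (@real_derive R).
Local Notation e1 := (e1 R).
Local Notation e2 := (e2 R).
Local Notation e3 := (e3 R).
Local Notation e4 := (e4 R).
Variable O : set (C2 R).
Hypothesis oO : open O.
Implicit Types (f g h : C2 R -> C) (z v w : C2 R).

Lemma real_derive_eq f g z v : O z -> (forall w, O w -> f w = g w) -> D v f z = D v g z.
Proof.
move=> Oz fg.
have N : \forall w \near z, f w = g w.
  by apply: filterS (open_nbhs_nbhs (conj oO Oz)) => w /fg.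
rewrite /real_derive; congr (_ +i* _); rewrite derive1E [RHS]derive1E; apply: near_eq_derive;
  have /nbhs_n2P[d d0 dP] := N; apply/nbhs_ballP; exists (d / (n2 v + 1)) => /=;
  rewrite ?divr_gt0// ?ltr_wpDl ?n2_ge0// => t; rewrite /ball /= sub0r normrN => td;
  rewrite dP// addrAC subrr add0r n2Z nc_real;
  (apply: (@le_lt_trans _ _ (`|t| * (n2 v + 1)));
    [by rewrite ler_wpM2l// lerDl|by rewrite -ltr_pdivlMr// ltr_wpDl// n2_ge0]).
Qed.

Definition smooth_in f := forall k, class_Ck k O f.

Lemma smooth_rderive f v : smooth_in f -> smooth_in (D v f).
Proof. by move=> sf k; exact: (class_Ck_rderive v (sf k.+1)). Qed.

Lemma smooth_rder f v z : smooth_in f -> O z -> rder v f z (D v f z).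
Proof. by move=> sf Oz; exact: (class_Ck1_rder v Oz (sf 1%N)). Qed.

Lemma smooth_dxbar2 f : smooth_in f -> smooth_in (dxbar2 f).
Proof.
move=> sf k; apply: (class_CkD oO); first exact: smooth_rderive.
by apply: (class_CkM oO); [exact: (class_Ck_cst oO)|exact: smooth_rderive].
Qed.

Lemma dxbar2_comm f v z : smooth_in f -> O z -> dxbar2 (D v f) z = D v (dxbar2 f) z.
Proof.
move=> sf Oz; apply/esym; apply: rderE.
have r1 := smooth_rder v (smooth_rderive e1 sf) Oz.
have r2 := smooth_rder v (smooth_rderive e2 sf) Oz.
rewrite /dxbar2 (real_derive_comm v e1 oO Oz (sf 2%N)) (real_derive_comm v e2 oO Oz (sf 2%N)).
exact: (rderD r1 (rderZ 'i r2)).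
Qed.

Definition leaf_holo f := forall z, O z -> D e4 f z = 'i * D e3 f z.

Lemma leaf_holo_rderive f v : smooth_in f -> leaf_holo f -> leaf_holo (D v f).
Proof.
move=> sf hf z Oz; rewrite (real_derive_comm v e4 oO Oz (sf 2%N)).
rewrite (real_derive_comm v e3 oO Oz (sf 2%N)).
rewrite (real_derive_eq v Oz hf); apply: rderE; apply: rderZ.
exact: (smooth_rder v (smooth_rderive e3 sf) Oz).
Qed.

Lemma leaf_holoD f g : smooth_in f -> smooth_in g -> leaf_holo f -> leaf_holo g ->
  leaf_holo (fun z => f z + g z).
Proof.
move=> sf sg hf hg z Oz.
have rv v := rderE (rderD (smooth_rder v sf Oz) (smooth_rder v sg Oz)).
by rewrite !rv hf// hg// mulrDr.
Qed.

Lemma leaf_holoM f g : smooth_in f -> smooth_in g -> leaf_holo f -> leaf_holo g ->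
  leaf_holo (fun z => f z * g z).
Proof.
move=> sf sg hf hg z Oz.
have rv v := rderE (rderM (smooth_rder v sf Oz) (smooth_rder v sg Oz)).
rewrite !rv hf// hg// mulrDr; congr (_ + _); first by rewrite mulrA.
by rewrite mulrCA.
Qed.

Lemma leaf_holoV f : smooth_in f -> (forall z, O z -> f z != 0) -> leaf_holo f ->
  leaf_holo (fun z => (f z)^-1).
Proof.
move=> sf f0 hf z Oz.
have rv v := rderE (rderV (f0 z Oz) (smooth_rder v sf Oz)).
by rewrite !rv hf// mulrCA.
Qed.

Lemma leaf_holoC (c : C) : leaf_holo (fun=> c).
Proof. by move=> z Oz; rewrite !(rderE (rder_cst _ _ _)) mulr0. Qed.

Lemma leaf_holo_dxbar2 f : smooth_in f -> leaf_holo f -> leaf_holo (dxbar2 f).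
Proof.
move=> sf hf; apply: leaf_holoD.
- exact: smooth_rderive.
- by move=> k; apply: (class_CkM oO); [exact: (class_Ck_cst oO)|exact: smooth_rderive].
- exact: leaf_holo_rderive.
- apply: leaf_holoM; [by move=> k; exact: class_Ck_cst|exact: smooth_rderive|exact: leaf_holoC|].
  exact: leaf_holo_rderive.
Qed.

Variable f : C2 R -> C.
Hypotheses (sf : smooth_in f) (hf : leaf_holo f) (f3 : forall z, O z -> D e3 f z != 0).

(* mu and K of the opening comment; B is dxbar2. *)
Definition slope g z : C := - dxbar2 g z * (D e3 g z)^-1.
Definition affine_inv g z : C := - D e3 (D e3 g) z * ((D e3 g z)^-1 * (D e3 g z)^-1).

Lemma smoothN g : smooth_in g -> smooth_in (fun z => - g z).
Proof.
move=> sg k; apply: (@class_Ck_eq R k O (fun z => -1 * g z)) => //.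
  by move=> z _; rewrite mulN1r.
by apply: (class_CkM oO); [exact: (class_Ck_cst oO)|exact: sg].
Qed.

Lemma smoothM g h : smooth_in g -> smooth_in h -> smooth_in (fun z => g z * h z).
Proof. by move=> sg sh k; exact: (class_CkM oO). Qed.

Lemma smoothV g : (forall z, O z -> g z != 0) -> smooth_in g -> smooth_in (fun z => (g z)^-1).
Proof. by move=> g0 sg k; exact: (class_CkV oO). Qed.

Lemma leaf_holoN g : smooth_in g -> leaf_holo g -> leaf_holo (fun z => - g z).
Proof.
move=> sg hg z Oz.
have rv v : D v (fun z => - g z) z = - D v g z.
  have := rderB (rder_cst v 0 z) (smooth_rder v sg Oz).
  rewrite sub0r => h; apply: rderE; apply: rder_near h.
  by near=> w; rewrite sub0r.
by rewrite !rv hg// mulrN.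
Unshelve. all: by end_near. Qed.

Lemma smooth_slope : smooth_in (slope f).
Proof.
apply: smoothM; first exact/smoothN/smooth_dxbar2.
by apply: smoothV; [exact: f3|exact: smooth_rderive].
Qed.

Lemma smooth_affine_inv : smooth_in (affine_inv f).
Proof.
apply: smoothM; first exact/smoothN/smooth_rderive/smooth_rderive.
by apply: smoothM; apply: smoothV; [exact: f3|exact: smooth_rderive|exact: f3|exact: smooth_rderive].
Qed.

Lemma leaf_holo_slope : leaf_holo (slope f).
Proof.
apply: leaf_holoM.
- exact/smoothN/smooth_dxbar2.
- by apply: smoothV; [exact: f3|exact: smooth_rderive].
- by apply: leaf_holoN; [exact: smooth_dxbar2|exact: leaf_holo_dxbar2].
- by apply: leaf_holoV; [exact: smooth_rderive|exact: f3|exact: leaf_holo_rderive].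
Qed.

Lemma leaf_holo_affine_inv : leaf_holo (affine_inv f).
Proof.
have s3 := smooth_rderive e3 sf; have h3 := leaf_holo_rderive e3 sf hf.
have sv := smoothV f3 s3; have hv := leaf_holoV s3 f3 h3.
apply: leaf_holoM.
- exact/smoothN/smooth_rderive.
- exact: smoothM.
- by apply: leaf_holoN; [exact: smooth_rderive|exact: leaf_holo_rderive].
- exact: leaf_holoM.
Qed.

(** A formal consequence of the quotient rule and of the fact that B commutes with the leafwise
    derivative. *)
Lemma dxbar2_affine_inv z : O z ->
  dxbar2 (affine_inv f) z + slope f z * D e3 (affine_inv f) z =
  D e3 (D e3 (slope f)) z * (D e3 f z)^-1.
Proof.
move=> Oz.
have s3 := smooth_rderive e3 sf; have s33 := smooth_rderive e3 s3.
have sA := smooth_dxbar2 sf; have sA3 := smooth_rderive e3 sA.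
have rN v g w : smooth_in g -> O w -> rder v (fun z => - g z) w (- D v g w).
  move=> sg Ow; have := rderB (rder_cst v 0 w) (smooth_rder v sg Ow).
  rewrite sub0r => h; apply: rder_near h.
  by near=> u; rewrite sub0r.
have rV v w : O w -> rder v (fun z => (D e3 f z)^-1) w (- (D e3 f w) ^- 2 * D v (D e3 f) w).
  by move=> Ow; apply: (rderV (f3 Ow)); exact: smooth_rder.
have rmu v w : O w -> D v (slope f) w =
    - D v (dxbar2 f) w * (D e3 f w)^-1 +
    - dxbar2 f w * (- (D e3 f w) ^- 2 * D v (D e3 f) w).
  by move=> Ow; apply: rderE; exact: (rderM (rN v _ w sA Ow) (rV v w Ow)).
have rK v w : O w -> D v (affine_inv f) w =
    - D v (D e3 (D e3 f)) w * ((D e3 f w)^-1 * (D e3 f w)^-1) +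
    - D e3 (D e3 f) w * ((- (D e3 f w) ^- 2 * D v (D e3 f) w) * (D e3 f w)^-1 +
      (D e3 f w)^-1 * (- (D e3 f w) ^- 2 * D v (D e3 f) w)).
  move=> Ow; apply: rderE.
  exact: (rderM (rN v _ w s33 Ow) (rderM (rV v w Ow) (rV v w Ow))).
have Ezz : D e3 (D e3 (slope f)) z =
    (- D e3 (D e3 (dxbar2 f)) z * (D e3 f z)^-1 +
     - D e3 (dxbar2 f) z * (- (D e3 f z) ^- 2 * D e3 (D e3 f) z)) +
    (- D e3 (dxbar2 f) z * (- (D e3 f z) ^- 2 * D e3 (D e3 f) z) +
     - dxbar2 f z * (- ((- (D e3 f z) ^- 2 * D e3 (D e3 f) z) * (D e3 f z)^-1 +
        (D e3 f z)^-1 * (- (D e3 f z) ^- 2 * D e3 (D e3 f) z)) * D e3 (D e3 f) z +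
       - ((D e3 f z)^-1 * (D e3 f z)^-1) * D e3 (D e3 (D e3 f)) z)).
  rewrite (real_derive_eq e3 Oz (rmu e3)); apply: rderE.
  have iE w : - (D e3 f w) ^- 2 = - ((D e3 f w)^-1 * (D e3 f w)^-1).
    by rewrite -exprVn expr2.
  have r1 := rderM (rN e3 _ z sA3 Oz) (rV e3 z Oz).
  have r2 : rder e3 (fun w => - (D e3 f w) ^- 2) z
      (- ((- (D e3 f z) ^- 2 * D e3 (D e3 f) z) * (D e3 f z)^-1 +
        (D e3 f z)^-1 * (- (D e3 f z) ^- 2 * D e3 (D e3 f) z))).
    have h := rderB (rder_cst e3 0 z) (rderM (rV e3 z Oz) (rV e3 z Oz)).
    rewrite sub0r in h; apply: rder_near h.
    by near=> u; rewrite sub0r iE.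
  have r3 := rderM r2 (smooth_rder e3 s33 Oz).
  have r4 := rderM (rN e3 _ z sA Oz) r3.
  by have := rderD r1 r4; rewrite !iE.
(* After exchanging B with the leafwise derivatives both sides are rational in the same partial
   derivatives of f, and the identity is one of fractions. *)
have X3 : dxbar2 (D e3 f) z = D e3 (dxbar2 f) z by exact: dxbar2_comm.
have X33 : dxbar2 (D e3 (D e3 f)) z = D e3 (D e3 (dxbar2 f)) z.
  apply: (eq_trans (dxbar2_comm e3 s3 Oz)).
  exact: (real_derive_eq e3 Oz (fun w Ow => dxbar2_comm e3 sf Ow)).
rewrite {1}/dxbar2 (rK e1 z Oz) (rK e2 z Oz) (rK e3 z Oz) Ezz -X33 -X3 /slope /affine_inv.
rewrite /dxbar2; have := f3 Oz.
move: (D e3 f z) (D e3 (D e3 f) z) (D e3 (D e3 (D e3 f)) z).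
move: (D e1 (D e3 f) z) (D e2 (D e3 f) z) (D e1 (D e3 (D e3 f)) z) (D e2 (D e3 (D e3 f)) z).
move: (D e1 f z) (D e2 f z); clear => a1 a2 b1 b2 c1 c2 g g3 g33 g0.
by field.
Unshelve. all: by end_near. Qed.

End LeafHolomorphic.

Section RealLinear.
Variable R : realType.
Local Notation C := (cplx R).
Implicit Types (f g : C2 R -> C) (z v w : C2 R) (c : C).

Lemma conj_ReIm c : c^* = (complex.Re c)%:C - 'i * (complex.Im c)%:C.
Proof.
have h : complex.Re (c^*) = complex.Re c /\ complex.Im (c^*) = - complex.Im c by case: c.
by rewrite [LHS]ReIm h.1 h.2 rcN mulrN.
Qed.

Lemma rlin_x f z c : rlin f z (c, 0) = (complex.Re c)%:C * real_derive (e1 R) f z +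
  (complex.Im c)%:C * real_derive (e2 R) f z.
Proof.
rewrite /rlin; change (complex.Re (0 : C))%:C with (0 : C).
change (complex.Im (0 : C))%:C with (0 : C).
by rewrite !mul0r !addr0.
Qed.

Lemma rlin_dxbar2 f z c : rlin f z (c, 0) + 'i * rlin f z ('i * c, 0) = c^* * dxbar2 f z.
Proof.
rewrite !rlin_x /dxbar2 conj_ReIm.
have -> : complex.Re ('i * c) = - complex.Im c.
  by rewrite cReM /= mul0r mul1r sub0r.
have -> : complex.Im ('i * c) = complex.Re c.
  by rewrite cImM /= mul0r mul1r add0r.
rewrite rcN; move: (real_derive (e1 R) f z) (real_derive (e2 R) f z) => s t.
have i2 : 'i * 'i = -1 :> C by rewrite -expr2 sqrCi.
move: ((complex.Re c)%:C : C) ((complex.Im c)%:C : C) => a b.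
have -> : 'i * (- b * s + a * t) = - ('i * b) * s + 'i * (a * t) by ring.
have -> : (a - 'i * b) * (s + 'i * t) = a * s + 'i * (a * t) - 'i * b * s - ('i * 'i) * (b * t) by ring.
by rewrite i2; ring.
Qed.

Lemma rlin_holo f z v : real_derive (e4 R) f z = 'i * real_derive (e3 R) f z ->
  rlin f z v = rlin f z (v.1, 0) + v.2 * real_derive (e3 R) f z.
Proof.
move=> E; rewrite rlin_x /rlin E [in RHS](ReIm v.2).
move: (real_derive (e1 R) f z) (real_derive (e2 R) f z) (real_derive (e3 R) f z) => s t x.
by move: (_%:C) (_%:C) (_%:C) (_%:C) => a b c d; ring.
Qed.

Lemma rlin_holo_x f z c : real_derive (e2 R) f z = 'i * real_derive (e1 R) f z ->
  rlin f z (c, 0) = c * real_derive (e1 R) f z.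
Proof.
move=> E; rewrite rlin_x E [in RHS](ReIm c) mulrDl; congr (_ + _).
by move: (real_derive (e1 R) f z) => s; ring.
Qed.

(** The operator 2 d/dxbar of the chart, pulled back by the cylinder, is conj(1/u_1) (B + mu D_3) on
    functions holomorphic along the leaves. The vector 1/u_1 enters conjugated because d/dxbar is
    antilinear in its direction, and the mu-term corrects the motion of y. *)
Lemma tri_inv_dxbar2 f g z (u c f3 : C) : c = u^-1 ->
  real_derive (e4 R) g z = 'i * real_derive (e3 R) g z ->
  rlin g z (tri_inv f z u f3 (e1 R)) + 'i * rlin g z (tri_inv f z u f3 (e2 R)) =
  c^* * (dxbar2 g z + (- dxbar2 f z * f3^-1) * real_derive (e3 R) g z).
Proof.
move=> cE hg; have Qf := rlin_dxbar2 f z c; have Qg := rlin_dxbar2 g z c.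
have E1 : tri_inv f z u f3 (e1 R) = (c, - rlin f z (c, 0) * f3^-1).
  by apply: c2P; rewrite ?tri_invE2 /= ?sub0r ?mul1r -cE.
have E2 : tri_inv f z u f3 (e2 R) = ('i * c, - rlin f z ('i * c, 0) * f3^-1).
  by apply: c2P; rewrite ?tri_invE2 /= ?sub0r -cE.
rewrite E1 E2 (rlin_holo (c, _) hg) (rlin_holo ('i * c, _) hg).
change ((c, - rlin f z (c, 0) * f3^-1) : C2 R).1 with c.
change (('i * c, - rlin f z ('i * c, 0) * f3^-1) : C2 R).1 with ('i * c).
change ((c, - rlin f z (c, 0) * f3^-1) : C2 R).2 with (- rlin f z (c, 0) * f3^-1).
change (('i * c, - rlin f z ('i * c, 0) * f3^-1) : C2 R).2 with (- rlin f z ('i * c, 0) * f3^-1).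
suff alg (A B A' B' F' G' k y g3 : C) : A + 'i * B = k * F' -> A' + 'i * B' = k * G' ->
    A' + - A * y * g3 + 'i * (B' + - B * y * g3) = k * (G' + - F' * y * g3).
  exact: alg Qf Qg.
move=> QF QG.
have -> : k * (G' + - F' * y * g3) = k * G' - (k * F') * y * g3 by ring.
by rewrite -QF -QG; ring.
Qed.

Lemma conj_factor (u t m x p u' m' x' : C) : t != 0 -> p != 0 ->
  u' = u * t -> m' = m -> x' = x * p ->
  u^-1^* * (m * x^-1) = u'^-1^* * (m' * x'^-1) * t^* * p.
Proof.
move=> t0 p0 -> -> ->; have E : t^-1^* * t^* = 1 :> C by rewrite -rmorphM mulVf// rmorph1.
have M : (u * t)^-1^* = u^-1^* * t^-1^* :> C by rewrite invfM rmorphM.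
rewrite M (invfM x p).
move: (u^-1^*) (t^-1^*) (t^*) E (x^-1) => a b c E y.
have -> : a * b * (m * (y * p^-1)) * c * p = a * (m * y) * (b * c) * (p^-1 * p) by ring.
by rewrite E mulVf// !mulr1.
Qed.

End RealLinear.

Section CylinderInvariants.
Variables (R : realType) (X : topologicalType) (F : foliatedSurface R X).
Local Notation C := (cplx R).
Local Notation D := (@real_derive R).
Local Notation e1 := (e1 R).
Local Notation e2 := (e2 R).
Local Notation e3 := (e3 R).
Local Notation e4 := (e4 R).
Local Notation ph := (@phi R X F).
Implicit Types (a b : chart F) (z v w : C2 R).

Section OneCylinder.
Variable Phi : C2 R -> X.
Hypotheses (cP : class_C F Phi) (sm : smooth_immersion F Phi).

Lemma cf_smooth_in a : smooth_in (cyl Phi a) (cf Phi a).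
Proof. by move=> k; exact: cf_smooth. Qed.

Lemma cf_leaf_holo a : leaf_holo (cyl Phi a) (cf Phi a).
Proof. by move=> z az; exact: (cf_e4 cP az). Qed.

Lemma cf_e3_neq0 a z : cyl Phi a z -> D e3 (cf Phi a) z != 0.
Proof. by move=> az; have [] := cf_slice cP az. Qed.

Lemma cu_rlin a z v : cyl Phi a z -> rlin (cu Phi a) z v = D e1 (cu Phi a) z * v.1.
Proof.
move=> az; have [h3 h4] := cu_e34 cP az.
rewrite rlin_holo; last by rewrite (rderE h3) (rderE h4) mulr0.
by rewrite (rderE h3) mulr0 addr0 (rlin_holo_x _ (cu_e2 cP sm az)) mulrC.
Qed.

Lemma cf_rlin a z v : cyl Phi a z ->
  rlin (cf Phi a) z v = rlin (cf Phi a) z (v.1, 0) + D e3 (cf Phi a) z * v.2.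
Proof. by move=> az; rewrite (rlin_holo _ (cf_e4 cP az)) [_ * v.2]mulrC. Qed.

(** Since B u = 0, a change of chart multiplies B f and f_3 by the same factor [tr2]. *)
Lemma slope_transition a b z : cyl Phi a z -> cyl Phi b z ->
  slope (cf Phi b) z = slope (cf Phi a) z.
Proof.
move=> az bz; rewrite /slope.
have [_ E1] := cyl_transition sm e1 az bz.
have [_ E2] := cyl_transition sm e2 az bz.
have [_ E3] := cyl_transition sm e3 az bz.
have [h3 _] := cu_e34 cP az; rewrite (rderE h3) mul0r add0r in E3.
have [_ ap] := az; have [_ bp] := bz; have t0 := tr2_neq0 ap bp.
have n3 := cf_e3_neq0 az.
have -> : dxbar2 (cf Phi b) z = dxbar2 (cf Phi a) z * tr2 a b (Phi z).
  have X0 := dxbar2_cu cP sm az; move: X0; rewrite /dxbar2 E1 E2.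
  move: (D e1 (cu Phi a) z) (D e2 (cu Phi a) z) (D e1 (cf Phi a) z) (D e2 (cf Phi a) z)
    (tr2 a b (Phi z)) (tr12 a b (Phi z)).
  move=> s t p q x y X0.
  have -> : s * y + p * x + 'i * (t * y + q * x) = (s + 'i * t) * y + (p + 'i * q) * x by ring.
  by rewrite X0 mul0r add0r.
by rewrite E3 invfM mulNr mulNr; congr (- _); rewrite -mulrA; congr (_ * _); rewrite mulrCA mulfV// mulr1.
Qed.

Lemma slope_D_transition a b z : cyl Phi a z -> cyl Phi b z ->
  D e3 (slope (cf Phi b)) z = D e3 (slope (cf Phi a)) z /\
  D e3 (D e3 (slope (cf Phi b))) z = D e3 (D e3 (slope (cf Phi a))) z.
Proof.
move=> az bz.
have oI : open (cyl Phi a `&` cyl Phi b) by apply: openI; exact: cyl_open.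
have E w : (cyl Phi a `&` cyl Phi b) w -> slope (cf Phi b) w = slope (cf Phi a) w.
  by move=> [aw bw]; exact: slope_transition.
have E' w : (cyl Phi a `&` cyl Phi b) w ->
    D e3 (slope (cf Phi b)) w = D e3 (slope (cf Phi a)) w.
  by move=> Ow; exact: (real_derive_eq oI e3 Ow E).
have Oz : (cyl Phi a `&` cyl Phi b) z by split.
by split; [exact: E'|exact: (real_derive_eq oI e3 Oz E')].
Qed.

Lemma cf_slice2 a z : cyl Phi a z ->
  is_derive z.2 1 (fun y => D e3 (cf Phi a) (z.1, y)) (D e3 (D e3 (cf Phi a)) z).
Proof.
move=> az; have oO := cyl_open sm (a := a).
apply: (slice_y oO az (smooth_rderive e3 (cf_smooth_in a) 1)).
exact: (leaf_holo_rderive oO e3 (cf_smooth_in a) (cf_leaf_holo (a := a))).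
Qed.

(* The coefficient T of the opening comment, read in the chart a. *)
Definition slope_tensor a z : C :=
  (D e1 (cu Phi a) z)^-1^* * (D e3 (D e3 (slope (cf Phi a))) z * (D e3 (cf Phi a) z)^-1).

Lemma slope_tensor_transition a b z : cyl Phi a z -> cyl Phi b z ->
  slope_tensor a z = slope_tensor b z * (tr1 a b (Phi z))^* * tr2 a b (Phi z).
Proof.
move=> az bz; rewrite /slope_tensor.
have [U1 _] := cyl_transition sm e1 az bz.
have [_ E3] := cyl_transition sm e3 az bz.
have [h3 _] := cu_e34 cP az; rewrite (rderE h3) mul0r add0r in E3.
have [_ ap] := az; have [_ bp] := bz; have t2 := tr2_neq0 ap bp; have t1 := tr1_neq0 ap bp.
have [_ S2] := slope_D_transition az bz.
exact: (conj_factor t1 t2 U1 S2 E3).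
Qed.

(** [kap] stands for K as a function on the chart, known only at points of the cylinder; these fill
    a neighbourhood. [tri_rder] differentiates it and [dxbar2_affine_inv] recognises T. *)
Lemma slope_tensor_rder a z (kap : C2 R -> C) : cyl Phi a z ->
  (forall w, cyl Phi a w -> kap (ph a (Phi w)) = affine_inv (cf Phi a) w) ->
  dxbar2 kap (ph a (Phi z)) = slope_tensor a z.
Proof.
move=> az kapE; have oO := cyl_open sm (a := a).
have sf := cf_smooth_in a; have hf := cf_leaf_holo (a := a).
have n3 w : cyl Phi a w -> D e3 (cf Phi a) w != 0 by exact: cf_e3_neq0.
have sK := smooth_affine_inv oO sf n3; have hK := leaf_holo_affine_inv oO sf hf n3.
have kapE' w : cyl Phi a w -> kap (tri_map (cu Phi a) (cf Phi a) w) = affine_inv (cf Phi a) w.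
  by move=> aw; rewrite /tri_map -surjective_pairing kapE.
have T v := tri_rder oO az (cu_smooth sm 1 a) (cf_smooth sm 1 a) (cu_e1_neq0 cP sm az)
  (n3 z az) (fun v => cu_rlin v az) (fun v => cf_rlin v az) v (sK 1%N) kapE'.
have -> : ph a (Phi z) = tri_map (cu Phi a) (cf Phi a) z by rewrite /tri_map -surjective_pairing.
rewrite /dxbar2 (rderE (T e1)) (rderE (T e2)) /slope_tensor.
have I := dxbar2_affine_inv oO sf n3 az.
apply: (eq_trans _ (congr1 (fun t => (D e1 (cu Phi a) z)^-1^* * t) I)).
exact: (tri_inv_dxbar2 _ _ erefl (hK z az)).
Qed.

End OneCylinder.

End CylinderInvariants.

(** * The tensor as an object on X *)

Section IntrinsicTensor.
Variables (R : realType) (X : topologicalType) (F : foliatedSurface R X).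
Local Notation C := (cplx R).
Local Notation D := (@real_derive R).
Local Notation e1 := (e1 R).
Local Notation e3 := (e3 R).
Local Notation ph := (@phi R X F).
Local Notation dm := (@dom R X F).
Implicit Types (a b : chart F) (z v w : C2 R) (Phi : C2 R -> X).

Hypothesis class_C_smooth : forall Phi, class_C F Phi -> smooth_immersion F Phi.

Lemma is_derive_affine (k m y : C) : is_derive y 1 (fun y : C => k * y + m) k.
Proof.
apply/is_deriveCP => e e0; exists 1 => // h _.
have -> : k * (y + h) + m - (k * y + m) - h * k = 0 by ring.
by rewrite nc0 mulr_ge0 ?nc_ge0// ltW.
Qed.

(* Two leafwise coordinates of the same leaf differ by an affine map. *)
Lemma affine_inv_unique Phi Phi' a z z' : class_C F Phi -> class_C F Phi' ->
  cyl Phi a z -> cyl Phi' a z' -> Phi z = Phi' z' ->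
  affine_inv (cf Phi a) z = affine_inv (cf Phi' a) z'.
Proof.
move=> cP cP' az az' E; have sm := class_C_smooth cP; have sm' := class_C_smooth cP'.
have [cz ap] := az; have [cz' ap'] := az'.
have [p up] := cylinder_covering cP cz; have [p' up'] := cylinder_covering cP' cz'.
have E1 : Phi' (z'.1, z'.2) = Phi (z.1, z.2) by rewrite -!surjective_pairing.
have L := covering_leaf_eq up' up E1; rewrite L in up'.
have [k [m [k0 kE km]]] := covering_affine up' up E1.
have Ez : (z'.1, k * z.2 + m) = z' by rewrite km -surjective_pairing.
have Ezz : (z.1, z.2) = z by rewrite -surjective_pairing.
have aw y : cyl Phi a (z.1, y) -> cyl Phi' a (z'.1, k * y + m).
  by move=> [_ ay]; split=> //; have := kE y; rewrite /preimage /= => <-.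
have H1 y : cyl Phi a (z.1, y) ->
    D e3 (cf Phi a) (z.1, y) = D e3 (cf Phi' a) (z'.1, k * y + m) * k.
  move=> ay; have [d1 _] := cf_slice cP ay; have [d2 _] := cf_slice cP' (aw y ay).
  have d3 := @is_derive_compC R (fun y => cf Phi' a (z'.1, y)) (fun y : C => k * y + m) y _ _
    d2 (is_derive_affine k m y).
  have d4 : is_derive y 1 (fun y => cf Phi a (z.1, y)) (D e3 (cf Phi' a) (z'.1, k * y + m) * k).
    have -> : (fun y => cf Phi a (z.1, y)) = (fun y => cf Phi' a (z'.1, y)) \o (fun y => k * y + m).
      by apply/funext => s; rewrite /cf /= kE.
    exact: d3.
  by apply: (eq_trans (esym (derive_val (is_derive := d1)))); exact: (derive_val (is_derive := d4)).
have H2 : D e3 (D e3 (cf Phi a)) z = D e3 (D e3 (cf Phi' a)) z' * k * k.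
  have d1 := cf_slice2 cP sm az.
  have az2 := aw z.2; rewrite Ezz in az2; have d2 := cf_slice2 cP' sm' (az2 az).
  have d3 := @is_derive_compC R (fun y => D e3 (cf Phi' a) (z'.1, y)) (fun y : C => k * y + m) z.2 _ _
    d2 (is_derive_affine k m z.2).
  have d4 := @is_derive_compC R (fun w : C => k * w) (fun y => D e3 (cf Phi' a) (z'.1, k * y + m)) z.2 _ _
    (is_derive_mulc k _) d3.
  have N : \forall y \near z.2,
      k * D e3 (cf Phi' a) (z'.1, k * y + m) = D e3 (cf Phi a) (z.1, y).
    have [d d0 dP] := cyl_box sm az; apply/nbhs_ncP; exists d => // y yd.
    by rewrite H1 1?mulrC//; apply: dP => //=; rewrite subrr nc0.
  have d5 := is_derive_near N d4.
  apply: (eq_trans (esym (derive_val (is_derive := d1)))).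
  by apply: (eq_trans (derive_val (is_derive := d5))); rewrite Ez mulrC.
have H1z := H1 z.2; rewrite Ezz Ez in H1z; have {}H1z := H1z az.
rewrite /affine_inv H2 H1z; have := cf_e3_neq0 cP' az'; move: k0.
move: (D e3 (D e3 (cf Phi' a)) z') (D e3 (cf Phi' a) z'); clear=> s t k0 t0.
by field; rewrite t0.
Qed.

(** K as a function of the chart coordinates. The choice is harmless by [affine_inv_unique]; points
    reached by no cylinder get the value 0. *)
Definition kappa a (zeta : C2 R) : C := xget 0 [set c | exists Phi z,
  [/\ class_C F Phi, cyl Phi a z, ph a (Phi z) = zeta & c = affine_inv (cf Phi a) z]].

Lemma kappaE Phi a z : class_C F Phi -> cyl Phi a z ->
  kappa a (ph a (Phi z)) = affine_inv (cf Phi a) z.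
Proof.
move=> cP az; rewrite /kappa.
case: xgetP => [c _ [Phi' [z' [cP' az' E ->]]]|H]; last first.
  by have [] := H (affine_inv (cf Phi a) z); exists Phi, z.
apply: affine_inv_unique => //; case: az' => _ h'; case: az => _ h.
exact: phi_inj h' h E.
Qed.

(** The coefficient T without reference to a cylinder; at each point any cylinder through it may be
    used to compute it. *)
Definition tensor a q : C := dxbar2 (kappa a) (ph a q).

Lemma tensorE Phi a z : class_C F Phi -> cyl Phi a z ->
  tensor a (Phi z) = slope_tensor Phi a z.
Proof.
move=> cP az; apply: (slope_tensor_rder cP (class_C_smooth cP) az) => w aw.
exact: kappaE.
Qed.

Lemma slope_tensor_smooth Phi a : class_C F Phi -> smooth_immersion F Phi ->
  smooth_in (cyl Phi a) (slope_tensor Phi a).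
Proof.
move=> cP sm k; have oO := @cyl_open _ _ _ _ sm a.
have sf := cf_smooth_in sm a.
have n3 w : cyl Phi a w -> D e3 (cf Phi a) w != 0 by exact: cf_e3_neq0.
have n1 w : cyl Phi a w -> D e1 (cu Phi a) w != 0 by exact: cu_e1_neq0.
have su : smooth_in (cyl Phi a) (cu Phi a) by move=> i; exact: cu_smooth.
apply: (class_CkM oO).
  by apply: (class_Ck_conj oO); apply: (class_CkV oO n1); exact: (smooth_rderive e1 su).
apply: (class_CkM oO).
  exact: (smooth_rderive e3 (smooth_rderive e3 (smooth_slope oO sf n3))).
by apply: (class_CkV oO n3); exact: (smooth_rderive e3 sf).
Qed.

Lemma slope_tensor_continuous Phi a z : class_C F Phi -> cyl Phi a z ->
  {for z, continuous (slope_tensor Phi a)}.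
Proof.
move=> cP az; exact: (class_Ck_cont (slope_tensor_smooth a cP (class_C_smooth cP) 0%N) az).
Qed.

Hypothesis leaves_parabolic : forall p : X, parabolic F (leaf F p).

Lemma cylinder_through q : exists Phi, class_C F Phi /\ Phi (0, 0) = q.
Proof. exact: class_C_exists. Qed.

Lemma cylinder0 : @cylinder R (0, 0).
Proof. by apply/diskP; rewrite nc0. Qed.

Lemma tensor_transition a b q : dm a q -> dm b q ->
  tensor a q = tensor b q * (tr1 a b q)^* * tr2 a b q.
Proof.
move=> aq bq; have [Phi [cP E]] := cylinder_through q.
have az : cyl Phi a (0, 0) by split; [exact: cylinder0|rewrite /preimage /= E].
have bz : cyl Phi b (0, 0) by split; [exact: cylinder0|rewrite /preimage /= E].
rewrite -{1 2}E (tensorE cP az) (tensorE cP bz).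
by rewrite (slope_tensor_transition cP (class_C_smooth cP) az bz) E.
Qed.

(** Nearby points of X have preimages near z, so continuity on X can be checked on the cylinder. *)
Lemma cylinder_local_onto Phi a z (e : R) : class_C F Phi -> cyl Phi a z -> 0 < e ->
  \forall q \near Phi z, exists2 w, n2 (w - z) < e /\ cyl Phi a w & Phi w = q.
Proof.
move=> cP az e0; have sm := class_C_smooth cP; have oO := @cyl_open _ _ _ _ sm a.
have [r [k [r0 k0 rO _ onto]]] := tri_local_inverse oO az (cu_smooth sm 1 a) (cf_smooth sm 1 a)
  (cu_e1_neq0 cP sm az) (cf_e3_neq0 cP az) (fun v => cu_rlin cP sm v az)
  (fun v => cf_rlin cP v az).
have [|p p0 pP] := onto (Num.min e r); first by rewrite lt_min e0.
have [_ aq] := az.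
have N1 : \forall q \near Phi z, dm a q.
  by apply: open_nbhs_nbhs; split=> //; exact: dom_open.
have N2 : \forall q \near Phi z, n2 (ph a q - ph a (Phi z)) < p.
  have N : nbhs (ph a (Phi z)) [set u | n2 (u - ph a (Phi z)) < p].
    by apply/nbhs_n2P; exists p.
  exact: (phi_continuous aq N).
apply: filterS (filterI N1 N2) => q [aq' qp].
have [|w wr wE] := pP (ph a q); first by rewrite /tri_map -surjective_pairing.
move: wr; rewrite lt_min => /andP[we wr]; have aw := rO w wr.
exists w; first by split.
case: (aw) => _ h; apply: (phi_inj h aq').
by rewrite -wE /tri_map -surjective_pairing.
Qed.

Lemma tensor_continuous a q : dm a q -> {for q, continuous (tensor a)}.
Proof.
move=> aq; have [Phi [cP E]] := cylinder_through q.
have az : cyl Phi a (0, 0) by split; [exact: cylinder0|rewrite /preimage /= E].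
apply/(@cvg_ncP R X (nbhs q) (nbhs_filter _)) => e e0.
have /continuous_n2P /(_ e e0)[d d0 dP] := slope_tensor_continuous cP az.
have := cylinder_local_onto cP az d0; rewrite E; apply: filterS => q' [w [wd aw] <-].
rewrite -E (tensorE cP aw) (tensorE cP az).
exact: dP.
Qed.

End IntrinsicTensor.

(** * The maximum principle along the leaves *)

Section SecondDerivativeTest.
Variable R : realType.
Local Notation C := (cplx R).
Local Notation Re := (@complex.Re R).
Local Notation Im := (@complex.Im R).

(** At the maximum th' vanishes; if l were positive, th' would be positive just to the right and the
    mean value theorem would give a larger value. *)
Lemma second_derivative_test (th th' : R -> R) (d l : R) : 0 < d ->
  (forall t : R, `|t| < d -> is_derive t 1 th (th' t)) -> is_derive (0 : R) 1 th' l ->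
  (forall t : R, `|t| < d -> th t <= th 0) -> l <= 0.
Proof.
move=> d0 D1 D2 M; rewrite leNgt; apply/negP => l0.
have N0 : `|0 : R| < d by rewrite normr0.
have inD (t : R) : t \in `]- d, d[ -> `|t| < d by rewrite in_itv /= ltr_norml.
have Z : th' 0 = 0.
  have h1 : is_derive (0 : R) 1 th 0.
    apply: (@derive1_at_max R th (- d) d 0).
    - by rewrite ge0_cp// ltW.
    - by move=> t /inD td; have h := D1 t td; exact: (ex_derive (is_derive := h)).
    - by rewrite in_itv /= oppr_lt0 d0.
    - by move=> t /inD; exact: M.
  by rewrite -(derive_val (is_derive := D1 0 N0)) (derive_val (is_derive := h1)).
have l2 : 0 < l / 2 by rewrite divr_gt0.
have [d' d'0 dP] := (is_deriveRP th' 0 l).1 D2 _ l2.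
pose t := Num.min d d' / 2.
have m0 : 0 < Num.min d d' by rewrite lt_min d0.
have t0 : 0 < t by rewrite divr_gt0.
have [td td'] : t < d /\ t < d'.
  have : t < Num.min d d' by rewrite /t; lra.
  by rewrite lt_min => /andP[].
have Dt (x : R) : 0 <= x <= t -> is_derive x 1 th (th' x).
  by move=> /andP[x0 xt]; apply: D1; rewrite ger0_norm// (le_lt_trans xt).
have [||c cI cE] := @MVT R th th' 0 t t0.
- by move=> x; rewrite in_itv /= => /andP[x0 xt]; apply: Dt; rewrite !ltW.
- apply: derivable_within_continuous => x; rewrite in_itv /= => /Dt h.
  exact: (ex_derive (is_derive := h)).
move: cI; rewrite in_itv /= => /andP[c0 ct].
have cd' : `|c| < d' by rewrite gtr0_norm// (lt_trans ct).
have := dP c cd'; rewrite add0r Z subr0 (gtr0_norm c0) ler_norml => /andP[h _].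
have := M t; rewrite gtr0_norm// => /(_ td) Mt.
have p1 : 0 < l / 2 * c by rewrite mulr_gt0.
have p2 : 0 < th' c.
  have -> : th' c = th' c - c * l + l * c by rewrite (mulrC c) subrK.
  have E : l * c = l / 2 * c + l / 2 * c by field.
  by move: h; rewrite E; clear - p1; lra.
have : 0 < th' c * (t - 0) by rewrite subr0 mulr_gt0.
by rewrite -cE subr_gt0 ltNge Mt.
Qed.

Lemma Re_div (l f : C) : f != 0 ->
  Re (l / f) = (nc f ^+ 2)^-1 * (Re l * Re f + Im l * Im f).
Proof.
move=> f0; rewrite nc_sqr cReM; case: f f0 => x y f0 /=.
by rewrite mulrDr mulrN opprK !mulrA; congr (_ + _); rewrite mulrC mulrA.
Qed.

Lemma is_derive_ln_nc2 (f : R -> C) (t : R) (l : C) : cder f t l -> f t != 0 ->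
  is_derive t 1 (fun s => ln (nc (f s) ^+ 2)) (2 * Re (l / f t)).
Proof.
move=> /cderP[d1 d2] f0.
have p : 0 < nc (f t) ^+ 2 by rewrite exprn_gt0// nc_gt0.
have d3 := is_deriveD (is_deriveM d1 d1) (is_deriveM d2 d2).
have d4 : is_derive t 1 (fun s => nc (f s) ^+ 2) (2 * (Re l * Re (f t) + Im l * Im (f t))).
  have -> : (fun s => nc (f s) ^+ 2) =
      (fun s => Re (f s) * Re (f s) + Im (f s) * Im (f s)).
    by apply/funext => s; rewrite nc_sqr !expr2.
  apply: (is_derive_eq d3); rewrite /GRing.scale /=; ring.
have d5 := is_derive1_ln p.
have := @is_derive1_comp R (@ln R) (fun s => nc (f s) ^+ 2) t _ _ d5 d4.
by move=> h; apply: (is_derive_eq h); rewrite Re_div// mulrCA.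
Qed.

End SecondDerivativeTest.

Section Subharmonic.
Variable R : realType.
Local Notation C := (cplx R).
Local Notation Re := (@complex.Re R).
Local Notation Im := (@complex.Im R).
Local Notation D := (@real_derive R).
Local Notation e3 := (e3 R).
Local Notation e4 := (e4 R).
Variables (O : set (C2 R)) (h : C2 R -> R).
Hypotheses (oO : open O) (h0 : forall z, O z -> 0 < h z)
  (sh : smooth_in O (fun z => (h z)%:C)).
Implicit Types (z v : C2 R).

Lemma rder_ln v z : O z ->
  rder v (fun w => (ln (h w))%:C) z (D v (fun w => (h w)%:C) z * ((h z)%:C)^-1).
Proof.
move=> Oz; have r := smooth_rder v sh Oz.
have /cderP[d1 d2] := r.
have I0 : Im (D v (fun w => (h w)%:C) z) = 0.
  rewrite -(derive_val (is_derive := d2)) /=; exact: derive_cst.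
have E0 : z + (0%:C : C) *: v = z by rewrite scale0r addr0.
have p : 0 < h (z + (0%:C : C) *: v) by rewrite E0; exact: h0.
have d3 := @is_derive1_comp R (@ln R) (fun t : R => h (z + t%:C *: v)) 0 _ _ (is_derive1_ln p) d1.
have := cder_real d3; rewrite /rder E0.
suff -> : ((h z)^-1 * Re (D v (fun w => (h w)%:C) z))%:C = D v (fun w => (h w)%:C) z * ((h z)%:C)^-1 by [].
rewrite {2}(ReIm (D v _ z)) I0 mulr0 addr0 rcM mulrC; congr (_ * _).
exact: fmorphV.
Qed.

Lemma smooth_ln : smooth_in O (fun w => (ln (h w))%:C).
Proof.
have ch z : O z -> {for z, continuous h}.
  move=> Oz; have c := class_Ck_cont (sh 0%N) Oz.
  exact: (@continuous_comp (C2 R) C R (fun z => (h z)%:C) Re z c (@continuous_Re R _)).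
have cl z : O z -> {for z, continuous (fun w => (ln (h w))%:C : C)}.
  move=> Oz; apply: (@continuous_comp (C2 R) R C (fun w => ln (h w)) (fun t => t%:C)).
    by apply: (@continuous_comp (C2 R) R R h (@ln R)); [exact: ch|exact/continuous_ln/h0].
  exact: continuous_real.
case=> [|k]; first by split.
apply: (class_Ck_intro oO cl) => v.
exists (fun z => D v (fun w => (h w)%:C) z * ((h z)%:C)^-1); first by move=> z; exact: rder_ln.
apply: (class_CkM oO); first exact: (smooth_rderive v sh).
apply: (class_CkV oO) => // z Oz; rewrite -nc_eq0 nc_real.
by rewrite gtr0_norm ?h0// gt_eqF// h0.
Qed.

(** Four times dy dybar is the Laplacian in y; the mixed derivatives cancel by Clairaut. *)
Lemma leaf_curvature_lt0 z : O z -> leaf_curvature h z < 0 ->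
  0 < Re (D e3 (D e3 (fun w => (ln (h w))%:C)) z) + Re (D e4 (D e4 (fun w => (ln (h w))%:C)) z).
Proof.
move=> Oz; set g := fun w => (ln (h w))%:C : C.
have sg : smooth_in O g := smooth_ln.
have s3 := smooth_rderive e3 sg; have s4 := smooth_rderive e4 sg.
have E v : D v (dybar g) z = (D v (D e3 g) z + 'i * D v (D e4 g) z) / 2.
  apply: rderE; rewrite /dybar mulrC.
  have := rderZ 2^-1 (rderD (smooth_rder v s3 Oz) (rderZ 'i (smooth_rder v s4 Oz))).
  by apply: rder_near; near=> w; rewrite mulrC.
rewrite /leaf_curvature -/g /dy -/e3 -/e4 !E.
rewrite (real_derive_comm e3 e4 oO Oz (sg 2%N)).
move: (D e3 (D e3 g) z) (D e4 (D e4 g) z) (D e3 (D e4 g) z) => a b c.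
have i2 : 'i * 'i = -1 :> C by rewrite -expr2 sqrCi.
have -> : ((a + 'i * c) / 2 - 'i * ((c + 'i * b) / 2)) / 2 = (a - ('i * 'i) * b) / 4 :> C by field.
rewrite i2 mulN1r opprK oppr_lt0.
have -> : (a + b) / 4 = (4^-1)%:C * (a + b) :> C.
  by rewrite mulrC; congr (_ * _); rewrite fmorphV rmorph_nat.
rewrite ltcE /= => /andP[_]; rewrite Re_realM cReD.
by rewrite pmulr_rgt0// invr_gt0.
Unshelve. all: by end_near. Qed.

(* Along a leaf log |T|^2 is harmonic and log h is strictly subharmonic, so
   |T|^2 h has no local maximum. *)
Lemma no_leafwise_max (T : C -> C) z r : O z -> leaf_curvature h z < 0 -> 0 < r ->
  (forall y, nc (y - z.2) < r -> [/\ derivable T y 1, O (z.1, y) &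
     nc (T y) ^+ 2 * h (z.1, y) <= nc (T z.2) ^+ 2 * h z]) -> T z.2 = 0.
Proof.
(* The test is applied in the directions 1 and i. The second derivatives of log |T|^2 there are 2a
   and -2a, which is its harmonicity; adding the two inequalities contradicts the positive Laplacian
   b + c. *)
have alg (a b c : R) : 0 < b + c -> 2 * - a + c <= 0 -> 2 * a + b <= 0 -> False by lra.
move=> Oz cz r0 H; apply: contrapT => /eqP T0.
have dT y : nc (y - z.2) < r -> derivable T y 1 by move=> /H[].
have z2 : nc (z.2 - z.2) < r by rewrite subrr nc0.
have cT := continuous_derivable (dT _ z2).
have T0' : 0 < nc (T z.2) by rewrite nc_gt0.
have /continuous_ncP /(_ _ T0')[d d0 dP] := cT.
pose s := Num.min r d; have s0 : 0 < s by rewrite lt_min r0.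
have Tn y : nc (y - z.2) < s -> T y != 0.
  rewrite lt_min => /andP[_ /dP]; apply: contraTN => /eqP ->.
  by rewrite sub0r ncN ltxx.
have sr y : nc (y - z.2) < s -> nc (y - z.2) < r by rewrite lt_min => /andP[].
set g := fun w => (ln (h w))%:C : C; have sg : smooth_in O g := smooth_ln.
(* The logarithmic derivative of T: in direction c, log |T|^2 has first derivative 2 Re(c q) and
   second derivative 2 Re(c^2 q'). *)
pose q y := 'D_1 T y * (T y)^-1.
have dq : derivable q z.2 1.
  have h1 := derivableP (holo_derivable r0 dT).
  have h2 := is_derive_compC (is_derive_invc T0) (derivableP (dT _ z2)).
  have h3 := is_deriveM h1 h2; exact: (ex_derive (is_derive := h3)).
have key (c : C) : nc c = 1 -> 2 * Re (c * (c * 'D_1 q z.2)) + Re (D (0, c) (D (0, c) g) z) <= 0.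
  move=> c1; pose v : C2 R := (0, c).
  have zt (t : R) : z + t%:C *: v = (z.1, z.2 + t%:C * c).
    by apply: c2P; rewrite ?fstD ?sndD ?fstZ ?sndZ ?mulr0 ?addr0.
  have near (t : R) : `|t| < s -> nc (z.2 + t%:C * c - z.2) < s.
    by move=> ts; rewrite addrAC subrr add0r ncM c1 mulr1 nc_real.
  apply: (@second_derivative_test R
    (fun t => ln (nc (T (z.2 + t%:C * c)) ^+ 2) + Re (g (z + t%:C *: v)))
    (fun t => 2 * Re (c * q (z.2 + t%:C * c)) + Re (D v g (z + t%:C *: v))) s _ s0).
  - move=> t /near ts.
    have k1 := cder_comp_holo (derivableP (dT _ (sr _ ts))) (cder_line z.2 c t).
    have k2 := is_derive_ln_nc2 k1 (Tn _ ts).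
    have [_ Ot _] := H _ (sr _ ts).
    have Ot' : O (z + t%:C *: v) by rewrite zt.
    have /cderP[k3 _] := rder_line (smooth_rder v sg Ot').
    apply: (is_derive_eq (is_deriveD k2 k3)).
    by congr (2 * Re _ + _); rewrite /q [RHS]mulrCA mulrA.
  - have E0 : z.2 + (0%:C : C) * c = z.2 by rewrite mul0r addr0.
    have dq0 : is_derive (z.2 + (0%:C : C) * c) 1 q ('D_1 q z.2) by rewrite E0; exact: derivableP.
    have k1 := cderMl c (cder_comp_holo dq0 (cder_line z.2 c 0)).
    have /cderP[k2 _] := k1.
    have /cderP[k3 _] := smooth_rder v (smooth_rderive v sg) Oz.
    apply: (is_derive_eq (is_deriveD (is_deriveZ 2 k2) k3)).
    by congr (2 * Re (c * _) + _); rewrite mulrC.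
  - move=> t /near ts; rewrite !zt /g /= mul0r addr0 -surjective_pairing.
    have [_ Ot le] := H _ (sr _ ts).
    have zs : nc (z.2 - z.2) < s by rewrite subrr nc0.
    rewrite -!lnM ?posrE ?exprn_gt0 ?nc_gt0 ?h0 ?Tn//.
    rewrite ler_ln// posrE mulr_gt0 ?exprn_gt0 ?nc_gt0 ?h0 ?Tn//.
have := key 1 (nc1 R); have := key 'i (nci R); have := leaf_curvature_lt0 Oz cz.
rewrite -/g -/e3 -/e4 !mul1r mulrA -expr2 sqrCi mulN1r cReN.
exact: alg.
Qed.

End Subharmonic.

Section Energy.
Variables (R : realType) (X : topologicalType) (F : foliatedSurface R X).
Local Notation C := (cplx R).
Local Notation D := (@real_derive R).
Local Notation e1 := (e1 R).
Local Notation e3 := (e3 R).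
Local Notation e4 := (e4 R).
Local Notation ph := (@phi R X F).
Local Notation ps := (@psi R X F).
Local Notation dm := (@dom R X F).
Implicit Types (a b : chart F) (z v w : C2 R) (Phi : C2 R -> X).

(** The conjugated factor does no harm: u_1 is constant along the leaves, because its leafwise
    derivatives are x-derivatives of those of u. *)
Lemma slope_tensor_leaf_holo Phi a : class_C F Phi -> smooth_immersion F Phi ->
  leaf_holo (cyl Phi a) (slope_tensor Phi a).
Proof.
move=> cP sm; have oO := @cyl_open _ _ _ _ sm a.
have sf := cf_smooth_in sm a; have hf := @cf_leaf_holo _ _ _ _ cP a.
have n3 w : cyl Phi a w -> D e3 (cf Phi a) w != 0 by exact: cf_e3_neq0.
have n1 w : cyl Phi a w -> D e1 (cu Phi a) w != 0 by exact: cu_e1_neq0.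
have su : smooth_in (cyl Phi a) (cu Phi a) by move=> k; exact: cu_smooth.
have su1 := smooth_rderive e1 su.
have ss := smooth_slope oO sf n3; have hs := leaf_holo_slope oO sf hf n3.
have s3 := smooth_rderive e3 sf; have h3 := leaf_holo_rderive oO e3 sf hf.
have ss3 := smooth_rderive e3 ss; have hs3 := leaf_holo_rderive oO e3 ss hs.
apply: (leaf_holoM).
- by move=> k; apply: (class_Ck_conj oO); apply: (class_CkV oO n1); exact: su1.
- apply: (smoothM oO); first exact: (smooth_rderive e3 ss3).
  exact: (smoothV oO n3 s3).
- move=> z az; have zero v : (forall w, cyl Phi a w -> D v (cu Phi a) w = 0) ->
      D v (fun w => (D e1 (cu Phi a) w)^-1^*) z = 0.
    move=> v0; have E : D v (D e1 (cu Phi a)) z = 0.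
      rewrite (real_derive_comm e1 v oO az (su 2%N)).
      by rewrite (real_derive_eq oO e1 az v0) (rderE (rder_cst _ _ _)).
    have := rder_conj (rderV (n1 z az) (smooth_rder v su1 az)).
    by move/rderE ->; rewrite E mulr0 rmorph0.
  rewrite !zero ?mulr0// => w aw; have [r3 r4] := cu_e34 cP aw; exact: rderE.
- apply: (leaf_holoM).
  + exact: (smooth_rderive e3 ss3).
  + exact: (smoothV oO n3 s3).
  + exact: (leaf_holo_rderive oO e3 ss3 hs3).
  + exact: (leaf_holoV s3 n3 h3).
Qed.

Lemma E_frame_fiber a (p : X) : dm a p -> E_fiber (F := F) p (E_frame a).
Proof.
move=> ap; split.
- by move=> Z Y [_ Z0] _; rewrite /E_frame Z0// rmorph0 mul0r.
- move=> c Z Z' Y _ _ _; rewrite /E_frame fstD fstZ rmorphD rmorphM mulrDl mulrA.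
  by [].
- by move=> c Z Y Y' _ _ _; rewrite /E_frame sndD sndZ mulrDr mulrCA.
Qed.

Lemma tangent_fst a b (p : X) Z : dm a p -> dm b p -> tangent (F := F) p Z ->
  (Z b).1 = (Z a).1 * tr1 a b p.
Proof. by move=> ap bp /(_ a b ap bp) ->; exact: (dtr_x1 (Z a) ap bp). Qed.

Lemma tangentF_snd a b (p : X) Y : dm a p -> dm b p -> tangentF (F := F) p Y ->
  (Y b).2 = (Y a).2 * tr2 a b p.
Proof.
move=> ap bp [/(_ a b ap bp) -> /(_ a ap) Y0].
have -> : Y a = (0, (Y a).2) by rewrite -Y0 -surjective_pairing.
exact: (congr1 snd (dtr_y (Y a).2 ap bp)).
Qed.

Lemma E_frame_transition a b (p : X) Z Y : dm a p -> dm b p -> tangent (F := F) p Z ->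
  tangentF (F := F) p Y ->
  E_frame b Z Y = (tr1 a b p)^* * tr2 a b p * E_frame a Z Y.
Proof.
move=> ap bp tZ tY; rewrite /E_frame (tangent_fst ap bp tZ) (tangentF_snd ap bp tY).
have -> : ((Z a).1 * tr1 a b p)^* = (Z a).1^* * (tr1 a b p)^* by rewrite rmorphM.
by ring.
Qed.

Hypothesis class_C_smooth : forall Phi, class_C F Phi -> smooth_immersion F Phi.
Hypothesis leaves_parabolic : forall p : X, parabolic F (leaf F p).
Variable N : X -> ((chart F -> C2 R) -> (chart F -> C2 R) -> C) -> R.
Hypothesis hN : hermitian_metric_E N.
Hypothesis curv : forall a z, (ph a @` dm a) z ->
  leaf_curvature (fun w => N (ps a w) (E_frame a)) z < 0.

Lemma metric_frame_gt0 a (p : X) : dm a p -> 0 < N p (E_frame a).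
Proof.
move=> ap; case: hN => _ _ + _; apply; first exact: E_frame_fiber.
move=> /(_ (tangent_of a p (1, 0)) (tangent_of a p (0, 1)) (tangent_ofP _ ap) (tangentF_of _ ap)).
rewrite /E_frame /tangent_of !dtr_id//= rmorph1 mulr1 => /eqP.
by rewrite oner_eq0.
Qed.

Lemma metric_frame_transition a b (p : X) : dm a p -> dm b p ->
  N p (E_frame b) = (nc (tr1 a b p) * nc (tr2 a b p)) ^+ 2 * N p (E_frame a).
Proof.
move=> ap bp; case: hN => H1 H2 _ _.
pose c := (tr1 a b p)^* * tr2 a b p.
have -> : N p (E_frame b) = N p (fun Z Y => c * E_frame a Z Y).
  apply: H1; first exact: E_frame_fiber.
    have [f1 f2 f3] := E_frame_fiber ap; split.
    - by move=> Z Y tZ tY; rewrite f1// mulr0.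
    - by move=> k Z Z' Y tZ tZ' tY; rewrite f2// mulrDr mulrCA.
    - by move=> k Z Y Y' tZ tY tY'; rewrite f3// mulrDr mulrCA.
  by move=> Z Y tZ tY; exact: E_frame_transition.
have := H2 p _ c (E_frame_fiber ap); rewrite normE -rmorphXn -rmorphM /= => /complexI ->.
by rewrite /c ncM nc_conj.
Qed.

(** The squared norm of T dxbar (x) dy. Independence of the chart holds because T and the frame
    transform by inverse factors. *)
Definition energy a q : R := nc (tensor a q) ^+ 2 * N q (E_frame a).

Lemma energy_transition a b q : dm a q -> dm b q -> energy a q = energy b q.
Proof.
move=> aq bq; rewrite /energy (metric_frame_transition aq bq).
rewrite (tensor_transition class_C_smooth leaves_parabolic aq bq) !ncM nc_conj.
move: (nc (tensor b q)) (nc (tr1 a b q)) (nc (tr2 a b q)) (N q _) => s t x y.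
by ring.
Qed.

Lemma energy_ge0 a q : dm a q -> 0 <= energy a q.
Proof. by move=> aq; rewrite mulr_ge0 ?sqr_ge0// ltW// metric_frame_gt0. Qed.

Lemma energy_eq0 a q : dm a q -> energy a q = 0 -> tensor a q = 0.
Proof.
move=> aq /eqP; rewrite mulf_eq0 (gt_eqF (metric_frame_gt0 aq)) orbF sqrf_eq0.
by rewrite nc_eq0 => /eqP.
Qed.

Definition energy_at q : R := energy (sval (cid (dom_cover F q))) q.

Lemma energy_atE a q : dm a q -> energy_at q = energy a q.
Proof. by move=> aq; apply: energy_transition => //; exact: (svalP (cid (dom_cover F q))). Qed.

Lemma metric_smooth a : smooth_in (ph a @` dm a) (fun z => (N (ps a z) (E_frame a))%:C).
Proof. by case: hN => _ _ _ H k; exact: H. Qed.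

Lemma energy_at_continuous q : {for q, continuous energy_at}.
Proof.
have [a aq] := dom_cover F q.
pose k p : R := nc (tensor a p) * nc (tensor a p) * N (ps a (ph a p)) (E_frame a).
have ck : {for q, continuous k}.
  apply: (@cvgM R X (nbhs q)).
    have c1 : {for q, continuous (fun p => nc (tensor a p))}.
      apply: (@continuous_comp X C R (tensor a) nc); last exact: continuous_nc.
      exact: tensor_continuous.
    exact: (@cvgM R X (nbhs q) (nbhs_filter q) _ _ _ _ c1 c1).
  have c2 := class_Ck_cont (metric_smooth a 0%N) (phi_cod aq).
  have c3 := @continuous_comp (C2 R) C R _ (@complex.Re R) _ c2 (@continuous_Re R _).
  exact: (@continuous_comp X (C2 R) R (ph a) _ q (phi_continuous aq) c3).
have E : \forall p \near q, k p = energy_at p.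
  have : \forall p \near q, dm a p by apply: open_nbhs_nbhs; split=> //; exact: dom_open.
  by apply: filterS => p ap; rewrite (energy_atE ap) /k -expr2 phiK.
have Eq : k q = energy_at q := nbhs_singleton E.
have H : energy_at @ nbhs q --> k q := cvg_trans (near_eq_cvg E) ck.
rewrite Eq in H; exact: H.
Qed.

(** On a plaque, T is its expression on a cylinder composed with the local inverse [G] of the leaf
    covering; both are holomorphic in the leaf coordinate. *)
Lemma tensor_leafwise q a : dm a q -> exists2 r : R, 0 < r & forall y,
  nc (y - (ph a q).2) < r -> (ph a @` dm a) ((ph a q).1, y) /\
  derivable (fun y => tensor a (ps a ((ph a q).1, y))) y 1.
Proof.
move=> aq; have [Phi [cP E]] := cylinder_through leaves_parabolic q.
have sm := class_C_smooth cP; have oO := @cyl_open _ _ _ _ sm a.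
have aq' : dm a (Phi (0, 0)) by rewrite E.
have [p up] := cylinder_covering cP (@cylinder0 R).
have [G [d d0 GP]] := covering_chart_inverse up aq'.
have Gy y : nc y < d -> is_derive (ph a (Phi (0, y))).2 1 G
    ('D_1 (fun y => (ph a (Phi (0, y))).2) y)^-1.
  move=> yd; have yd' : nc (y - 0) < d by rewrite subr0.
  have [[ay _] G1 G2 G3] := GP y yd'.
  have [d1 n1] := covering_derivable up ay.
  exact: (is_derive_inverseC (derivableP d1) n1 G1 G2 G3).
have d00 : nc (0 - 0 : C) < d by rewrite subrr nc0.
have [_ G1 G2 G3] := GP 0 d00; rewrite E in G1 G2 G3.
have n1 : \forall h \near (ph a q).2, nc (G h) < d.
  have := (@cvg_ncP R C (nbhs (ph a q).2) (nbhs_filter _) _ _).1 G2 d d0; rewrite G1.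
  by apply: filterS => h; rewrite subr0.
have [s s0 sP] := (nbhs_nc2P _ _).1 (overlap_near aq aq).
have nG : nbhs (ph a q).2 [set h | nc (G h) < d /\ (ph a (Phi (0, G h))).2 = h].
  by apply: filterI; [exact: n1|exact: G3].
have [r r0 rP] := (nbhs_ncP _ _).1 nG.
exists (Num.min r s); first by rewrite lt_min r0.
have good y : nc (y - (ph a q).2) < r ->
    ps a ((ph a q).1, y) = Phi (0, G y) /\ cyl Phi a (0, G y).
  move=> /rP[yd yE]; have yd' : nc (G y - 0) < d by rewrite subr0.
  have [[ay a1] _ _ _] := GP _ yd'; rewrite E in a1.
  split; last by split=> //; exact: cylinder0.
  have -> : ((ph a q).1, y) = ph a (Phi (0, G y)) by apply: c2P; rewrite /= ?a1 ?yE.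
  exact: phiK.
move=> y; rewrite lt_min => /andP[yr ys]; split.
  have [|x [ax _] <-] := sP ((ph a q).1, y) _ ys; first by rewrite subrr nc0.
  exact: phi_cod.
have [yE cy] := good y yr; have [yd yG] := rP y yr.
have dT := slice_y oO cy (slope_tensor_smooth a cP sm 1) (slope_tensor_leaf_holo cP sm cy).
have dG := Gy (G y) yd; rewrite yG in dG.
have dTG := @is_derive_compC R (fun y => slope_tensor Phi a (0, y)) G y _ _ dT dG.
apply: (near_eq_derivable (f := (fun y => slope_tensor Phi a (0, y)) \o G)).
  apply/nbhs_ncP; exists (r - nc (y - (ph a q).2)); first by rewrite subr_gt0.
  move=> x xy; have [|-> cx] := good x; last by rewrite (tensorE class_C_smooth cP cx).
  have := ncD (x - y) (y - (ph a q).2); rewrite addrA subrK => h.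
  by apply: le_lt_trans h _; rewrite -ltrBrDr.
exact: (ex_derive (is_derive := dTG)).
Qed.

Lemma tensor_eq0 : compact [set: X] -> forall a q, dm a q -> tensor a q = 0.
Proof.
move=> cX a q aq; have X0 : [set: X] !=set0 by exists q.
have cE : {within [set: X], continuous energy_at}.
  by apply: continuous_subspaceT => p; exact: energy_at_continuous.
have [m _ mM] := compact_EVT_max X0 cX cE.
have M p : energy_at p <= energy_at m by apply: mM; rewrite inE.
suff E0 : energy_at m = 0.
  apply: (energy_eq0 aq); apply/eqP; rewrite eq_le energy_ge0// andbT.
  by rewrite -(energy_atE aq) -E0.
have [b bm] := dom_cover F m; rewrite (energy_atE bm).
have [r r0 rP] := tensor_leafwise bm.
suff T0 : tensor b m = 0 by rewrite /energy T0 nc0 expr0n mul0r.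
have h0 z : (ph b @` dm b) z -> 0 < N (ps b z) (E_frame b).
  by move=> /psi_dom[bz _]; exact: metric_frame_gt0.
have := @no_leafwise_max R _ _ (@cod_open R X F b) h0 (metric_smooth b)
  (fun y => tensor b (ps b ((ph b m).1, y))) (ph b m) r (phi_cod bm) (curv (phi_cod bm)) r0.
rewrite -surjective_pairing phiK//; apply => y yr; have [cy dy] := rP y yr; split=> //.
have [by_ _] := psi_dom cy.
by have := M (ps b ((ph b m).1, y)); rewrite (energy_atE by_) (energy_atE bm).
Qed.

End Energy.

(** * Holomorphy of the cylinders and vanishing of Gamma *)

Section HolomorphicCylinders.
Variables (R : realType) (X : topologicalType) (F : foliatedSurface R X).
Local Notation C := (cplx R).
Local Notation D := (@real_derive R).
Local Notation e1 := (e1 R).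
Local Notation e2 := (e2 R).
Local Notation e3 := (e3 R).
Local Notation e4 := (e4 R).
Local Notation ph := (@phi R X F).
Local Notation dm := (@dom R X F).
Implicit Types (a b : chart F) (z v w : C2 R).
Variable Phi : C2 R -> X.
Hypotheses (cP : class_C F Phi) (sm : smooth_immersion F Phi).
Hypothesis slope_affine : forall a z, cyl Phi a z ->
  D e3 (D e3 (slope (cf Phi a))) z = 0.

(** Uniqueness along a whole leaf for a family given chart by chart: zero leafwise derivative and
    zero value on y = 0. It is used first for mu_3, then for mu. *)
Lemma leafwise_zero (s : chart F -> C2 R -> C) :
  (forall a b z, cyl Phi a z -> cyl Phi b z -> s b z = s a z) ->
  (forall a z, cyl Phi a z -> is_derive z.2 1 (fun y => s a (z.1, y)) 0) ->
  (forall a x, cyl Phi a (x, 0) -> s a (x, 0) = 0) ->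
  forall a z, cyl Phi a z -> s a z = 0.
Proof.
move=> sE ds s0 a [x y0] az; have [dx _] := az.
pose P y := forall b, cyl Phi b (x, y) -> s b (x, y) = 0.
suff H y : P y by exact: H.
apply: (@locally_constant_prop R P _ 0); last by move=> b; exact: s0.
move=> {}y.
have cy : cylinder (x, y) by [].
have [b bz] := cyl_chart F Phi cy.
have [d d0 dP] := cyl_box sm bz; exists d => // y' yd.
have inc u : nc (u - y) < d -> cyl Phi b (x, u).
  by move=> ud; apply: dP => //=; rewrite subrr nc0.
have E : s b (x, y') = s b (x, y).
  have := @zero_derive_eq R (fun u => s b (x, u)) y (y' - y); rewrite subrKC; apply=> t t01.
  have td : nc (y + t%:C * (y' - y) - y) < d.
    rewrite addrAC subrr add0r ncM nc_real ger0_norm; last by case/andP: t01.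
    apply: le_lt_trans yd; apply: ler_piMl; first exact: nc_ge0.
    by case/andP: t01.
  exact: (ds b _ (inc _ td)).
have bz' := inc _ yd.
by split=> Py c cz; rewrite (sE b c)// ?E ?Py// -E Py.
Qed.

(** On y = 0, f is a coordinate of the disk p and f_3 is a coordinate of the trivialization t; both
    are holomorphic in x. *)
Lemma dxbar2_cf0 a (x : C) : cyl Phi a (x, 0) ->
  dxbar2 (cf Phi a) (x, 0) = 0 /\ dxbar2 (D e3 (cf Phi a)) (x, 0) = 0.
Proof.
move=> az; have [dx _] := az; have oO := @cyl_open _ _ _ _ sm a.
have [p [t [[_ dp _ _] tr H]]] := cP.
have [_ P0 _] := H x dx.
have ap : dm a (p x) by rewrite -P0; case: az.
have near : \forall s \near x, cyl Phi a (s, 0).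
  have [d d0 dP] := cyl_box sm az; apply/nbhs_ncP; exists d => // s sd.
  have z0 : nc (0 - 0 : C) < d by rewrite subrr nc0.
  exact: (dP (s, 0) sd z0).
have zero (g : C2 R -> C) l : is_derive x 1 (fun s : C => g (s, 0)) l -> dxbar2 g (x, 0) = 0.
  move=> dg; have [r1 r2] := @slice_x_rder R g (x, 0) _ dg.
  by rewrite /dxbar2 (rderE r1) (rderE r2) mulrA -expr2 sqrCi mulN1r subrr.
split.
- have [d1 _] := dp x a dx ap; have [_ d2] := is_derive_pairP d1.
  apply: (zero _ ('D_1 (ph a \o p) x).2); apply: (is_derive_near _ d2).
  by apply: filterS near => s [ds _]; have [_ Ps _] := H s ds; rewrite /cf Ps.
have [_ /(_ a ap)[_ dt]] := tr x dx; have [_ d2] := is_derive_pairP dt.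
apply: (zero _ ('D_1 (fun s => t s a) x).2); apply: (is_derive_near _ d2).
apply: filterS near => s az'; have [ds as_] := az'; have [_ Ps Ht] := H s ds.
have aps : dm a (p s) by rewrite -Ps.
have [h3 h4] := cu_e34 cP az'.
have E4 : D e4 (cu Phi a) (s, 0) = 'i * D e3 (cu Phi a) (s, 0).
  by rewrite (rderE h3) (rderE h4) mulr0.
have k1 := slice_y oO az' (cu_smooth sm 1 a) E4.
have [k2 _] := cf_slice cP az'.
have k3 := is_derive_pair k1 k2.
have <- : 'D_1 (fun y => ph a (Phi (s, y))) 0 = t s a by exact: Ht.
have -> : (fun y => ph a (Phi (s, y))) = (fun y => (cu Phi a (s, y), cf Phi a (s, y)) : C2 R).
  by apply/funext => y; rewrite -surjective_pairing.
by have := derive_val (is_derive := k3) => /= ->.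
Qed.

Lemma dxbar2_cf a z : cyl Phi a z -> dxbar2 (cf Phi a) z = 0.
Proof.
move=> az; have [dx _] := az.
have sf b := cf_smooth_in sm b; have hf b := @cf_leaf_holo _ _ _ _ cP b.
have oO b := @cyl_open _ _ _ _ sm b.
have n3 b w : cyl Phi b w -> D e3 (cf Phi b) w != 0 by exact: cf_e3_neq0.
have ss b := smooth_slope (oO b) (sf b) (n3 b).
have hs b := leaf_holo_slope (oO b) (sf b) (hf b) (n3 b).
have ss3 b := smooth_rderive e3 (ss b).
have hs3 b := leaf_holo_rderive (oO b) e3 (ss b) (hs b).
have slope0 b x : cyl Phi b (x, 0) -> slope (cf Phi b) (x, 0) = 0.
  by move=> bz; rewrite /slope (dxbar2_cf0 bz).1 oppr0 mul0r.
(* By the quotient rule mu_3 is a combination of B f_3 and B f, after exchanging B with the leafwise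
   derivative. *)
have slope30 b x : cyl Phi b (x, 0) -> D e3 (slope (cf Phi b)) (x, 0) = 0.
  move=> bz; have sX := smooth_dxbar2 (oO b) (sf b).
  have r1 := smooth_rder e3 sX bz.
  have r2 := rderV (n3 b _ bz) (smooth_rder e3 (smooth_rderive e3 (sf b)) bz).
  have r3 := rderM r1 r2.
  have r4 := rderZ (-1) r3.
  have -> : slope (cf Phi b) = (fun w => -1 * (dxbar2 (cf Phi b) w * (D e3 (cf Phi b) w)^-1)).
    by apply/funext => w; rewrite /slope mulN1r mulNr.
  rewrite (rderE r4) -(dxbar2_comm (oO b) e3 (sf b) bz).
  by rewrite (dxbar2_cf0 bz).1 (dxbar2_cf0 bz).2 !mul0r addr0 mulr0.
have step1 b w : cyl Phi b w -> D e3 (slope (cf Phi b)) w = 0.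
  move: b w; apply: leafwise_zero => [c c' w cw cw'|c w cw|c x cz].
  - by have [] := slope_D_transition cP sm cw cw'.
  - by rewrite -(slope_affine cw); exact: (slice_y (oO c) cw (ss3 c 1%N) (hs3 c w cw)).
  - exact: slope30.
have step2 b w : cyl Phi b w -> slope (cf Phi b) w = 0.
  move: b w; apply: leafwise_zero => [c c' w cw cw'|c w cw|c x cz].
  - exact: (slope_transition cP sm cw cw').
  - by rewrite -(step1 c w cw); exact: (slice_y (oO c) cw (ss c 1%N) (hs c w cw)).
  - exact: slope0.
have := step2 a z az; rewrite /slope => /eqP; rewrite mulf_eq0 invr_eq0 (negbTE (n3 a z az)) orbF.
by rewrite oppr_eq0 => /eqP.
Qed.

Lemma cf_e2 a z : cyl Phi a z -> D e2 (cf Phi a) z = 'i * D e1 (cf Phi a) z.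
Proof.
move=> /dxbar2_cf /(congr1 (fun t => 'i * t)); rewrite /dxbar2 mulr0 mulrDr mulrA -expr2 sqrCi.
by rewrite mulN1r => /eqP; rewrite subr_eq0 => /eqP.
Qed.

Lemma cylinder_differentiable a z : cyl Phi a z -> differentiable (ph a \o Phi) z /\
  forall v, 'D_v (ph a \o Phi) z = 0 -> v = 0.
Proof.
move=> az; have oO := @cyl_open _ _ _ _ sm a.
have [h3 h4] := cu_e34 cP az.
have E4 : D e4 (cu Phi a) z = 'i * D e3 (cu Phi a) z by rewrite (rderE h3) (rderE h4) mulr0.
have [d1 D1] := real_derive_differentiable oO az (cu_smooth sm 1 a) (cu_e2 cP sm az) E4.
have [d2 D2] := real_derive_differentiable oO az (cf_smooth sm 1 a) (cf_e2 az) (cf_e4 cP az).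
have E : ph a \o Phi = (fun w => (cu Phi a w, cf Phi a w)).
  by apply/funext => w; rewrite -surjective_pairing.
have df : differentiable (ph a \o Phi) z by rewrite E; exact: differentiable_pair.
split=> // v v0; have [cz ap] := az; have [_ _ imm] := sm.
have [p1 p2] := is_derive_pairP (diff_derivable (v := v) df).
apply: (imm z a v cz ap).
- rewrite -[LHS](D1 v); have := derive_val (is_derive := p1); rewrite v0; exact.
- rewrite -[LHS](D2 v); have := derive_val (is_derive := p2); rewrite v0; exact.
Qed.

Lemma class_C_holomorphic_cylinder : holomorphic_cylinder F Phi.
Proof.
split; last by move=> x dx; have [p [[_ rf _] _]] := cylinder_covering cP dx; exists p.
split; first by move=> z cz; exact: (cylinder_continuous sm cz).
by move=> z a cz az; exact: cylinder_differentiable.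
Qed.

End HolomorphicCylinders.

(** * The forms of the invariant for holomorphic cylinders *)

Section GammaForm.
Variables (R : realType) (X : topologicalType) (F : foliatedSurface R X).
Local Notation C := (cplx R).
Local Notation D := (@real_derive R).
Local Notation e1 := (e1 R).
Local Notation e2 := (e2 R).
Local Notation e3 := (e3 R).
Local Notation ph := (@phi R X F).
Local Notation ps := (@psi R X F).
Local Notation dm := (@dom R X F).
Implicit Types (a b : chart F) (z v w : C2 R).

Lemma rder_snd v z : rder v (fun w : C2 R => w.2) z v.2.
Proof.
have := cder_line z.2 v.2 0; apply: cder_eq => t.
by rewrite sndD sndZ.
Qed.

Lemma class_C1_snd (O : set (C2 R)) : open O -> class_Ck 1 O (fun w : C2 R => w.2).
Proof.
move=> oO; apply: (class_Ck_intro oO); first by move=> z _; exact: cvg_snd.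
by move=> v; exists (fun=> v.2); [move=> z _; exact: rder_snd|exact: class_Ck_cst].
Qed.

Lemma Gamma_form_eq0 (g : C2 R -> C) (O : set (C2 R)) : open O ->
  (forall z Z, O z -> D ('i *: Z) g z = 'i * D Z g z) ->
  forall z Z Y, O z -> Gamma_form g z Z Y = 0.
Proof.
move=> oO H.
have L Z z : O z -> lambda_form g z Z = 0.
  by move=> Oz; rewrite /lambda_form H// subrr.
have zero (f : C2 R -> C) v z : O z -> (forall w, O w -> f w = 0) -> D v f z = 0.
  move=> Oz f0; rewrite (real_derive_eq oO v Oz (g := fun=> 0) f0).
  exact: rderE (rder_cst _ _ _).
have A Z z : O z -> A_form g z Z = 0.
  move=> Oz; rewrite /A_form /ext_d.
  rewrite (zero (fun w => lambda_form g w (0, 1)) Z z Oz (L _)).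
  by rewrite (zero (fun w => lambda_form g w Z) (0, 1) z Oz (L _)) subrr mul0r.
move=> z Z Y Oz; rewrite /Gamma_form /ext_d.
rewrite (zero (fun w => A_form g w Y) Z z Oz (A _)).
by rewrite (zero (fun w => A_form g w Z) Y z Oz (A _)) subrr.
Qed.

Variable Phi : C2 R -> X.
Hypotheses (cP : class_C F Phi) (sm : smooth_immersion F Phi).
Hypothesis holo : forall a z, cyl Phi a z -> D e2 (cf Phi a) z = 'i * D e1 (cf Phi a) z.

Lemma inverse_rder a V G (q : X) v : local_inverse Phi V G -> V q -> dm a q ->
  D v (fun z => (G (ps a z)).2) (ph a q) =
  (v.2 - v.1 / D e1 (cu Phi a) (G q) * D e1 (cf Phi a) (G q)) / D e3 (cf Phi a) (G q).
Proof.
move=> [U [[oU UC] _ [oV _] UV VU]] Vq aq; have [Uq Gq] := VU q Vq.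
have az : cyl Phi a (G q) by split; [exact: UC|rewrite /preimage /= Gq].
have oO : open (cyl Phi a `&` U) by apply: openI => //; exact: cyl_open.
have OO : cyl Phi a `&` U `<=` cyl Phi a by move=> w [].
have K w : (cyl Phi a `&` U) w ->
    (G (ps a (tri_map (cu Phi a) (cf Phi a) w))).2 = (fun w : C2 R => w.2) w.
  move=> [[_ aw] Uw]; rewrite /tri_map -surjective_pairing phiK//.
  by have [_ ->] := UV w Uw.
have := @tri_rder R _ _ _ _ _ _ oO (conj az Uq) (class_Ck_sub OO (cu_smooth sm 1 a))
  (class_Ck_sub OO (cf_smooth sm 1 a)) (cu_e1_neq0 cP sm az) (cf_e3_neq0 cP az)
  (fun v => cu_rlin cP sm v az) (fun v => cf_rlin cP v az) _
  (fun z => (G (ps a z)).2) v (class_C1_snd oO) K.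
rewrite /tri_map -surjective_pairing Gq => /rderE ->.
rewrite -(real_derive_rlin _ oO (conj az Uq) (class_C1_snd oO)) (rderE (rder_snd _ _)).
by rewrite tri_invE2 (rlin_holo_x _ (holo az)).
Qed.

Lemma inverse_Gamma_form a V G (q : X) Z Y : local_inverse Phi V G -> V q -> dm a q ->
  Gamma_form (fun z => (G (ps a z)).2) (ph a q) Z Y = 0.
Proof.
move=> LI Vq aq; pose O := ph a @` dm a `&` [set z | (ph a @` dm a) z /\ V (ps a z)].
have oV : open V by case: LI => U [_ _ []].
have oO : open [set z | (ph a @` dm a) z /\ V (ps a z)].
  rewrite openE => z [az Vz]; apply: filterI.
    by apply: open_nbhs_nbhs; split=> //; exact: cod_open.
  by apply: (psi_continuous az); exact: open_nbhs_nbhs.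
apply: (Gamma_form_eq0 oO); last by split; [exact: phi_cod|rewrite phiK].
move=> z W [/psi_dom[az zE] Vz]; rewrite -zE.
rewrite !(inverse_rder _ LI Vz az) fstZ sndZ.
move: (D e1 (cu Phi a) _) (D e1 (cf Phi a) _) (D e3 (cf Phi a) _) (W.1) (W.2).
move=> s t x y y'; rewrite mulrA; congr (_ / _).
by rewrite mulrBr !mulrA.
Qed.

End GammaForm.

Section LocalInverse.
Variables (R : realType) (X : topologicalType) (F : foliatedSurface R X).
Hypothesis class_C_smooth : forall Phi, class_C F Phi -> smooth_immersion F Phi.

(** [is_Gamma] constrains the tensor only at points of some set V with a local inverse. Together
    with the cylinders through every point, this lemma makes the constraint reach all of X. *)
Lemma local_inverse_exists (Phi : C2 R -> X) : class_C F Phi ->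
  exists V G, local_inverse Phi V G.
Proof.
move=> cP; have sm := class_C_smooth cP.
have [a az] := cyl_chart F Phi (@cylinder0 R).
have [r [k [r0 k0 rO inj _]]] := tri_local_inverse (@cyl_open _ _ _ _ sm a) az
  (cu_smooth sm 1 a) (cf_smooth sm 1 a) (cu_e1_neq0 cP sm az) (cf_e3_neq0 cP az)
  (fun v => cu_rlin cP sm v az) (fun v => cf_rlin cP v az).
pose U := [set w : C2 R | n2 (w - (0, 0)) < r].
have Uinj w w' : U w -> U w' -> Phi w = Phi w' -> w = w'.
  move=> Uw Uw' E; apply/eqP; rewrite -subr_eq0; apply/eqP; apply: n2_eq0.
  apply/eqP; rewrite eq_le n2_ge0 andbT; apply: le_trans (inj w w' Uw Uw') _.
  by rewrite /tri_map /cu /cf E subrr n2_0 mulr0.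
pose G q : C2 R := get [set w | U w /\ Phi w = q].
have GP q : (Phi @` U) q -> U (G q) /\ Phi (G q) = q.
  move=> [w Uw <-]; have : [set w' | U w' /\ Phi w' = Phi w] w by [].
  exact: getI.
exists (Phi @` U), G, U; split.
- split; last by move=> w Uw; have [] := rO w Uw.
  rewrite openE => w Uw; apply/nbhs_n2P; exists (r - n2 (w - (0, 0))).
    by rewrite subr_gt0.
  move=> w' w'w; rewrite /U /=; have := n2D (w' - w) (w - (0, 0)).
  by rewrite addrA subrK => h; apply: le_lt_trans h _; rewrite -ltrBrDr.
- by rewrite /U /= subrr n2_0.
- split; last by exists (0, 0) => //; rewrite /U /= subrr n2_0.
  rewrite openE => q [w Uw <-].
  have e0 : 0 < r - n2 (w - (0, 0)) by rewrite subr_gt0.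
  have := cylinder_local_onto class_C_smooth cP (rO w Uw) e0.
  apply: filterS => q' [w' [w'w _] <-]; exists w' => //; rewrite /U /=.
  have := n2D (w' - w) (w - (0, 0)).
  by rewrite addrA subrK => h; apply: le_lt_trans h _; rewrite -ltrBrDr.
- move=> w Uw; split; first by exists w.
  have [|UG GE] := GP (Phi w); first by exists w.
  exact: Uinj.
- exact: GP.
Qed.

End LocalInverse.

Theorem proposition3p4 (R : realType) (X : topologicalType)
    (F : foliatedSurface R X)
    (X_neq0 : ([set: X] !=set0)%classic)
    (X_hausdorff : hausdorff_space X)
    (X_compact : compact [set: X]%classic)
    (leaves_parabolic : forall p : X, parabolic F (leaf F p))
    (class_C_smooth : forall Phi, class_C F Phi -> smooth_immersion F Phi)
    (E_neg : E_negative F) :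
  ((exists Gamma, is_Gamma (F := F) Gamma) /\
   (forall Gamma, is_Gamma (F := F) Gamma -> vanishes Gamma)) /\
  exists Phi, holomorphic_cylinder F Phi.
Proof.
have [N hN curv] := E_neg.
have affine Phi (cP : class_C F Phi) (a : chart F) (z : C2 R) : cyl Phi a z ->
    real_derive (e3 R) (real_derive (e3 R) (slope (cf Phi a))) z = 0.
  move=> az; have sm := class_C_smooth Phi cP; have [_ aq] := az.
  have := tensor_eq0 class_C_smooth leaves_parabolic hN curv X_compact aq.
  rewrite (tensorE class_C_smooth cP az) /slope_tensor => /eqP.
  rewrite !mulf_eq0 conjC_eq0 !invr_eq0 (negbTE (cu_e1_neq0 cP sm az)).
  by rewrite (negbTE (cf_e3_neq0 cP az)) orbF => /eqP.
have Gamma0 Phi V G (p : X) (a : chart F) Z Y : class_C F Phi -> local_inverse Phi V G ->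
    V p -> dom a p -> Gamma_form (fun z => (G (psi a z)).2) (phi a p) Z Y = 0.
  move=> cP; have sm := class_C_smooth Phi cP.
  apply: (inverse_Gamma_form cP sm) => b z bz.
  exact: (cf_e2 cP sm (affine Phi cP) bz).
split; last first.
  have [q _] := X_neq0; have [Phi [cP _]] := cylinder_through leaves_parabolic q.
  by exists Phi; exact: (class_C_holomorphic_cylinder cP (class_C_smooth Phi cP) (affine Phi cP)).
split.
  (* Every [Gamma_form] vanishes, so the zero tensor satisfies [is_Gamma]. *)
  by exists (fun _ _ _ => 0) => Phi V G cP LI p Z Y Vp _ _ a ap; rewrite (Gamma0 Phi V G).
move=> Gamma GammaP p Z Y tZ tY.
have [Phi [cP E]] := cylinder_through leaves_parabolic p.
have [V [G LI]] := local_inverse_exists class_C_smooth cP.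
have Vp : V p by case: LI => U [_ _ [_]]; rewrite E.
have [a ap] := dom_cover F p.
by rewrite (GammaP Phi V G cP LI p Z Y Vp tZ tY a ap) (Gamma0 Phi V G).
Qed.
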